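(* Let $K$ be an algebraically closed field of characteristic $0$ and let $C\subset\mathbb{P}^2$ be a smooth plane curve over $K$ of degree $d$. Assume that $d\ge 14$, $d$ is even, and $n=d/2$. Then $\delta'[\ge n]\ge 2$ if and only if $C$ is projectively equivalent to the curve defined by $$X^{2n}+Y^{2n}+Z^{2n}+aX^nY^n+bY^nZ^n+cZ^nX^n=0$$ for some $a,b,c\in K$. In this case, $\delta'[\ge n]=3$.
   Context: For $P\in\mathbb{P}^2$, $\pi_P:C\dashrightarrow\mathbb{P}^1$ is the projection from $P$, and $G[P]=\{\tau\in\mathrm{Bir}(C)\mid \pi_P\circ\tau=\pi_P\}$. $P$ is called quasi-Galois if $|G[P]|\ge 2$. For an integer $n\ge 2$, $\delta'[\ge n]$ denotes the number of quasi-Galois points $P\in\mathbb{P}^2\setminus C$ with $|G[P]|\ge n$. Two plane curves are projectively equivalent if a linear transformation of $\mathbb{P}^2$ maps one onto the other. *)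

(* Defs.v *)
From mathcomp Require Import all_boot all_order all_algebra.
From mathcomp Require Import mpoly.

Set Implicit Arguments.
Unset Strict Implicit.
Unset Printing Implicit Defensive.

Import GRing.Theory.

Local Open Scope ring_scope.

(* Cardinality of the quotient of [S] by [eqv], without forming the quotient:  *)
(* [at_least eqv S m] says that [S] has m pairwise inequivalent elements, so   *)
(* it also holds for every m when there are infinitely many classes.           *)
Definition at_least (T : Type) (eqv : T -> T -> Prop) (S : T -> Prop)
    (m : nat) : Prop :=
  exists x : 'I_m -> T,
    (forall i, S (x i)) /\ (forall i j, eqv (x i) (x j) -> i = j).

Definition exactly (T : Type) (eqv : T -> T -> Prop) (S : T -> Prop)
    (m : nat) : Prop :=
  at_least eqv S m /\ ~ at_least eqv S m.+1.

Section PlaneCurves.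

Variable K : closedFieldType.

(* A point of P^2 is a nonzero row vector up to [same_point]; the plane curve  *)
(* C is represented by a form F that defines it.                               *)

Definition same_point (v w : 'rV[K]_3) : Prop :=
  exists2 c : K, c != 0 & w = c *: v.

Definition on_curve (F : {mpoly K[3]}) (v : 'rV[K]_3) : Prop :=
  v != 0 /\ F.@[v 0] = 0.

(* When d > 0, such an F is irreducible, by Bezout's theorem. *)
Definition smooth_plane_curve (F : {mpoly K[3]}) (d : nat) : Prop :=
  [/\ F != 0, F \is d.-homog
    & forall v, on_curve F v -> exists i : 'I_3, (F^`M(i)).@[v 0] != 0].

Definition vanishes_on (F g : {mpoly K[3]}) : Prop :=
  forall v, on_curve F v -> g.@[v 0] = 0.

(* Representatives of rational maps C --> P^(k-1): k forms of the same degree, *)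
(* not all of them identically zero on C.                                      *)
Definition ratmap (F : {mpoly K[3]}) (k : nat)
    (f : k.-tuple {mpoly K[3]}) : Prop :=
  (exists m : nat, forall i, tnth f i \is m.-homog) /\
  (exists i, ~ vanishes_on F (tnth f i)).

Definition ratmap_eq (F : {mpoly K[3]}) (k : nat)
    (f g : k.-tuple {mpoly K[3]}) : Prop :=
  [/\ ratmap F f, ratmap F g
    & forall i j, vanishes_on F (tnth f i * tnth g j - tnth f j * tnth g i)].

Definition ratmap_comp (k : nat) (g : k.-tuple {mpoly K[3]})
    (f : 3.-tuple {mpoly K[3]}) : k.-tuple {mpoly K[3]} :=
  [tuple tnth g i \mPo f | i < k].

Definition ratmap_id : 3.-tuple {mpoly K[3]} := [tuple 'X_i | i < 3].

Definition self_ratmap (F : {mpoly K[3]}) (f : 3.-tuple {mpoly K[3]}) : Prop :=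
  ratmap F f /\ vanishes_on F (F \mPo f).

(* Representatives of the elements of Bir(C). As [ratmap_eq] entails that both *)
(* of its sides are [ratmap]s, the two composites are required to be defined.  *)
Definition Bir (F : {mpoly K[3]}) (f : 3.-tuple {mpoly K[3]}) : Prop :=
  self_ratmap F f /\
  exists g, [/\ self_ratmap F g,
                ratmap_eq F (ratmap_comp g f) ratmap_id
              & ratmap_eq F (ratmap_comp f g) ratmap_id].

(* Two linear forms with P as their only common zero: the projection from P,   *)
(* which is determined up to a choice of coordinates on P^1.                   *)
Definition is_projection_from (P : 'rV[K]_3)
    (l : 2.-tuple {mpoly K[3]}) : Prop :=
  (forall i, tnth l i \is 1.-homog) /\
  (forall v : 'rV[K]_3, v != 0 ->
     (forall i, (tnth l i).@[v 0] = 0) <-> same_point P v).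

(* Representatives of the elements of G[P]; two of them give the same element  *)
(* when they are related by [ratmap_eq F].                                     *)
Definition G (F : {mpoly K[3]}) (P : 'rV[K]_3)
    (tau : 3.-tuple {mpoly K[3]}) : Prop :=
  Bir F tau /\
  exists2 l, is_projection_from P l & ratmap_eq F (ratmap_comp l tau) l.

Definition order_G_ge (F : {mpoly K[3]}) (P : 'rV[K]_3) (m : nat) : Prop :=
  at_least (ratmap_eq F (k := 3)) (G F P) m.

Definition quasi_Galois (F : {mpoly K[3]}) (P : 'rV[K]_3) : Prop :=
  order_G_ge F P 2.

Definition outer_quasi_Galois_ge (F : {mpoly K[3]}) (n : nat)
    (P : 'rV[K]_3) : Prop :=
  [/\ P != 0, ~ on_curve F P, quasi_Galois F P & order_G_ge F P n].

(* delta'[>= n] is at least m, resp. equal to m *)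
Definition delta'_ge (F : {mpoly K[3]}) (n m : nat) : Prop :=
  at_least same_point (outer_quasi_Galois_ge F n) m.

Definition delta'_eq (F : {mpoly K[3]}) (n m : nat) : Prop :=
  exactly same_point (outer_quasi_Galois_ge F n) m.

Definition projectively_equivalent (F H : {mpoly K[3]}) : Prop :=
  exists2 A : 'M[K]_3, A \in unitmx
    & forall v, on_curve F v <-> on_curve H (v *m A).

Definition family_form (n : nat) (a b c : K) : {mpoly K[3]} :=
  let X : {mpoly K[3]} := 'X_0 in
  let Y : {mpoly K[3]} := 'X_1 in
  let Z : {mpoly K[3]} := 'X_2%R in
  X ^+ (2 * n) + Y ^+ (2 * n) + Z ^+ (2 * n)
  + a *: (X ^+ n * Y ^+ n) + b *: (Y ^+ n * Z ^+ n) + c *: (Z ^+ n * X ^+ n).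

End PlaneCurves.

(* Main.v *)
(* Write C : F = 0 with d = 2n.  Elements of G[P], for P outside C, are linear:  *)
(* in coordinates with P = (1 : 0 : 0) such an element is (X : Y : Z) |->        *)
(* (x' : Y : Z), where x' is homogeneous of degree 1 in the function field and   *)
(* integral over K[Y, Z], since F(x', Y, Z) = 0 and F is monic in X; as C is     *)
(* smooth the homogeneous coordinate ring is integrally closed, so x' is a       *)
(* linear form.  Normality applied to nilpotents and to idempotents also shows   *)
(* that F is squarefree and irreducible.  Hence |G[P]| >= n forces F to be       *)
(* invariant under the homologies of order n with centre P and some axis.        *)
(*   For two such points P, P', restrict F to the line PP'.  A binary form of    *)
(* degree 2n with n-fold symmetries about two different pairs of points is a     *)
(* power of a linear form (a polynomial with four terms has no nonzero root of   *)
(* multiplicity 4), and that case contradicts smoothness; so each of P, P' lies  *)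
(* on the axis of the other.  Thus two points give coordinates in which F only   *)
(* involves X^n, Y^n and Z^n, and four points are impossible.                    *)

From HB Require Import structures.
Require Import Defs.
From mathcomp Require Import all_boot all_order all_algebra.
From mathcomp Require Import mpoly.
From mathcomp Require Import separable cyclic cyclotomic.
From mathcomp Require Import zify ring.

Set Implicit Arguments.
Unset Strict Implicit.
Unset Printing Implicit Defensive.

Import GRing.Theory.

Local Open Scope ring_scope.

(** * Evaluation of ternary forms *)

(** The proof turns birational symmetries into matrices. The coordinate ring of a smooth plane curve
    is normal ([normality]), and comparing top-degree terms shows that the integral functions
    arising here are of degree at most one ([integral_degree], [integral_affine]). For P outside C
    and tau in G[P], the new first coordinate is such a function, so [linear_of_G] yields a linear
    form phi with tau(v) = v + phi(v) P on C, a map that multiplies F by a constant.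

    Two such maps with the same multiplier coincide, hence any two commute and all nontrivial ones
    share an axis ([central_inj], [central_comm]). If there are n of them, then for w on the axis
    only those powers s^k occur in F(w + s P) for which n distinct (2n)-th roots of unity alpha
    satisfy alpha^k = 1. This forces n to divide k, so F is preserved by the full cyclic group of n
    homologies with centre P and that axis ([axis_of_G]).

    Let P and P' be two such points. If P' were off the axis of P, the binary form cut out on PP'
    would be sparse in two different coordinate systems, hence the 2n-th power of a linear form
    ([two_symmetric_forms]), and C would be singular at its zero. So each point lies on the axis of
    the other ([pair_on_axis]). Points and axes are then dual vectors and covectors, whence at most
    three points ([no_four_points]). Two points, completed by the intersection of their axes, form a
    frame in which F is a quadratic form in X^n, Y^n, Z^n ([monomial_form]); smoothness makes the
    pure powers occur, and scaling makes their coefficients 1 ([family_of_two_points]).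

    Conversely, a member of the family is preserved when one coordinate is multiplied by an n-th
    root of unity, so all three coordinate points count ([three_points]). Thus two points give the
    family, the family gives three points, and four are impossible. *)

Lemma mpoly_ring_ind (n : nat) (R : nzRingType) (T : {mpoly R[n]} -> Prop) :
  (forall c, T c%:MP) -> (forall i, T 'X_i) ->
  (forall p q, T p -> T q -> T (p + q)) ->
  (forall p q, T p -> T q -> T (p * q)) -> forall p, T p.
Proof.
move=> TC TX TD TM p; rewrite (mpolyE p).
apply: (big_ind T) => [||m _]; [by rewrite -mpolyC0|exact: TD|].
rewrite -mul_mpolyC; apply: (TM); first exact: TC.
rewrite mpolyXE_id; apply: (big_ind T) => [||i _]; [by rewrite -mpolyC1|exact: TM|].
elim: (m i) => [|k IH]; first by rewrite expr0 -mpolyC1.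
by rewrite exprS; apply: TM.
Qed.

Section Mmap.

Variables (K : comNzRingType) (n : nat).

Lemma mmap_ext (A : comNzRingType) (f : {rmorphism K -> A}) (h h' : 'I_n -> A) E :
  h =1 h' -> mmap f h E = mmap f h' E.
Proof.
by move=> hh; apply: eq_bigr => m _; congr (_ * _); apply: mmap1_eq.
Qed.

Lemma mmap_comp (A B : comNzRingType) (f : {rmorphism K -> A}) (g : {rmorphism A -> B})
    (f' : {rmorphism K -> B}) (h : 'I_n -> A) (h' : 'I_n -> B) E :
  (forall c, g (f c) = f' c) -> (forall i, g (h i) = h' i) ->
  g (mmap f h E) = mmap f' h' E.
Proof.
move=> gf gh; rewrite rmorph_sum; apply: eq_bigr => m _.
rewrite rmorphM gf rmorph_prod; congr (_ * _); apply: eq_bigr => i _.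
by rewrite rmorphXn gh.
Qed.

Lemma mmap_homogM (A : comNzRingType) (f : {rmorphism K -> A}) (c : A)
    (h : 'I_n -> A) (E : {mpoly K[n]}) k :
  E \is k.-homog -> mmap f (fun i => c * h i) E = c ^+ k * mmap f h E.
Proof.
move=> /dhomogP hE; rewrite big_distrr /=; apply: eq_big_seq => m /hE <-.
rewrite mulrCA; congr (_ * _).
rewrite /= mdegE /mmap1 -prodrXr -big_split /=.
by apply: eq_bigr => i _; rewrite exprMn.
Qed.

Lemma mmap_congr (A : comNzRingType) (f : {rmorphism K -> A}) (a : A)
    (h h' : 'I_n -> A) (E : {mpoly K[n]}) :
  (forall i, exists q, h i - h' i = q * a) ->
  exists q, mmap f h E - mmap f h' E = q * a.
Proof.
move=> hh'; elim/mpoly_ring_ind: E => [c|i|p q [b Hb] [c Hc]|p q [b Hb] [c Hc]].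
- by exists 0; rewrite !mmapC subrr mul0r.
- by rewrite !mmapX !mmap1U.
- by exists (b + c); rewrite !mmapD mulrDl -Hb -Hc; ring.
- exists (b * mmap f h q + mmap f h' p * c).
  by rewrite !rmorphM /= mulrDl -(mulrA _ c) -Hc mulrAC -Hb; ring.
Qed.

End Mmap.

Lemma sizeM_top (R : comNzRingType) (p q : {poly R}) a b :
  (size p <= a.+1)%N -> (size q <= b.+1)%N -> (size (p * q)%R <= (a + b).+1)%N.
Proof.
move=> sp sq; apply: leq_trans (size_polyMleq _ _) _.
move: (size p) (size q) sp sq => x y; lia.
Qed.

Lemma coefM_top (R : comNzRingType) (p q : {poly R}) a b :
  (size p <= a.+1)%N -> (size q <= b.+1)%N -> (p * q)`_(a + b) = p`_a * q`_b.
Proof.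
move=> sp sq; have ha : (a < (a + b).+1)%N by lia.
rewrite coefM (bigD1 (Ordinal ha)) //= big1 ?addr0; first by congr (_ * _`_ _); lia.
move=> [i hi] /negPf ia; have {ia} ia : i <> a by move=> e; move: ia; rewrite -val_eqE /= e eqxx.
have [lt_ai|le_ia] := ltnP a i; first by rewrite nth_default ?mul0r //=; apply: leq_trans sp lt_ai.
by rewrite [q`__]nth_default ?mulr0 //=; apply: leq_trans sq _; lia.
Qed.

Lemma coefX_top (R : comNzRingType) (p : {poly R}) a k :
  (size p <= a.+1)%N ->
  (size (p ^+ k)%R <= (k * a).+1)%N /\ (p ^+ k)`_(k * a) = p`_a ^+ k.
Proof.
move=> sp; elim: k => [|k [IHs IHc]]; first by rewrite expr0 coef1 mul0n size_poly1.
split; last by rewrite exprS mulSn coefM_top // IHc exprS.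
by rewrite exprS mulSn sizeM_top.
Qed.

(** Leading terms cannot cancel unexpectedly: a form of degree k in polynomials of degree at most e
    has as its coefficient of degree k e the form in their e-th coefficients. The comparisons of
    degrees below, in x, along lines and at infinity, are instances. *)
Lemma mmap_top (K A : comNzRingType) (n : nat) (f : {rmorphism K -> A})
    (g : {rmorphism K -> {poly A}}) (h : 'I_n -> {poly A}) (E : {mpoly K[n]}) k e :
    (forall c, g c = (f c)%:P) -> E \is k.-homog -> (forall i, (size (h i) <= e.+1)%N) ->
  (size (mmap g h E) <= (k * e).+1)%N /\
  (mmap g h E)`_(k * e) = mmap f (fun i => (h i)`_e) E.
Proof.
move=> gf /dhomogP hE sh.
have mon m : (size (mmap1 h m) <= (mdeg m * e).+1)%N /\
    (mmap1 h m)`_(mdeg m * e) = mmap1 (fun i => (h i)`_e) m.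
  rewrite mdegE /mmap1; elim/big_rec3: _ => [|i p j q _ [IHs IHc]].
    by rewrite mul0n size_poly1 coef1.
  have [sX cX] := coefX_top (m i) (sh i).
  rewrite mulnDl coefM_top // IHc cX; split=> //.
  exact: sizeM_top.
have [/= sE cE] : (size (\sum_(m <- msupp E) g E@_m * mmap1 h m)%R <= (k * e).+1)%N /\
  (\sum_(m <- msupp E) g E@_m * mmap1 h m)`_(k * e) =
  \sum_(m <- msupp E) f E@_m * mmap1 (fun i => (h i)`_e) m.
  split.
    apply: (big_ind (fun p : {poly A} => (size p <= (k * e).+1)%N)).
    - by rewrite size_poly0.
    - by move=> p q sp sq; apply: leq_trans (size_polyD _ _) _; rewrite geq_max sp.
    move=> m _; have [Em|Em] := boolP (m \in msupp E); last first.
      by rewrite memN_msupp_eq0 // rmorph0 mul0r size_poly0.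
    rewrite gf mul_polyC; apply: leq_trans (size_scale_leq _ _) _.
    by rewrite -(hE m) //; have [] := mon m.
  rewrite coef_sum; apply: eq_big_seq => m /hE <-.
  by rewrite gf coefCM; have [_ ->] := mon m.
by split.
Qed.

Definition vec3 (A : Type) (a b c : A) (i : 'I_3) : A := nth c [:: a; b; c] i.

Lemma vec3E (A : Type) (v : 'I_3 -> A) : v =1 vec3 (v 0) (v 1) (v 2%:R).
Proof. by move=> [[|[|[|i]]] hi] //; rewrite /vec3 /=; congr v; apply/val_inj. Qed.

Lemma ord3P (T : 'I_3 -> Prop) : T 0 -> T 1 -> T 2%:R -> forall i, T i.
Proof.
move=> T0 T1 T2 [[|[|[|i]]] hi] //.
- by have -> : Ordinal hi = 0 by apply/val_inj.
- by have -> : Ordinal hi = 1 by apply/val_inj.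
- by have -> : Ordinal hi = 2%:R by apply/val_inj.
Qed.

Lemma mmap_e0 (K A : comNzRingType) (f : {rmorphism K -> A}) (a : A)
    (E : {mpoly K[3]}) k : E \is k.-homog ->
  mmap f (vec3 a 0 0) E = a ^+ k * f E.@[vec3 1 0 0].
Proof.
move=> hE; rewrite (mmap_comp (f := idfun) (f' := f) (h' := vec3 1 0 0)) //; last first.
  by apply: ord3P; rewrite /vec3 /= ?rmorph1 ?rmorph0.
rewrite -(mmap_homogM _ _ _ hE); apply: mmap_ext; apply: ord3P; rewrite /vec3 /=; ring.
Qed.

(** * Restriction of a form to a parametrised line *)

Section Restrict.

Variable K : fieldType.
Implicit Types (F : {mpoly K[3]}) (v w : 'rV[K]_3).

(** The polynomial F(v + s w) in s. Its coefficient of s is the derivative of F at v along w, and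
    its coefficient of degree d is F(w) when F has degree d. *)
Definition restr F v w : {poly K} :=
  mmap (@polyC K) (fun i => (v 0 i)%:P + (w 0 i) *: 'X) F.

Lemma horner_restr F v w s : (restr F v w).[s] = F.@[(v + s *: w) 0].
Proof.
rewrite -horner_evalE; apply: mmap_comp => [c|i]; rewrite /= horner_evalE ?hornerE //.
by rewrite !mxE mulrC.
Qed.

Lemma coef0_restr F v w : (restr F v w)`_0 = F.@[v 0].
Proof. by rewrite -horner_coef0 horner_restr scale0r addr0. Qed.

Lemma size_restr F v w d : F \is d.-homog -> (size (restr F v w) <= d.+1)%N.
Proof.
move=> hF; have [] := @mmap_top K K 3 idfun (@polyC K)
  (fun i => (v 0 i)%:P + (w 0 i) *: 'X) F d 1 (fun=> erefl) hF.
  move=> i; apply: leq_trans (size_polyD _ _) _.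
  rewrite geq_max (leq_trans (size_polyC_leq1 _)) //.
  by apply: leq_trans (size_scale_leq _ _) _; rewrite size_polyX.
by rewrite muln1.
Qed.

Lemma coef_top_restr F v w d : F \is d.-homog -> (restr F v w)`_d = F.@[w 0].
Proof.
move=> hF; have [] := @mmap_top K K 3 idfun (@polyC K)
  (fun i => (v 0 i)%:P + (w 0 i) *: 'X) F d 1 (fun=> erefl) hF.
  move=> i; apply: leq_trans (size_polyD _ _) _.
  rewrite geq_max (leq_trans (size_polyC_leq1 _)) //.
  by apply: leq_trans (size_scale_leq _ _) _; rewrite size_polyX.
rewrite muln1 => _ ->; apply: mmap_ext => i.
by rewrite coefD coefC coefZ coefX /= add0r mulr1.
Qed.

Lemma coef1_restr F v w :
  (restr F v w)`_1 = \sum_i w 0 i * (F^`M(i)).@[v 0].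
Proof.
have der q : (restr q v w)^`() = \sum_i w 0 i *: restr q^`M(i) v w.
  elim/mpoly_ring_ind: q => [c|j|p q Hp Hq|p q Hp Hq].
  - rewrite /restr mmapC derivC big1 // => i _.
    by rewrite mderivC mmap0 scaler0.
  - rewrite /restr mmapX mmap1U derivD derivC derivZ derivX add0r.
    rewrite (bigD1 j) //= big1 ?addr0 => [|i ij].
      rewrite mderivX mnm1E eqxx scale1r.
      have -> : (U_(j) - U_(j))%MM = 0%MM by apply/mnmP=> i; rewrite mnmBE subnn mnm0E.
      by rewrite mmapX mmap11.
    by rewrite mderivX mnm1E eq_sym (negPf ij) scale0r mmap0 scaler0.
  - rewrite /restr mmapD derivD -!/(restr _ _ _) Hp Hq -big_split /=.
    by apply: eq_bigr => i _; rewrite -scalerDr mderivD /restr mmapD.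
  - rewrite /restr rmorphM /= derivM -!/(restr _ _ _) Hp Hq mulr_suml mulr_sumr.
    rewrite -big_split /=; apply: eq_bigr => i _.
    rewrite mderivM /restr mmapD !rmorphM /= -!/(restr _ _ _).
    by rewrite scalerDr -scalerAl -scalerAr.
have -> : (restr F v w)`_1 = (restr F v w)^`()`_0 by rewrite coef_deriv mulr1n.
rewrite der coef_sum; apply: eq_bigr => i _.
by rewrite coefZ coef0_restr.
Qed.

Lemma homogZ F d c v : F \is d.-homog -> F.@[(c *: v) 0] = c ^+ d * F.@[v 0].
Proof.
move=> hF; rewrite -(mmap_homogM idfun _ _ hF); apply: mmap_ext => i.
by rewrite mxE.
Qed.

Lemma restr_homog F v w d u r : F \is d.-homog ->
  F.@[(u *: v + r *: w) 0] =
  \sum_(k < d.+1) (restr F v w)`_k * u ^+ (d - k) * r ^+ k.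
Proof.
move=> hF.
have [->|u0] := eqVneq u 0.
  rewrite scale0r add0r (homogZ _ _ hF) big_ord_recr /= subnn expr0 mulr1.
  rewrite (coef_top_restr _ _ hF) big1 ?add0r 1?mulrC // => i _.
  by rewrite expr0n subn_eq0 leqNgt ltn_ord mulr0 mul0r.
have -> : u *: v + r *: w = u *: (v + (r / u) *: w).
  by rewrite scalerDr scalerA mulrC divfK.
rewrite (homogZ _ _ hF) -horner_restr (horner_coef_wide _ (size_restr _ _ hF)) mulr_sumr.
apply: eq_bigr => i _; rewrite mulrCA -mulrA; congr (_ * _).
have -> : u ^+ d = u ^+ (d - i) * u ^+ i by rewrite -exprD subnK // -ltnS.
by rewrite expr_div_n -mulrA; congr (_ * _); rewrite mulrC divfK // expf_neq0.
Qed.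

End Restrict.

Section InfiniteField.

Variables (K : fieldType) (charK : [pchar K] =i pred0).

Lemma natr_inj : injective (fun n : nat => n%:R : K).
Proof.
have natr_eq0 : forall n, (n%:R == 0 :> K) = (n == 0%N) by apply/pcharf0P.
move=> m n; wlog: m n / (m <= n)%N => [H|le_mn] e.
  by case/orP: (leq_total m n) => h; [|symmetry]; apply: H.
apply/eqP; rewrite eqn_leq le_mn /= -subn_eq0 -natr_eq0.
by rewrite natrB // e subrr.
Qed.

Lemma poly_eq0_fun (p D : {poly K}) :
  D != 0 -> (forall x, D.[x] != 0 -> p.[x] = 0) -> p = 0.
Proof.
move=> D0 pD; apply/eqP/negPn/negP => p0.
have pD0 : p * D != 0 by rewrite mulf_neq0.
have : (size [seq n%:R : K | n <- iota 0 (size (p * D)%R)] < size (p * D)%R)%N.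
  apply: max_poly_roots => //; last by rewrite (map_inj_uniq natr_inj) iota_uniq.
  apply/allP => x _; rewrite rootM /root.
  by have [|/pD/eqP->] := eqVneq D.[x] 0; rewrite ?orbT.
by rewrite size_map size_iota ltnn.
Qed.

Lemma poly_ext (p q : {poly K}) : (forall x, p.[x] = q.[x]) -> p = q.
Proof.
move=> pq; apply/eqP; rewrite -subr_eq0; apply/eqP.
apply: (poly_eq0_fun (oner_neq0 _)) => x _; rewrite !hornerE pq; ring.
Qed.

End InfiniteField.

(** As p has smaller degree than f, some zero of f has larger multiplicity in f than in p; common
    zeros are cancelled one at a time until it shows. *)
Lemma split_multiplicity (K : closedFieldType) (p f : {poly K}) :
  p != 0 -> (size p < size f)%N ->
  exists x r w u, [/\ p = ('X - x%:P) ^+ r * w, w.[x] != 0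
                    & f = ('X - x%:P) ^+ r.+1 * u].
Proof.
have [n] := ubnP (size f); elim: n p f => // n IH p f le_n p0 lt_pf.
have /closed_rootP [z fz] : size f != 1%N.
  by move: lt_pf; rewrite -[p == 0]size_poly_eq0 in p0 *; case: (size p) p0 => // m _; lia.
have [pz|pz] := boolP (root p z); last first.
  by have /factor_theorem [u ->] := fz; exists z, 0%N, p, u; rewrite expr0 expr1 mul1r mulrC.
have /factor_theorem [f' ef] := fz; have /factor_theorem [p' ep] := pz.
have p'0 : p' != 0 by apply: contraNneq p0; rewrite ep => ->; rewrite mul0r.
have f'0 : f' != 0 by apply: contraTneq lt_pf; rewrite ef => ->; rewrite mul0r size_poly0.
move: le_n lt_pf; rewrite ef ep !size_Mmonic ?monicXsubC // size_XsubC !addn2 /= !ltnS => le_n lt_pf.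
have [x [r [w [u [ep' wx ef']]]]] := IH _ _ le_n p'0 lt_pf.
have [exz|nxz] := eqVneq x z.
  exists x, r.+1, w, u; rewrite ep' ef' -exz; split=> //; rewrite !exprS; ring.
exists x, r, (w * ('X - z%:P)), (u * ('X - z%:P)); split.
- by rewrite ep'; ring.
- by rewrite hornerM !hornerE mulf_neq0 // subr_eq0.
- by rewrite ef'; ring.
Qed.

(** * Polynomials in two variables and the affine chart *)

Notation cst2 := (@polyC _ \o @polyC _).

Section Bivariate.

Variable K : fieldType.
Implicit Types (p q : {poly {poly K}}).

Definition at_y (y : K) p : {poly K} := map_poly (horner_eval y) p.

Lemma horner_at_y y p x : (at_y y p).[x] = p.[x%:P].[y].
Proof.
by rewrite -[RHS]/(horner_eval y p.[x%:P]) -horner_map /= horner_evalE hornerC.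
Qed.

Lemma split_y y p :
  exists q, p = map_poly polyC (at_y y p) + ('X - y%:P)%:P * q.
Proof.
exists (\poly_(i < size p) ((p`_i - (p`_i).[y]%:P) %/ ('X - y%:P))).
apply/polyP => i; rewrite coefD coefCM !coef_map /= /horner_eval coef_poly.
case: ltnP => hi; last by rewrite nth_default // horner0 mulr0 addr0 polyC0.
have dv : 'X - y%:P %| p`_i - (p`_i).[y]%:P.
  by rewrite dvdp_XsubCl rootE hornerD hornerN hornerC subrr.
by rewrite mulrC (divpK dv) addrC subrK.
Qed.

(** For E of degree k this is N^k E(p/N, y, 1) without fractions: its divisibility by the equation
    of the curve says that p/N satisfies E, an integral equation when E(1,0,0) is nonzero. *)
Definition ev2 (E : {mpoly K[3]}) p (N : {poly K}) : {poly {poly K}} :=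
  mmap cst2 (vec3 p (N%:P * 'X%:P) N%:P) E.

(** The chart Z = 1, with x as outer and y as inner variable. When E(1,0,0) is nonzero, the leading
    coefficient in x is a unit, so division with remainder works over K[y]. *)
Definition dehom (E : {mpoly K[3]}) : {poly {poly K}} :=
  mmap cst2 (vec3 'X 'X%:P 1) E.

Lemma at_xy_mmap (E : {mpoly K[3]}) p q r x y :
  (mmap cst2 (vec3 p q r) E).[x%:P].[y] =
  E.@[vec3 p.[x%:P].[y] q.[x%:P].[y] r.[x%:P].[y]].
Proof.
rewrite -!horner_evalE -[LHS]/((horner_eval y \o horner_eval x%:P) _).
apply: mmap_comp => [c|]; first by rewrite /= !horner_evalE !hornerC.
exact: ord3P.
Qed.

Lemma at_xy_dehom (E : {mpoly K[3]}) x y :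
  (dehom E).[x%:P].[y] = E.@[vec3 x y 1].
Proof. by rewrite at_xy_mmap !hornerE. Qed.

Lemma at_xy_ev2 (E : {mpoly K[3]}) p N x y :
  (ev2 E p N).[x%:P].[y] = E.@[vec3 p.[x%:P].[y] (N.[y] * y) N.[y]].
Proof. by rewrite at_xy_mmap hornerM !hornerC hornerM hornerX. Qed.

Lemma mmap_dehom (E : {mpoly K[3]}) (A : comNzRingType) (f : {rmorphism K -> A})
   (g : {rmorphism {poly {poly K}} -> A}) p q r :
  (forall c, g c%:P%:P = f c) ->
  g (mmap cst2 (vec3 p q r) E) = mmap f (vec3 (g p) (g q) (g r)) E.
Proof. by move=> gf; apply: mmap_comp => [c|]; [rewrite /= gf | apply: ord3P]. Qed.

End Bivariate.

Lemma poly_at0_dvd (R : idomainType) (e : nat) (U V Q : {poly R}) :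
  'X^e * U = Q * V -> V.[0] != 0 -> exists w, U = w * V.
Proof.
elim: e Q => [|e IH] Q; first by rewrite mul1r => -> _; exists Q.
move=> eq V0; have : root (Q * V) 0 by rewrite -eq rootM /root !hornerE exprS mul0r eqxx.
rewrite rootM [root V 0](negPf V0) orbF => /factor_theorem [Q' eQ].
apply: (IH Q') => //; apply: (@mulfI _ 'X); first by rewrite polyX_eq0.
by rewrite mulrA -exprS eq eQ subr0; ring.
Qed.

(** * Normality of the coordinate ring *)

Definition row3 (K : fieldType) (a b c : K) : 'rV[K]_3 := \row_i vec3 a b c i.

Lemma meval_row3 (K : fieldType) (E : {mpoly K[3]}) a b c :
  E.@[row3 a b c 0] = E.@[vec3 a b c].
Proof. by apply: mmap_ext => i; rewrite mxE. Qed.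

Lemma dvdp_mulCr (R : idomainType) (c : R) (p q : {poly R}) :
  c != 0 -> (p %| c%:P * q) = (p %| q).
Proof. by move=> c0; rewrite mul_polyC dvdpZr. Qed.

(** * The weighted substitution at a point of the curve *)

Section WeightedBlowUp.

Variables (K : fieldType) (x0 y0 : K) (m : nat).
Hypothesis m_gt0 : (0 < m)%N.

Let X : {poly {poly K}} := cst2 x0 + 'X.
Let Y : {poly {poly K}} := cst2 y0 + 'X%:P * 'X^m.

(* The substitution x := x0 + t, y := y0 + lambda t^m, with t the outer and *)
(* lambda the inner variable of the target.                                 *)
Definition blowup_y : {poly K} -> {poly {poly K}} := horner_eval Y \o map_poly cst2.
Definition blowup : {poly {poly K}} -> {poly {poly K}} :=
  horner_eval X \o map_poly blowup_y.

HB.instance Definition _ := GRing.RMorphism.on blowup_y.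
HB.instance Definition _ := GRing.RMorphism.on blowup.

Lemma blowup_yC c : blowup_y c%:P = cst2 c.
Proof. by rewrite /blowup_y /= map_polyC /horner_eval hornerC. Qed.

Lemma blowup_yX : blowup_y 'X = Y.
Proof. by rewrite /blowup_y /= map_polyX /horner_eval hornerX. Qed.

Lemma blowupC c : blowup c%:P = blowup_y c.
Proof. by rewrite /blowup /= map_polyC /horner_eval hornerC. Qed.

Lemma blowupX : blowup 'X = X.
Proof. by rewrite /blowup /= map_polyX /horner_eval hornerX. Qed.

Lemma blowup_at0 p : (blowup p).[0] = p.[x0%:P].[y0]%:P.
Proof.
have Y0 q : (blowup_y q).[0] = q.[y0]%:P.
  rewrite /blowup_y /= /horner_eval -[LHS]/(horner_eval 0 _) -horner_map /=.
  rewrite -map_poly_comp /horner_eval /Y /=.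
  rewrite !hornerE expr0n gtn_eqF // mulr0 addr0 -horner_map /=; congr (_.[_]).
  by apply: eq_map_poly => c /=; rewrite /horner_eval hornerC.
rewrite /blowup /= /horner_eval -[LHS]/(horner_eval 0 _) -horner_map /=.
rewrite -map_poly_comp /horner_eval /X /= !hornerE -horner_at_y -horner_map /=.
rewrite -map_poly_comp; congr (_.[_]).
by apply: eq_map_poly => c /=; rewrite /horner_eval Y0.
Qed.

Lemma blowup_YsubC : blowup ('X - y0%:P)%:P = 'X%:P * 'X^m.
Proof. by rewrite blowupC rmorphB /= blowup_yX blowup_yC /Y addrC addKr. Qed.

End WeightedBlowUp.

Section Normality.

Variables (K : closedFieldType) (charK : [pchar K] =i pred0).
Variables (F : {mpoly K[3]}) (d : nat).
Hypotheses (hF : F \is d.-homog) (F_e0 : F.@[vec3 1 0 0] != 0).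
Hypothesis smF : forall v : 'rV[K]_3, v != 0 -> F.@[v 0] = 0 ->
  exists w, (restr F v w)`_1 != 0.

Local Notation F1 := (dehom F).

Lemma size_lead_dehom : size F1 = d.+1 /\ lead_coef F1 = F.@[vec3 1 0 0]%:P.
Proof.
have [] := @mmap_top K {poly K} 3 (@polyC K) cst2 (vec3 'X 'X%:P 1) F d 1
  (fun=> erefl) hF.
  apply: ord3P; rewrite /vec3 /= ?size_polyX ?size_poly1 //.
  by apply: leq_trans (size_polyC_leq1 _) _.
rewrite muln1 -/F1 => sF cF.
have {}cF : F1`_d = F.@[vec3 1 0 0]%:P.
  rewrite cF (mmap_ext _ (h' := vec3 1 0 0)) ?(mmap_e0 _ _ hF) ?expr1n ?mul1r //.
  by apply: ord3P; rewrite /vec3 /= ?coefX ?coefC ?coef1.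
have sF' : size F1 = d.+1.
  apply/eqP; rewrite eqn_leq sF ltnNge; apply/negP => /leq_sizeP/(_ d (leqnn _))/eqP.
  by rewrite cF polyC_eq0 (negPf F_e0).
by rewrite lead_coefE sF'.
Qed.

Lemma size_dehom : size F1 = d.+1. Proof. by have [] := size_lead_dehom. Qed.

Lemma dehom_neq0 : F1 != 0.
Proof. by rewrite -size_poly_eq0 size_dehom. Qed.

Lemma dvd_dehomP p : reflect (exists q, p = q * F1) (F1 %| p).
Proof.
have [_ lF] := size_lead_dehom.
apply: Pdiv.IdomainUnit.dvdpP.
by rewrite lF poly_unitE size_polyC F_e0 coefC /= unitfE F_e0.
Qed.

Lemma at_y_dehom y : (size (at_y y F1) = d.+1)%N.
Proof.
have [sF lF] := size_lead_dehom.
rewrite /at_y size_map_poly_id0 // lF /= /horner_eval hornerC //.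
Qed.

(** At a multiple root x of the fibre over y the x-derivative of F vanishes. The value of q is the
    y-derivative there; if it vanished as well, Euler's relation would kill the third derivative and
    the point would be singular. *)
Lemma deriv_y_neq0 x y q u r : F1 = map_poly polyC (at_y y F1) + ('X - y%:P)%:P * q ->
  at_y y F1 = ('X - x%:P) ^+ r.+2 * u -> q.[x%:P].[y] != 0.
Proof.
move=> eF eu; apply/eqP => q0.
have F_xy s t : F.@[row3 s t 1 0] = F1.[s%:P].[t] by rewrite meval_row3 at_xy_dehom.
have Fv : F.@[row3 x y 1 0] = 0.
  by rewrite F_xy -horner_at_y eu exprS !hornerE subrr !mul0r.
have v0 : row3 x y 1 != 0.
  by apply/eqP => /rowP /(_ 2%:R); rewrite !mxE /vec3 /=; apply/eqP/oner_neq0.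
have [w] := smF v0 Fv; rewrite coef1_restr.
have d0 : (F^`M(0)).@[row3 x y 1 0] = 0.
  have -> : (F^`M(0)).@[row3 x y 1 0] = (restr F (row3 x y 1) (row3 1 0 0))`_1.
    rewrite coef1_restr !big_ord_recl big_ord0 !mxE /vec3 /=.
    by rewrite mul1r !mul0r !addr0.
  have -> : restr F (row3 x y 1) (row3 1 0 0) = 'X^r * (u \Po ('X + x%:P)) * 'X * 'X.
    apply: (poly_ext charK) => s; rewrite horner_restr !hornerE horner_comp !hornerE.
    have -> : row3 x y 1 + s *: row3 1 0 0 = row3 (s + x) y 1.
      by apply/rowP; apply: ord3P; rewrite !mxE /vec3 /=; ring.
    by rewrite F_xy -horner_at_y eu !exprS !(hornerM, horner_exp, hornerXsubC) addrK; ring.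
  by rewrite coefMX coefMX.
have d1 : (F^`M(1)).@[row3 x y 1 0] = 0.
  have -> : (F^`M(1)).@[row3 x y 1 0] = (restr F (row3 x y 1) (row3 0 1 0))`_1.
    rewrite coef1_restr !big_ord_recl big_ord0 !mxE /vec3 /=.
    have -> : lift 0 0 = 1 :> 'I_3 by apply/val_inj.
    by rewrite mul1r !mul0r !addr0 add0r.
  have -> : restr F (row3 x y 1) (row3 0 1 0) = (q.[x%:P] \Po ('X + y%:P)) * 'X.
    apply: (poly_ext charK) => s; rewrite horner_restr !hornerE horner_comp !hornerE.
    have -> : row3 x y 1 + s *: row3 0 1 0 = row3 x (s + y) 1.
      by apply/rowP; apply: ord3P; rewrite !mxE /vec3 /=; ring.
    rewrite F_xy {1}eF hornerD hornerM horner_map /= horner_at_y -F_xy Fv.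
    by rewrite !hornerE addrK mulrC.
  by rewrite coefMX /= -horner_coef0 horner_comp !hornerE.
(* Euler's relation: F vanishes identically on the multiples of a zero, so the derivative along the
   point itself is 0. *)
have d2 : (F^`M(2%:R)).@[row3 x y 1 0] = 0.
  have : (restr F (row3 x y 1) (row3 x y 1))`_1 = 0.
    have -> : restr F (row3 x y 1) (row3 x y 1) = 0.
      apply: (poly_ext charK) => s; rewrite horner_restr horner0.
      by rewrite -{1}[row3 x y 1]scale1r -scalerDl (homogZ _ _ hF) Fv mulr0.
    by rewrite coef0.
  rewrite coef1_restr !big_ord_recl big_ord0 !mxE /vec3 /=.
  have -> : lift 0 0 = 1 :> 'I_3 by apply/val_inj.
  have -> : lift 0 (lift 0 0) = 2%:R :> 'I_3 by apply/val_inj.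
  by rewrite d0 d1 !mulr0 !add0r addr0 mul1r.
rewrite big1 ?eqxx // => i _; move: i.
by apply: ord3P; rewrite ?d0 ?d1 ?d2 mulr0.
Qed.

(* The coordinate ring K[x, y]/(F1) is integrally closed: at a point (x0, y0) *)
(* where p(x, y0) has too small a multiplicity r, weigh x - x0 by 1 and       *)
(* y - y0 by r + 1; the leading form of the integral equation is a constant   *)
(* whereas that of F1 is not.                                                 *)
Lemma normality_local (E : {mpoly K[3]}) k (p : {poly {poly K}}) (N N1 : {poly K}) y :
    E \is k.-homog -> E.@[vec3 1 0 0] != 0 -> (1 < k)%N -> (size p <= d)%N ->
    N = ('X - y%:P) * N1 -> F1 %| ev2 E p N -> at_y y p = 0.
Proof.
move=> hE E0 k1 sp eN /dvd_dehomP [Q eQ]; apply/eqP/negPn/negP => p0.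
have [] := split_multiplicity p0 (f := at_y y F1).
  by rewrite at_y_dehom ltnS; exact: leq_trans (size_poly _ _) sp.
move=> x [r [w [u [ep wx eF]]]].
(* If [p] does not vanish at (x, y), evaluation there, where [F1] and [N] vanish, leaves E(1,0,0)
   p(x,y)^k = 0, which is absurd. In the other case the multiplicity of [p] becomes [r.+1], and [F1]
   vanishes to order at least [r.+2]. *)
case: r ep eF => [|r] ep eF.
  have := congr1 (fun q : {poly {poly K}} => q.[x%:P].[y]) eQ.
  rewrite at_xy_ev2 eN !hornerM hornerXsubC subrr !mul0r -[F1.[_].[_]]horner_at_y.
  rewrite eF expr1 hornerM hornerXsubC subrr mul0r mulr0 -horner_at_y ep mul1r.
  rewrite [X in X = _](mmap_e0 _ _ hE) /= => /eqP; rewrite mulf_eq0 (negPf E0) orbF.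
  by rewrite expf_eq0 (negPf wx) andbF.
have [p1 ep1] := split_y y p; have [q eq] := split_y y F1.
have qxy := deriv_y_neq0 eq eF.
pose th := blowup x y r.+2.
have thD : {morph th : a b / a + b} by exact: rmorphD.
have thM : {morph th : a b / a * b} by exact: rmorphM.
have thE : th (ev2 E p N) =
    mmap cst2 (vec3 (th p) (th (N%:P * 'X%:P)) (th N%:P)) E.
  apply: (@mmap_dehom K E {poly {poly K}} cst2 (blowup x y r.+2)) => c.
  by rewrite [LHS]blowupC blowup_yC.
have th_lift a : th (map_poly polyC a) = (map_poly cst2 a).[cst2 x + 'X].
  rewrite /th /blowup /= -map_poly_comp /horner_eval; congr (_.[_]).
  by apply: eq_map_poly => c /=; rewrite blowup_yC.
have lift0 a : (map_poly cst2 a).[cst2 x + 'X].[0] = a.[x]%:P.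
  by rewrite -th_lift blowup_at0 // -horner_at_y; congr (_.[_]%:P); rewrite /at_y
    -map_poly_comp map_poly_id // => c _ /=; rewrite /horner_eval hornerC.
have thX : (map_poly cst2 ('X - x%:P)).[cst2 x + 'X] = 'X.
  by rewrite rmorphB /= map_polyX map_polyC /= !hornerE addrC addKr.
pose A := (map_poly cst2 w).[cst2 x + 'X] + 'X%:P * 'X * th p1.
pose B := th N1%:P * 'X%:P.
pose U := mmap cst2 (vec3 A ('X * B * th 'X%:P) ('X * B)) E.
pose V := (map_poly cst2 u).[cst2 x + 'X] + 'X%:P * th q.
have eA : th p = 'X^(r.+1) * A.
  rewrite {1}ep1 thD thM [th (_ - _)%:P]blowup_YsubC th_lift ep rmorphM rmorphXn.
  rewrite hornerM horner_exp thX /A !exprS; ring.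
have eB : th N%:P = 'X^(r.+1) * ('X * B).
  by rewrite eN polyCM thM [th (_ - _)%:P]blowup_YsubC /B !exprS; ring.
have eV : th F1 = 'X^(r.+2) * V.
  rewrite {1}eq thD thM [th (_ - _)%:P]blowup_YsubC th_lift eF rmorphM rmorphXn.
  rewrite hornerM horner_exp thX /V; ring.
have eU : th (ev2 E p N) = 'X^(r.+1 * k) * U.
  rewrite thE.
  rewrite exprM -(mmap_homogM _ _ _ hE); apply: mmap_ext.
  apply: ord3P; [exact: eA| |exact: eB].
  by rewrite [RHS]mulrA -[LHS]/(th (N%:P * 'X%:P)) thM eB.
have U0 : U.[0] = (w.[x] ^+ k * E.@[vec3 1 0 0])%:P.
  have -> : U.[0] = mmap (@polyC K) (vec3 A.[0] ('X * B * th 'X%:P).[0] ('X * B).[0]) E.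
    by apply: (@mmap_dehom K E {poly K} (@polyC K) (horner_eval 0)) => c; exact: hornerC.
  rewrite (mmap_ext _ (h' := vec3 w.[x]%:P 0 0)); last first.
    apply: ord3P; rewrite /vec3 /=.
    - by rewrite /A hornerD lift0 !hornerM hornerX mulr0 mul0r addr0.
    - by rewrite !hornerM hornerX !mul0r.
    - by rewrite hornerM hornerX mul0r.
  by rewrite (mmap_e0 _ _ hE) rmorphM rmorphXn.
have V0 : V.[0] = u.[x]%:P + 'X * q.[x%:P].[y]%:P.
  by rewrite /V !hornerE lift0 blowup_at0.
have sV0 : size V.[0] = 2.
  rewrite V0 addrC mulrC size_polyDl ?size_Cmul ?size_polyX //.
  exact: leq_ltn_trans (size_polyC_leq1 _) _.
(* Since k > 1, (r + 1) k >= r + 2, so the power of t in front of [V] cancels; the remaining power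
   of t is removed because V(0) is nonzero. *)
have [c eUV] : exists c, U = c * V.
  apply: (@poly_at0_dvd _ (r.+1 * k - r.+2) _ _ (th Q)); last first.
    by rewrite -size_poly_eq0 sV0.
  apply: (@mulfI _ 'X^(r.+2)); first by rewrite expf_neq0 // polyX_eq0.
  rewrite mulrA -exprD subnKC; last by nia.
  by rewrite -eU eQ thM eV mulrCA.
have := congr1 (fun p : {poly {poly K}} => size p.[0]) eUV.
rewrite hornerM U0 size_polyC.
have [->|c0] := eqVneq c.[0] 0.
  by rewrite mul0r size_poly0 mulf_neq0 // expf_neq0.
rewrite size_mul // -?size_poly_eq0 sV0 //.
have : (0 < size c.[0])%N by rewrite size_poly_gt0.
rewrite addn2 /=; case: (size c.[0]) => // j _.
by case: (_ == 0).
Qed.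

(** The roots of the denominator are removed one by one: at each of them [normality_local] makes the
    numerator divisible by the same linear factor, and E, being homogeneous, survives the
    cancellation. *)
Lemma normality (E : {mpoly K[3]}) k (p : {poly {poly K}}) (N : {poly K}) :
    E \is k.-homog -> E.@[vec3 1 0 0] != 0 -> (1 < k)%N -> (size p <= d)%N ->
    N != 0 -> F1 %| ev2 E p N -> exists L, p = N%:P * L.
Proof.
move=> hE E0 k1; have [n] := ubnP (size N).
elim: n N p => // n IH N p le_n sp N0 dv.
have [sN|/closed_rootP [y /factor_theorem [N1 eN]]] := eqVneq (size N) 1.
  have /size_poly1P [c c0 ->] : size N == 1 by rewrite sN.
  by exists (c^-1%:P%:P * p); rewrite mulrA -!polyCM divff // mul1r.
rewrite mulrC in eN.
have N10 : N1 != 0 by apply: contraNneq N0; rewrite eN => ->; rewrite mulr0.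
have ep : exists p1, p = ('X - y%:P)%:P * p1.
  have [p1 ep] := split_y y p; exists p1.
  by rewrite {1}ep (normality_local hE E0 k1 sp eN dv) map_poly0 add0r.
have {ep} [p1 ep] := ep.
have Xy0 : 'X - y%:P != 0 by rewrite polyXsubC_eq0.
have [||||L eL] := IH N1 p1.
- by move: le_n; rewrite eN size_mul // size_XsubC.
- by rewrite ep mul_polyC size_scale in sp.
- by [].
- move: dv; rewrite /ev2 eN ep.
  rewrite (mmap_ext _ (h' := fun i => ('X - y%:P)%:P * vec3 p1 (N1%:P * 'X%:P) N1%:P i)).
    by rewrite (mmap_homogM _ _ _ hE) -polyC_exp dvdp_mulCr // expf_neq0.
  by apply: ord3P; rewrite /vec3 /= ?polyCM ?mulrA.
by exists L; rewrite ep eL eN polyCM mulrA.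
Qed.
End Normality.

(** * The function field *)

Lemma deriv_neq0 (R : idomainType) (p : {poly R}) :
  [pchar R] =i pred0 -> (1 < size p)%N -> p^`() != 0.
Proof.
move=> /pcharf0P charR sp; apply/eqP => /polyP /(_ (size p).-2)/eqP.
rewrite coef_deriv coef0 -mulr_natr mulf_eq0 charR orbF.
have -> : (size p).-2.+1 = (size p).-1 by move: sp; case: (size p) => [|[]].
by rewrite -lead_coefE lead_coef_eq0; case: eqP sp => [->|] //; rewrite size_poly0.
Qed.

Lemma separable_dvd_exp (R : idomainType) (f g : {poly R}) k :
  separable_poly f -> f %| g ^+ k -> f %| g.
Proof.
move=> sf fg; pose h := gcdp f g; have f0 := separable_poly_neq0 sf.
have /Pdiv.Idomain.dvdpP [[c a] /= c0 ea] := dvdp_gcdl f g.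
have ca : coprimep a h.
  case/separable_polyP: sf => sqf _; apply: sqf.
  by rewrite -ea dvdpZl.
have af : a %| f by rewrite -(dvdpZr _ _ c0) ea dvdp_mulr.
have cag : coprimep a g.
  apply/coprimepP => e ea' eg; have /coprimepP/(_ e ea') := ca; apply.
  by rewrite dvdp_gcd eg (dvdp_trans ea' af).
have ga : size a = 1%N.
  have : coprimep a (g ^+ k) by apply: coprimep_expr.
  by move=> /coprimepP/(_ a (dvdpp _) (dvdp_trans af fg)); rewrite -size_poly_eq1 => /eqP.
have /size_poly1P [b b0 eb] : size a == 1%N by rewrite ga.
apply: dvdp_trans (dvdp_gcdr f g).
by rewrite -(dvdpZl _ _ c0) ea eb mul_polyC dvdpZl.
Qed.

Lemma dhomog_var (n : nat) (R : nzRingType) (i : 'I_n) :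
  ('X_i : {mpoly R[n]}) \is 1.-homog.
Proof. by rewrite dhomogX /= mdeg1. Qed.

(** * Total degree and leading forms *)

Section AffineExchange.

Variable K : fieldType.

(* x := x t, y := t: the t-degree of the image is the total degree. *)
Definition to_infinity : {poly {poly K}} -> {poly {poly K}} :=
  horner_eval ('X%:P * 'X) \o map_poly (map_poly (@polyC K)).

HB.instance Definition _ := GRing.RMorphism.on to_infinity.

Lemma to_infinityC q : to_infinity q%:P = map_poly polyC q.
Proof. by rewrite /to_infinity /= map_polyC /horner_eval hornerC. Qed.

Lemma to_infinityX : to_infinity 'X = 'X%:P * 'X.
Proof. by rewrite /to_infinity /= map_polyX /horner_eval hornerX. Qed.

Lemma coef_to_infinity p i j :
  ((to_infinity p)`_j)`_i = if (i <= j)%N then (p`_i)`_(j - i) else 0.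
Proof.
have thD : {morph to_infinity : a b / a + b} by exact: rmorphD.
have thM : {morph to_infinity : a b / a * b} by exact: rmorphM.
elim/poly_ind: p i j => [|p c IH] i j.
  by rewrite [to_infinity 0]rmorph0 !coef0 if_same.
rewrite thD thM to_infinityC to_infinityX mulrA coefD coefMX !coefD coefMX coef_map /=.
rewrite coefMC !coefC; case: i j => [|i] [|j] //=; rewrite ?coef0 ?mulr0 ?add0r ?addr0 //.
- by rewrite coefMX add0r subn0.
- by rewrite coefMX IH ltnS subSS.
Qed.

Definition affine (a b c : K) : {poly {poly K}} :=
  a%:P%:P * 'X + (b%:P * 'X + c%:P)%:P.

Lemma affine_at a b c x y : (affine a b c).[x%:P].[y] = a * x + b * y + c.
Proof. by rewrite /affine !hornerE ?addrA. Qed.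

End AffineExchange.

Section GoodFrame.

Variables (K : closedFieldType) (charK : [pchar K] =i pred0).
Variables (F : {mpoly K[3]}) (d : nat).
Hypotheses (hF : F \is d.-homog) (F_e0 : F.@[vec3 1 0 0] != 0).
Hypothesis smF : forall v : 'rV[K]_3, v != 0 -> F.@[v 0] = 0 ->
  exists w, (restr F v w)`_1 != 0.

Local Notation F1 := (dehom F).

Lemma pchar_poly : [pchar {poly K}] =i pred0.
Proof.
have natr0 : forall n, (n%:R == 0 :> K) = (n == 0%N) by apply/pcharf0P.
by apply/pcharf0P => n; rewrite -polyC_natr polyC_eq0 natr0.
Qed.

(** A square factor g^2 of F1 leaves a nilpotent q g, of smaller degree than F1. A nilpotent divided
    by any nonzero N still satisfies X^2 = 0, so normality would make it divisible by every
    polynomial in y. *)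
Lemma separable_dehom : separable_poly F1.
Proof.
have F10 := dehom_neq0 hF F_e0.
apply/separable_polyP; split=> [u v uv|u _ su]; last exact: (deriv_neq0 pchar_poly).
apply/negPn/negP => nuv; set g := gcdp u v.
have : g * g %| F1.
  by apply: dvdp_trans uv; rewrite dvdp_mul ?dvdp_gcdl ?dvdp_gcdr.
move=> /Pdiv.Idomain.dvdpP [[c q] /= c0 eq].
have gq0 : q * g != 0.
  apply: contraNneq F10 => qg0.
  have : c%:P * F1 == 0 by rewrite mul_polyC eq mulrA qg0 mul0r.
  by rewrite mulf_eq0 polyC_eq0 (negPf c0).
have g0 : g != 0 by apply: contraNneq gq0 => ->; rewrite mulr0.
have sg : (1 < size g)%N.
  by rewrite ltn_neqAle eq_sym -coprimep_def nuv size_poly_gt0.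
have sqg : (size (q * g)%R <= d)%N.
  have : size (c *: F1) = d.+1 by rewrite size_scale ?(size_dehom hF).
  rewrite eq mulrA size_mul //.
  by move: (size (q * g)%R) (size g) sg => a b; lia.
pose l := lead_coef (q * g).
have l0 : l != 0 by rewrite lead_coef_eq0.
(* The denominator y^(size l) has larger degree than the leading coefficient [l] of q g, so it
   cannot divide [l]. *)
have [||||||L eL] := @normality _ charK _ _ hF F_e0 smF ('X_0 ^+ 2) 2 (q * g) ('X^(size l)).
- exact: (dhomogMn 2 (dhomog_var _ _)).
- by rewrite rmorphXn /= mevalXU /vec3 /= expr1n oner_neq0.
- by [].
- by [].
- by rewrite expf_neq0 ?polyX_eq0.
- rewrite /ev2 rmorphXn /= mmapX mmap1U /vec3 /= expr2.
  have -> : q * g * (q * g) = c *: (F1 * q) by rewrite scalerAl eq; ring.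
  by rewrite dvdpZr // dvdp_mulr.
have : l = 'X^(size l) * L`_(size (q * g)).-1.
  by rewrite -coefCM -eL.
move=> el; have L0 : L`_(size (q * g)).-1 != 0.
  by apply: contraNneq l0 => L0; rewrite el L0 mulr0.
move: el L0; set m := L`__ => el m0.
have : size l = size ('X^(size l) * m) by rewrite -el.
rewrite size_mul ?expf_neq0 ?polyX_eq0 // size_polyXn.
have : (0 < size m)%N by rewrite size_poly_gt0.
by move: (size l) (size m) => a b; lia.
Qed.

Hypothesis sep_inf : separable_poly (mmap (@polyC K) (vec3 'X 1 0) F).

Lemma size_inf : size (mmap (@polyC K) (vec3 'X 1 0) F) = d.+1.
Proof.
have [] := @mmap_top K K 3 idfun (@polyC K) (vec3 'X 1 0) F d 1 (fun=> erefl) hF.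
  by apply: ord3P; rewrite /vec3 /= ?size_polyX ?size_poly1 ?size_poly0.
rewrite muln1 => sF cF; apply/eqP; rewrite eqn_leq sF ltnNge.
apply/negP => /leq_sizeP/(_ d (leqnn _))/eqP.
rewrite cF (mmap_ext _ (h' := vec3 1 0 0)) ?(negPf F_e0) //.
by apply: ord3P; rewrite /vec3 /= ?coefX ?coef1 ?coef0.
Qed.

(* Comparing terms of top total degree: an integral element of degree e > 1 *)
(* would have its leading form divisible by the leading form of F1.         *)
Lemma integral_degree (E : {mpoly K[3]}) k (L : {poly {poly K}}) :
    E \is k.-homog -> E.@[vec3 1 0 0] != 0 -> (0 < k)%N -> (size L <= d)%N ->
    F1 %| ev2 E L 1 -> exists a b c, L = affine a b c.
Proof.
move=> hE E0 k0 sL /(dvd_dehomP hF F_e0) [Q eQ].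
set th := @to_infinity K.
have thM : {morph th : a b / a * b} by exact: rmorphM.
have thE G p q r : th (mmap cst2 (vec3 p q r) G) =
    mmap cst2 (vec3 (th p) (th q) (th r)) G.
  apply: (@mmap_dehom K G {poly {poly K}} cst2 th) => c.
  by rewrite /th [LHS]to_infinityC map_polyC.
have th1 : th 1 = 1 by exact: rmorph1.
have thY : th 'X%:P = 'X by rewrite /th to_infinityC map_polyX.
pose e := (size (th L)).-1.
have [le_e1|lt_1e] := leqP e 1.
  have c0 i j : (1 < i + j)%N -> (L`_i)`_j = 0.
    move=> ij; have := coef_to_infinity L i (i + j).
    have z : (th L)`_(i + j) = 0.
      apply: nth_default; apply: leq_trans ij.
      by move: le_e1; rewrite /e; case: (size (th L)).
    by rewrite leq_addr addKn -/th z coef0 => <-.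
  exists (L`_1)`_0, (L`_0)`_1, (L`_0)`_0.
  apply/polyP => i; rewrite /affine coefD coefCM coefX coefC.
  apply/polyP => j; rewrite coefD.
  case: i => [|[|i]] /=; rewrite ?mulr0 ?mulr1 ?add0r ?coef0 ?addr0; last by rewrite c0.
    by rewrite coefD coefCM coefX coefC; case: j => [|[|j]] /=;
      rewrite ?mulr0 ?mulr1 ?add0r ?addr0 // c0.
  by rewrite coefC; case: j => [|j] //=; rewrite c0.
exfalso.
have thL0 : th L != 0.
  by apply: contraTneq lt_1e => e0; rewrite /e e0 size_poly0.
have sthL : size (th L) = e.+1.
  by rewrite /e prednK // size_poly_gt0.
pose Finf := mmap (@polyC K) (vec3 'X 1 0) F; have sFinf : size Finf = d.+1 := size_inf.
have Finf0 : Finf != 0 by rewrite -size_poly_eq0 sFinf.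
have lF : lead_coef (th F1) = Finf.
  rewrite /dehom thE [th 'X]to_infinityX thY th1.
  have [] := @mmap_top K {poly K} 3 (@polyC K) cst2 (vec3 ('X%:P * 'X) 'X 1) F d 1
    (fun=> erefl) hF.
    apply: ord3P; rewrite /vec3 /= ?size_polyX ?size_poly1 //.
    by rewrite mul_polyC; apply: leq_trans (size_scale_leq _ _) _; rewrite size_polyX.
  rewrite muln1 => sF cF.
  have {}cF : (mmap cst2 (vec3 ('X%:P * 'X) 'X 1) F)`_d = Finf.
    rewrite cF; apply: mmap_ext; apply: ord3P; rewrite /vec3 /= ?coefX ?coef1 //.
    by rewrite coefCM coefX mulr1.
  rewrite lead_coefE (_ : size _ = d.+1) //; apply/eqP; rewrite eqn_leq sF ltnNge.
  by apply/negP => /leq_sizeP/(_ d (leqnn _))/eqP; rewrite cF (negPf Finf0).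
have lE : lead_coef (th (ev2 E L 1)) = E.@[vec3 1 0 0] *: lead_coef (th L) ^+ k.
  rewrite /ev2 thE thM thY th1.
  have [] := @mmap_top K {poly K} 3 (@polyC K) cst2 (vec3 (th L) (1 * 'X) 1) E k e
    (fun=> erefl) hE.
    apply: ord3P; rewrite /vec3 /= ?sthL // ?mul1r ?size_polyX ?size_poly1 //; lia.
  move=> sE cE.
  have {}cE : (mmap cst2 (vec3 (th L) (1 * 'X) 1) E)`_(k * e) =
      E.@[vec3 1 0 0] *: lead_coef (th L) ^+ k.
    rewrite cE (mmap_ext _ (h' := vec3 (lead_coef (th L)) 0 0)).
      by rewrite (mmap_e0 _ _ hE) mulrC mul_polyC.
    apply: ord3P; rewrite /vec3 /= ?mul1r ?coefX ?coef1 ?lead_coefE ?sthL //.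
      by rewrite gtn_eqF.
    by rewrite gtn_eqF // ltnW.
  have cn0 : E.@[vec3 1 0 0] *: lead_coef (th L) ^+ k != 0.
    by rewrite scaler_eq0 negb_or E0 expf_neq0 // lead_coef_eq0.
  rewrite lead_coefE (_ : size _ = (k * e).+1) //.
  apply/eqP; rewrite eqn_leq sE ltnNge.
  by apply/negP => /leq_sizeP/(_ _ (leqnn _))/eqP; rewrite cE (negPf cn0).
have : Finf %| lead_coef (th L).
  apply: (separable_dvd_exp (k := k)) => //.
  by rewrite -(dvdpZr _ _ E0) -lE eQ thM lead_coefM lF dvdp_mull.
move=> /dvdp_leq; rewrite lead_coef_eq0 thL0 sFinf => /(_ isT).
rewrite ltnNge => /negP; apply; apply: leq_trans sL.
apply/leq_sizeP => i hi; rewrite lead_coefE coef_to_infinity; case: ifP => // _.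
by rewrite [L`_i]nth_default // coef0.
Qed.

End GoodFrame.

(** * Irreducibility and integral elements *)

Section FunctionField.

Variables (K : closedFieldType) (charK : [pchar K] =i pred0).
Variables (F : {mpoly K[3]}) (d : nat).
Hypotheses (hF : F \is d.-homog) (F_e0 : F.@[vec3 1 0 0] != 0).
Hypothesis smF : forall v : 'rV[K]_3, v != 0 -> F.@[v 0] = 0 ->
  exists w, (restr F v w)`_1 != 0.

Local Notation F1 := (dehom F).

Lemma coprime_bezout (h : {poly {poly K}}) : coprimep F1 h ->
  exists u v N, N != 0 /\ u * F1 + v * h = N%:P.
Proof.
move=> /Bezout_coprimepP [[u v] /= /eqpP [[c1 c2] /= /andP [c10 c20] e]].
exists (c1 *: u), (c1 *: v), c2; split=> //.
by rewrite -!scalerAl -scalerDr e alg_polyC.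
Qed.

(** A Bezout relation between F1 and its x-derivative, cleared of denominators, specialises to every
    y at which the right-hand side N is nonzero. *)
Lemma separable_fibre : exists2 N : {poly K},
  N != 0 & forall y, N.[y] != 0 -> separable_poly (at_y y F1).
Proof.
have sep := separable_dehom charK hF F_e0 smF.
have [u [v [N [N0 eN]]]] : exists u v N, N != 0 /\ u * F1 + v * F1^`() = N%:P.
  by apply: coprime_bezout; rewrite unlock in sep.
exists N => // y Ny.
rewrite unlock; apply/Bezout_coprimepP; exists (at_y y u, at_y y v) => /=.
have := congr1 (at_y y) eN; rewrite /at_y rmorphD !rmorphM /= deriv_map => ->.
by rewrite map_polyC /= -size_poly_eq1 size_polyC Ny.
Qed.

(* Nullstellensatz for the curve F1 = 0, with finitely many fibres omitted. *)
Lemma vanish_dvd (g : {poly {poly K}}) (D : {poly K}) : D != 0 ->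
  (forall x y, D.[y] != 0 -> F1.[x%:P].[y] = 0 -> g.[x%:P].[y] = 0) -> F1 %| g.
Proof.
move=> D0 gD; have F10 := dehom_neq0 hF F_e0.
have [_ lF] := size_lead_dehom hF F_e0.
have lFu : lead_coef F1 \is a GRing.unit.
  by rewrite lF poly_unitE size_polyC F_e0 coefC /= unitfE F_e0.
have eg := Pdiv.IdomainUnit.divp_eq lFu g.
have sr : (size (g %% F1)%R < d.+1)%N by rewrite -(size_dehom hF F_e0) ltn_modp.
have [N N0 sepN] := separable_fibre.
apply/modp_eq0P/polyP => i; rewrite coef0.
apply: (poly_eq0_fun charK (mulf_neq0 D0 N0)) => y.
rewrite hornerM mulf_eq0 negb_or => /andP [Dy Ny].
suff ry : at_y y (g %% F1) = 0.
  by have := congr1 (fun p : {poly K} => p`_i) ry; rewrite coef_map coef0.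
have sy := sepN y Ny.
have [rs ers] := closed_field_poly_normal (at_y y F1).
have lc0 : lead_coef (at_y y F1) != 0.
  by rewrite lead_coef_eq0 -size_poly_eq0 (at_y_dehom hF F_e0).
have urs : uniq rs.
  rewrite -separable_prod_XsubC; apply: dvdp_separable sy.
  by rewrite -(dvdpZl _ _ lc0) -ers dvdpp.
have srs : size rs = d.
  have := at_y_dehom hF F_e0 y; rewrite ers size_scale // size_prod_XsubC.
  by case.
apply/eqP/negPn/negP => r0.
have := max_poly_roots r0 (rs := rs) _ urs; rewrite srs.
have -> : all (root (at_y y (g %% F1))) rs.
  apply/allP => z zrs; rewrite rootE horner_at_y.
  have Fz : F1.[z%:P].[y] = 0.
    apply/eqP; rewrite -horner_at_y -rootE ers rootZ // root_prod_XsubC //.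
  have := gD z y Dy Fz; rewrite {1}eg hornerD hornerM hornerD hornerM Fz mulr0 add0r.
  by move=> ->.
move=> /(_ isT); apply/negP; rewrite -leqNgt.
by apply: leq_trans (size_poly _ _) _; rewrite -ltnS.
Qed.

Lemma vanish_dvd_form (g : {mpoly K[3]}) (D : {poly K}) : D != 0 ->
  (forall x y, D.[y] != 0 -> F.@[vec3 x y 1] = 0 -> g.@[vec3 x y 1] = 0) ->
  F1 %| dehom g.
Proof.
move=> D0 gD; apply: (vanish_dvd D0) => x y Dy.
move=> /(etrans (esym (at_xy_dehom F x y))) Fxy.
exact: etrans (at_xy_dehom g x y) (gD x y Dy Fxy).
Qed.

(** The fraction p/N is first reduced modulo F1 to x-degree below d, where [normality] clears the
    denominator and [integral_degree] bounds the total degree by 1. *)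
Lemma integral_affine (sep_inf : separable_poly (mmap (@polyC K) (vec3 'X 1 0) F))
    (E : {mpoly K[3]}) k (p : {poly {poly K}}) (N : {poly K}) :
    E \is k.-homog -> E.@[vec3 1 0 0] != 0 -> (1 < k)%N -> N != 0 ->
    F1 %| ev2 E p N ->
  exists a b c, F1 %| p - N%:P * affine a b c /\ F1 %| ev2 E (affine a b c) 1.
Proof.
move=> hE E0 k1 N0 dv; have F10 := dehom_neq0 hF F_e0.
have [_ lF] := size_lead_dehom hF F_e0.
have lFu : lead_coef F1 \is a GRing.unit.
  by rewrite lF poly_unitE size_polyC F_e0 coefC /= unitfE F_e0.
have ep := Pdiv.IdomainUnit.divp_eq lFu p.
set r := p %% F1 in ep; set q := p %/ F1 in ep.
have sr : (size r <= d)%N by rewrite -ltnS -(size_dehom hF F_e0) ltn_modp.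
have dvr : F1 %| ev2 E r N.
  have [|c ec] := @mmap_congr K 3 {poly {poly K}} cst2 F1
      (vec3 p (N%:P * 'X%:P) N%:P) (vec3 r (N%:P * 'X%:P) N%:P) E.
    apply: ord3P; rewrite /vec3 /=; [by exists q; rewrite {1}ep addrK| |];
      by exists 0; rewrite subrr mul0r.
  have er : ev2 E r N = ev2 E p N - c * F1 by rewrite -[c * F1]ec /ev2 subKr.
  by rewrite er; apply: (dvdp_sub dv (dvdp_mull _ (dvdpp _))).
have [L eL] := normality charK hF F_e0 smF hE E0 k1 sr N0 dvr.
have dvL : F1 %| ev2 E L 1.
  move: dvr; rewrite /ev2 (mmap_ext _ (h' := fun i => N%:P * vec3 L (1%:P * 'X%:P) 1%:P i)).
    by rewrite (mmap_homogM _ _ _ hE) -polyC_exp dvdp_mulCr // expf_neq0.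
  by apply: ord3P; rewrite /vec3 /= ?mul1r ?mulr1.
have sL : (size L <= d)%N by move: sr; rewrite eL mul_polyC size_scale.
have [a [b [c eabc]]] := integral_degree hF F_e0 sep_inf hE E0 (ltnW k1) sL dvL.
exists a, b, c; rewrite -eabc; split=> //.
have -> : p - N%:P * L = q * F1 by rewrite -eL {1}ep addrK.
exact: (dvdp_mull _ (dvdpp _)).
Qed.

Hypothesis d_ge3 : (2 < d)%N.
Hypothesis sep_inf : separable_poly (mmap (@polyC K) (vec3 'X 1 0) F).

Lemma size_affine (a b c : K) : (size (affine a b c) <= 2)%N.
Proof.
rewrite /affine; apply: leq_trans (size_polyD _ _) _; rewrite geq_max mul_polyC.
apply/andP; split; first by apply: leq_trans (size_scale_leq _ _) _; rewrite size_polyX.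
exact: leq_trans (size_polyC_leq1 _) _.
Qed.

(* A proper common factor of F1 and h would give an idempotent of the function *)
(* ring; it is integral, hence affine, hence 0 or 1 as 2 < d.                  *)
Lemma dvd_or_coprime (h : {poly {poly K}}) : F1 %| h \/ coprimep F1 h.
Proof.
have F10 := dehom_neq0 hF F_e0.
have [|nc] := boolP (coprimep F1 h); [by right | left].
set g := gcdp F1 h.
have /Pdiv.Idomain.dvdpP [[c q] /= c0 eq] : g %| F1 := dvdp_gcdl _ _.
have cq0 : c *: F1 != 0.
  by rewrite -mul_polyC mulf_neq0 // polyC_eq0.
have q0 : q != 0 by apply: contraNneq cq0 => q0; rewrite eq q0 mul0r.
have g0 : g != 0 by apply: contraNneq cq0 => g0; rewrite eq g0 mulr0.
have cop : coprimep g q.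
  have /separable_polyP [sq _] := separable_dehom charK hF F_e0 smF.
  by apply: sq; rewrite mulrC -eq dvdpZl // dvdpp.
have [u [v [N [N0 eN]]]] : exists u v N, N != 0 /\ u * g + v * q = N%:P.
  move/Bezout_coprimepP: cop => [[u v] /= /eqpP [[c1 c2] /= /andP [c10 c20] e]].
  exists (c1 *: u), (c1 *: v), c2; split=> //.
  by rewrite -!scalerAl -scalerDr e alg_polyC.
(* The equation e^2 = e for e = u g / N: since u g + v q = N, the product of e and 1 - e is a
   multiple of F1. *)
pose E : {mpoly K[3]} := 'X_0 ^+ 2 - 'X_0 * 'X_2%:R.
have evE p M : ev2 E p M = p ^+ 2 - p * M%:P.
  by rewrite /ev2 mmapB rmorphXn rmorphM /= !mmapX !mmap1U.
have hE : E \is 2.-homog.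
  apply: rpredB; first exact: (dhomogMn 2 (dhomog_var _ _)).
  exact: (dhomogM (dhomog_var _ _) (dhomog_var _ _)).
have E0 : E.@[vec3 1 0 0] != 0.
  rewrite /E mevalB rmorphXn rmorphM /= !mevalXU /vec3 /=.
  by rewrite mulr0 subr0 expr1n oner_neq0.
have eqF : c%:P * F1 = q * g by rewrite mul_polyC.
have dvE : F1 %| ev2 E (u * g) N.
  have -> : ev2 E (u * g) N = - (u * v * (c%:P * F1)) by rewrite evE -eN eqF; ring.
  by rewrite mulrA dvdpNr dvdp_mull.
have [a1 [a2 [a3 []]]] := integral_affine sep_inf hE E0 isT N0 dvE.
set L := affine a1 a2 a3; rewrite evE => dvL dvLL.
have sL : (size L <= 2)%N := size_affine _ _ _.
(* A multiple of F1 of x-degree at most 2 < d must be 0. *)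
have L01 : L * (L - 1) = 0.
  apply/eqP/negPn/negP => nz.
  have eL : L * (L - 1) = L ^+ 2 - L * 1%:P by ring.
  have := dvdp_leq nz; rewrite {1}eL => /(_ _ dvLL); rewrite (size_dehom hF F_e0) eL.
  apply/negP; rewrite -ltnNge ltnS; apply: leq_trans d_ge3.
  apply: leq_trans (size_polyD _ _) _; rewrite geq_max size_polyN mulr1.
  by rewrite (leq_trans sL) // expr2 (sizeM_top (a := 1) (b := 1)).
have const_of_dvd r : r %| N%:P -> size r = 1%N.
  move=> rN; have NP0 : N%:P != 0 by rewrite polyC_eq0.
  have r0 : r != 0 by apply: contraTneq rN => ->; rewrite dvd0p.
  by apply/eqP; rewrite eqn_leq size_poly_gt0 r0 andbT (leq_trans (dvdp_leq NP0 rN)) // size_polyC_leq1.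
move/eqP: L01; rewrite mulf_eq0 => /orP [/eqP L0|].
  move: dvL; rewrite L0 mulr0 subr0 -(dvdpZl _ _ c0) eq dvdp_mul2r // => qu.
  have /const_of_dvd/eqP/size_poly1P [b b0 eb] : q %| N%:P.
    by rewrite -eN; apply: dvdp_add; [exact: dvdp_mulr|exact: dvdp_mulIr].
  rewrite -(dvdpZl _ _ c0) eq eb mul_polyC dvdpZl //.
  exact: dvdp_gcdr.
rewrite subr_eq0 => /eqP L1; move: dvL.
have -> : u * g - N%:P * L = - (v * q) by rewrite L1 -eN; ring.
rewrite dvdpNr -(dvdpZl _ _ c0) eq [q * g]mulrC dvdp_mul2r // => gv.
have /const_of_dvd sg : g %| N%:P.
  by rewrite -eN; apply: dvdp_add; [exact: dvdp_mulIr|exact: dvdp_mulr].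
by move: nc; rewrite coprimep_def -/g sg.
Qed.

(** A point (f0 : f1 : f2) of the curve over its own function field with f1 = y f2 has f0/f2
    integral, since F(f0/f2, y, 1) = 0 is an integral equation; hence f0/f2 is affine in x and y. *)
Lemma linear_lift (f0 f1 f2 : {poly {poly K}}) :
    F1 %| f1 - 'X%:P * f2 -> F1 %| mmap cst2 (vec3 f0 f1 f2) F ->
    ~ (F1 %| f0 /\ F1 %| f2) ->
  exists a b c, F1 %| f0 - affine a b c * f2 /\ F1 %| ev2 F (affine a b c) 1.
Proof.
move=> dv12 dvF nf.
have dvF' : F1 %| mmap cst2 (vec3 f0 ('X%:P * f2) f2) F.
  have [|c ec] := @mmap_congr K 3 {poly {poly K}} cst2 F1
      (vec3 f0 f1 f2) (vec3 f0 ('X%:P * f2) f2) F.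
    apply: ord3P; rewrite /vec3 /=; try by exists 0; rewrite subrr mul0r.
    by have /(dvd_dehomP hF F_e0) := dv12.
  set y := mmap _ _ _ in dvF ec; set z := mmap _ _ _ in ec *.
  have -> : z = y - c * F1 by rewrite -ec subKr.
  by apply: (dvdp_sub dvF (dvdp_mull _ (dvdpp _))).
(* If f2 vanished on the curve, F(f0, 0, 0) = F(1,0,0) f0^d would too, and F1 being squarefree would
   divide f0. *)
have [dv2|/coprime_bezout [u [v [N [N0 eN]]]]] := dvd_or_coprime f2.
  case: nf; split=> //.
  have [|c ec] := @mmap_congr K 3 {poly {poly K}} cst2 F1
      (vec3 f0 ('X%:P * f2) f2) (vec3 f0 0 0) F.
    have /(dvd_dehomP hF F_e0) [q eq] := dv2.
    apply: ord3P; rewrite /vec3 /= ?subr0; first by exists 0; rewrite subrr mul0r.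
      by exists ('X%:P * q); rewrite eq mulrA.
    by exists q.
  have : F1 %| mmap cst2 (vec3 f0 0 0) F.
    set y := mmap _ _ _ in dvF' ec; set z := mmap _ _ _ in ec *.
    have -> : z = y - c * F1 by rewrite -ec subKr.
    by apply: (dvdp_sub dvF' (dvdp_mull _ (dvdpp _))).
  rewrite (mmap_e0 _ _ hF) mulrC dvdp_mulCr ?polyC_eq0 //.
  exact: (separable_dvd_exp (separable_dehom charK hF F_e0 smF)).
(* Modulo F1 the element v inverts f2 up to N in K[y], so f0/f2 equals f0 v / N, the kind of
   fraction [integral_affine] accepts. *)
have dvE : F1 %| ev2 F (f0 * v) N.
  have [|c ec] := @mmap_congr K 3 {poly {poly K}} cst2 F1
      (vec3 (f0 * v) (N%:P * 'X%:P) N%:P)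
      (fun i => v * vec3 f0 ('X%:P * f2) f2 i) F.
    apply: ord3P; rewrite /vec3 /= -?eN; first by exists 0; rewrite mul0r; ring.
      by exists (u * 'X%:P); ring.
    by exists u; ring.
  rewrite (mmap_homogM _ _ _ hF) in ec.
  set y := mmap _ _ _ in dvF' ec; rewrite /ev2; set z := mmap _ _ _ in ec *.
  have -> : z = c * F1 + v ^+ d * y by rewrite -ec subrK.
  by apply: dvdp_add; apply: dvdp_mull.
have [a [b [c [dvL dvF2]]]] := integral_affine sep_inf hF F_e0 (ltnW d_ge3) N0 dvE.
exists a, b, c; split=> //; set L := affine a b c in dvL *.
rewrite -(dvdp_mulCr _ _ N0) -{1}eN.
have -> : (u * F1 + v * f2) * (f0 - L * f2) =
    u * (f0 - L * f2) * F1 + f2 * (f0 * v - (u * F1 + v * f2) * L) + u * L * f2 * F1.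
  ring.
rewrite eN; apply: dvdp_add; last exact: (dvdp_mull _ (dvdpp _)).
by apply: dvdp_add; [exact: (dvdp_mull _ (dvdpp _))|exact: (dvdp_mull _ dvL)].
Qed.

(** Such a line would be a component of C: by [dvd_or_coprime], F1 either divides x - (b y + c),
    which has too small a degree, or shares no zeros with it except over finitely many y. *)
Lemma no_linear_factor (b c : K) :
  (forall y, F.@[vec3 (b * y + c) y 1] = 0) -> False.
Proof.
move=> van; pose l : {poly K} := b *: 'X + c%:P.
have rootF1 : F1.[l] = 0.
  apply: (poly_ext charK) => y; rewrite horner0 -[RHS](van y).
  rewrite -!horner_evalE -[LHS]/((horner_eval y \o horner_eval l) _).
  rewrite (mmap_dehom _ _ _ _ (f := idfun)) => [|x]; last first.
    by rewrite /= /horner_eval !hornerC.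
  apply: mmap_ext; apply: ord3P; rewrite /vec3 /= /horner_eval ?hornerC ?hornerX //.
  by rewrite /l !hornerE.
have [dv|/coprime_bezout [u [v [N [N0 eN]]]]] := dvd_or_coprime ('X - l%:P).
  have := dvdp_leq _ dv; rewrite polyXsubC_eq0 size_XsubC (size_dehom hF F_e0).
  by move=> /(_ isT); rewrite ltnS leqNgt (ltnW d_ge3).
have := congr1 (fun p : {poly {poly K}} => p.[l]) eN.
rewrite hornerD !hornerM hornerXsubC subrr rootF1 !mulr0 addr0 hornerC => /esym/eqP.
by rewrite (negPf N0).
Qed.

End FunctionField.

(** * Linearity of the elements of G[P] *)

Definition lin_tuple (K : fieldType) (M : 'M[K]_3) : 3.-tuple {mpoly K[3]} :=
  [tuple \sum_j M j i *: 'X_j | i < 3].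

Definition subst_lin (K : fieldType) (F : {mpoly K[3]}) (M : 'M[K]_3) : {mpoly K[3]} :=
  F \mPo lin_tuple M.

Section LinearSubstitution.

Variable K : fieldType.
Implicit Types (F : {mpoly K[3]}) (M : 'M[K]_3) (v : 'rV[K]_3).

Lemma meval_lin_tuple M v i : (tnth (lin_tuple M) i).@[v 0] = (v *m M) 0 i.
Proof.
rewrite tnth_mktuple rmorph_sum /= mxE; apply: eq_bigr => j _.
by rewrite mevalZ mevalXU mulrC.
Qed.

Lemma lin_tuple_homog M i : tnth (lin_tuple M) i \is 1.-homog.
Proof.
rewrite tnth_mktuple; apply: rpred_sum => j _.
exact/dhomogZ/dhomog_var.
Qed.

Lemma meval_comp F (f : 3.-tuple {mpoly K[3]}) (v w : 'rV[K]_3) :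
  (forall i, (tnth f i).@[v 0] = w 0 i) -> (F \mPo f).@[v 0] = F.@[w 0].
Proof. by move=> fw; rewrite comp_mpoly_meval; apply: meval_eq => i; rewrite fw. Qed.

Lemma meval_subst_lin F M v : (subst_lin F M).@[v 0] = F.@[(v *m M) 0].
Proof. by apply: meval_comp => i; rewrite meval_lin_tuple. Qed.

Lemma comp_homog (p : {mpoly K[3]}) (f : 3.-tuple {mpoly K[3]}) d m :
  p \is d.-homog -> (forall i, tnth f i \is m.-homog) -> p \mPo f \is (m * d).-homog.
Proof.
move=> /dhomogP hp hf; rewrite comp_mpolyE big_seq; apply: rpred_sum => e /hp <-.
apply: dhomogZ; rewrite /= mdegE big_distrr /=.
elim/big_rec2: _ => [|i j q _ hq]; first exact: dhomog1.
by apply: dhomogM => //; apply: dhomogMn.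
Qed.

Lemma subst_lin_homog F M d : F \is d.-homog -> subst_lin F M \is d.-homog.
Proof.
by move=> hF; rewrite -[d]mul1n; apply: comp_homog => // i; apply: lin_tuple_homog.
Qed.

End LinearSubstitution.

(** * Frames and rows of matrices *)

Definition mx3 (K : fieldType) (a b c : 'rV[K]_3) : 'M[K]_3 := \matrix_i vec3 a b c i.

Section Rows.

Variable K : fieldType.
Implicit Types (v a b c : 'rV[K]_3).

Lemma row3_eta v : v = row3 (v 0 0) (v 0 1) (v 0 2%:R).
Proof. by apply/rowP => i; rewrite mxE -(vec3E (v 0)). Qed.

Lemma mul_mx3 x y z a b c :
  row3 x y z *m mx3 a b c = x *: a + y *: b + z *: c.
Proof.
apply/rowP => i; rewrite !mxE !big_ord_recl big_ord0 !mxE /vec3 /=; ring.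
Qed.

Lemma row3Z (t x y z : K) : t *: row3 x y z = row3 (t * x) (t * y) (t * z).
Proof. by apply/rowP; apply: ord3P; rewrite !mxE. Qed.

Lemma row3D (x y z x' y' z' : K) :
  row3 x y z + row3 x' y' z' = row3 (x + x') (y + y') (z + z').
Proof. by apply/rowP; apply: ord3P; rewrite !mxE. Qed.

Lemma row3_inj (x y z x' y' z' : K) :
  row3 x y z = row3 x' y' z' -> [/\ x = x', y = y' & z = z'].
Proof.
by move=> /rowP e; split; [have := e 0|have := e 1|have := e 2%:R]; rewrite !mxE.
Qed.

Lemma row3_eq0 (x y z : K) : (row3 x y z == 0) = [&& x == 0, y == 0 & z == 0].
Proof.
apply/eqP/and3P => [e|[/eqP-> /eqP-> /eqP->]].
  by split; apply/eqP; [have /rowP/(_ 0) := e|have /rowP/(_ 1) := e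
    |have /rowP/(_ 2%:R) := e]; rewrite !mxE.
by apply/rowP; apply: ord3P; rewrite !mxE.
Qed.

Lemma mul_row_mx3 M a b c : mx3 a b c *m M = mx3 (a *m M) (b *m M) (c *m M).
Proof.
apply/row_matrixP => i; rewrite row_mul !rowK; move: i.
by apply: ord3P; rewrite /vec3 /=.
Qed.

Lemma mx3_1 : mx3 (row3 1 0 0) (row3 0 1 0) (row3 0 0 1) = 1%:M :> 'M[K]_3.
Proof.
by apply/matrixP; apply: ord3P; apply: ord3P; rewrite !mxE /vec3 /= .
Qed.

Lemma complete_frame (P : 'rV[K]_3) : P != 0 ->
  exists2 M : 'M[K]_3, M \in unitmx & row3 1 0 0 *m M = P.
Proof.
move=> P0; have rP : \rank P = 1%N.
  by apply/eqP; rewrite eqn_leq rank_leq_row lt0n mxrank_eq0.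
have := mulmx_ebase P; rewrite rP => eP.
pose c := col_ebase P 0 0; exists (c *: row_ebase P).
  rewrite unitmxZ ?row_ebase_unit // unitfE.
  have := col_ebase_unit P; rewrite unitmxE det_mx11 unitfE; exact.
rewrite -{2}eP -scalemxAr [col_ebase P]mx11_scalar mul_scalar_mx -scalemxAl.
congr (_ *: (_ *m _)); apply/rowP; apply: ord3P; rewrite !mxE /vec3 //=.
Qed.

End Rows.

(** * Smoothness and changes of coordinates *)

Section Smooth.

Variables (K : closedFieldType) (charK : [pchar K] =i pred0).

(** Smoothness through directional derivatives, a form that is visibly stable under linear
    substitutions. *)
Definition smooth_form (F : {mpoly K[3]}) : Prop :=
  forall v : 'rV[K]_3, v != 0 -> F.@[v 0] = 0 -> exists w, (restr F v w)`_1 != 0.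

Lemma smooth_plane_curveP (F : {mpoly K[3]}) d :
  smooth_plane_curve F d -> F \is d.-homog /\ smooth_form F.
Proof.
case=> _ hF sm; split=> // v v0 Fv; have [//|i Fi] := sm v.
exists (delta_mx 0 i); rewrite coef1_restr (bigD1 i) //= big1 ?addr0.
  by rewrite mxE !eqxx mul1r.
by move=> j ji; rewrite mxE eqxx (negPf ji) mul0r.
Qed.

Lemma restr_subst_lin F (M : 'M[K]_3) v w :
  restr (subst_lin F M) v w = restr F (v *m M) (w *m M).
Proof.
apply: (poly_ext charK) => s.
by rewrite !horner_restr meval_subst_lin mulmxDl scalemxAl.
Qed.

Lemma smooth_subst_lin F M : M \in unitmx -> smooth_form F ->
  smooth_form (subst_lin F M).
Proof.
move=> uM sF v v0; rewrite meval_subst_lin => Fv.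
have [|w wP] := sF _ _ Fv.
  by apply: contraNneq v0 => vM; rewrite -(mulmxK uM v) vM mul0mx.
by exists (w *m invmx M); rewrite restr_subst_lin mulmxKV.
Qed.

(** Since F(1,0,0) is nonzero, a point of C with z = 0 has y nonzero. It lies in the chart obtained
    by exchanging y and z, where vanishing away from one fibre already gives divisibility by the
    equation of C. *)
Lemma vanish_ext (F g : {mpoly K[3]}) d m :
    F \is d.-homog -> F.@[row3 1 0 0 0] != 0 -> smooth_form F -> g \is m.-homog ->
    (forall v : 'rV[K]_3, F.@[v 0] = 0 -> v 0 2%:R != 0 -> g.@[v 0] = 0) ->
  forall v : 'rV[K]_3, v != 0 -> F.@[v 0] = 0 -> g.@[v 0] = 0.
Proof.
move=> hF F0 sF hg van v v0 Fv.
have [v2|] := eqVneq (v 0 2%:R) 0; last exact: van.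
pose S := mx3 (row3 1 0 0) (row3 0 0 1) (row3 0 1 0) : 'M[K]_3.
have mulS (x y z : K) : row3 x y z *m S = row3 x z y.
  by rewrite mul_mx3 !row3Z !row3D; congr row3; ring.
have uS : S \in unitmx.
  have : S *m S = 1%:M by rewrite mul_row_mx3 !mulS mx3_1.
  by case/mulmx1_unit.
have vE : v = row3 (v 0 0) (v 0 1) 0 by rewrite {1}[v]row3_eta v2.
have v1 : v 0 1 != 0.
  apply: contraNneq F0 => v1; have x0 : v 0 0 != 0.
    by apply: contraNneq v0 => x0; rewrite vE row3_eq0 x0 v1 eqxx.
  have ve : v = v 0 0 *: row3 1 0 0 by rewrite {1}vE v1 row3Z mulr1 mulr0.
  move: Fv; rewrite ve.
  rewrite (homogZ _ _ hF) => /eqP; rewrite mulf_eq0 expf_eq0.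
  by rewrite (negPf x0) andbF.
have : dehom (subst_lin F S) %| dehom (subst_lin g S).
  apply: (vanish_dvd_form charK (subst_lin_homog _ hF) _ (smooth_subst_lin uS sF) (D := 'X)).
  - by rewrite -meval_row3 meval_subst_lin mulS.
  - by rewrite polyX_eq0.
  move=> x y Dy; have y0 : y != 0 by rewrite hornerX in Dy.
  rewrite -!meval_row3 !meval_subst_lin !mulS => Fxy.
  by apply: van => //; rewrite mxE.
have F0' : (subst_lin F S).@[vec3 1 0 0] != 0.
  by rewrite -meval_row3 meval_subst_lin mulS.
move=> /(dvd_dehomP (subst_lin_homog _ hF) F0') [q eq].
have ev := @at_xy_dehom K _ (v 0 0 / v 0 1) 0.
have vS : v = v 0 1 *: (row3 (v 0 0 / v 0 1) 0 1 *m S).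
  by rewrite mulS row3Z mulrC divfK // mulr1 mulr0.
rewrite vS (homogZ _ _ hg) -meval_subst_lin meval_row3 -ev eq hornerM hornerM ev.
rewrite -meval_row3 meval_subst_lin.
move: Fv; rewrite {1}vS (homogZ _ _ hF) => /eqP; rewrite mulf_eq0 expf_eq0 (negPf v1) andbF /=.
by move=> /eqP ->; rewrite !mulr0.
Qed.

End Smooth.

(** * Lifting elements of G[P] to matrices *)

Section LinearOfG.

Variables (K : closedFieldType) (charK : [pchar K] =i pred0).
Variables (F : {mpoly K[3]}) (d : nat).
Hypotheses (hF : F \is d.-homog) (sF : smooth_form F) (d_ge3 : (2 < d)%N).

(** Coordinates with P = (1 : 0 : 0) in which the line z = 0 through P meets C in distinct points,
    the condition that [integral_degree] needs at infinity. *)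
Definition good_frame (P : 'rV[K]_3) (M : 'M[K]_3) : Prop :=
  [/\ M \in unitmx, row3 1 0 0 *m M = P
    & separable_poly (mmap (@polyC K) (vec3 'X 1 0) (subst_lin F M))].

Lemma good_frame_exists (P : 'rV[K]_3) : P != 0 -> F.@[P 0] != 0 ->
  exists M, good_frame P M.
Proof.
move=> P0 FP; have [M0 uM0 eM0] := complete_frame P0.
have F0e : (subst_lin F M0).@[vec3 1 0 0] != 0.
  by rewrite -meval_row3 meval_subst_lin eM0.
have [N N0 sepN] := separable_fibre charK (subst_lin_homog M0 hF) F0e
  (smooth_subst_lin charK uM0 sF).
have /closed_nonrootP [y Ny] := N0.
(* This matrix carries (x, 1, 0) to (x, y, 1): the separable fibre over [y] becomes the line at
   infinity. *)
pose A := mx3 (row3 1 0 0) (row3 0 y 1) (row3 0 1 0) : 'M[K]_3.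
have mulA (a b c : K) : row3 a b c *m A = row3 a (b * y + c) b.
  by rewrite mul_mx3 !row3Z !row3D; congr row3; ring.
have uA : A \in unitmx.
  have : mx3 (row3 1 0 0) (row3 0 0 1) (row3 0 1 (- y)) *m A = 1%:M.
    by rewrite mul_row_mx3 !mulA mul0r mul1r addrN addr0 add0r mx3_1.
  by case/mulmx1_unit.
exists (A *m M0); split.
- by rewrite unitmx_mul uA.
- by rewrite mulmxA mulA mul0r addr0.
suff -> : mmap (@polyC K) (vec3 'X 1 0) (subst_lin F (A *m M0)) =
    at_y y (dehom (subst_lin F M0)) by apply: sepN.
apply: (poly_ext charK) => x; rewrite horner_at_y.
apply: etrans (esym (at_xy_dehom _ _ _)).
rewrite -[LHS]/(horner_eval x _).
rewrite (mmap_comp (f' := idfun) (h' := vec3 x 1 0)); last 2 first.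
- by move=> c; rewrite /= /horner_eval hornerC.
- by apply: ord3P; rewrite /vec3 /= /horner_eval ?hornerX ?hornerC.
by rewrite -[LHS]meval_row3 -meval_row3 !meval_subst_lin mulmxA mulA mul1r addr0.
Qed.

Lemma frame_e0 P M : good_frame P M -> F.@[P 0] != 0 ->
  (subst_lin F M).@[vec3 1 0 0] != 0.
Proof. by case=> _ eM _; rewrite -meval_row3 meval_subst_lin eM. Qed.

Lemma line_not_in_curve (P : 'rV[K]_3) (a : 'cV[K]_3) :
    P != 0 -> F.@[P 0] != 0 -> (P *m a) 0 0 != 0 ->
    (forall v : 'rV[K]_3, (v *m a) 0 0 = 0 -> F.@[v 0] = 0) -> False.
Proof.
move=> P0 FP aP van; have [M gM] := good_frame_exists P0 FP.
have [uM eM sM] := gM.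
have := no_linear_factor charK (subst_lin_homog M hF) (frame_e0 gM FP)
  (smooth_subst_lin charK uM sF) d_ge3 sM.
pose t (v : 'rV[K]_3) := (v *m M *m a) 0 0.
have tD v w : t (v + w) = t v + t w by rewrite /t !mulmxDl mxE.
have tZ c v : t (c *: v) = c * t v by rewrite /t -!scalemxAl mxE.
have t0 : t (row3 1 0 0) != 0 by rewrite /t eM.
move=> /(_ (- t (row3 0 1 0) / t (row3 1 0 0)) (- t (row3 0 0 1) / t (row3 1 0 0))).
apply=> y; rewrite -meval_row3 meval_subst_lin; apply: van.
set x := _ + _; rewrite -/(t _).
have -> : row3 x y 1 = x *: row3 1 0 0 + y *: row3 0 1 0 + row3 0 0 1.
  by rewrite !row3Z !row3D; congr row3; ring.
by rewrite !tD !tZ /x; field.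
Qed.

Section Frame.

Variables (P : 'rV[K]_3) (M : 'M[K]_3).
Hypotheses (FP : F.@[P 0] != 0) (gM : good_frame P M).

Local Notation FM := (subst_lin F M).

Let hFM : FM \is d.-homog := subst_lin_homog M hF.
Let FMe := frame_e0 gM FP.
Let uM : M \in unitmx. Proof. by case: gM. Qed.
Let eM : row3 1 0 0 *m M = P. Proof. by case: gM. Qed.
Let sFM := smooth_subst_lin charK uM sF.
Let sM : separable_poly (mmap (@polyC K) (vec3 'X 1 0) FM). Proof. by case: gM. Qed.

(** F(L, y, 1) has x-degree at most d, so its quotient by F1 is a constant, found to be a^d on
    leading terms. If a were 0, the quotient would vanish and F would contain a line. *)
Lemma ev2_affine_eq (a b c : K) : dehom FM %| ev2 FM (affine a b c) 1 ->
  a != 0 /\ forall x y z, FM.@[vec3 (a * x + b * y + c * z) y z] = a ^+ d * FM.@[vec3 x y z].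
Proof.
move=> /(dvd_dehomP hFM FMe) [Q eQ].
have sev : (size (ev2 FM (affine a b c) 1) <= d.+1)%N /\
    (ev2 FM (affine a b c) 1)`_d = (a ^+ d * FM.@[vec3 1 0 0])%:P.
  have [] := @mmap_top K {poly K} 3 (@polyC K) cst2
    (vec3 (affine a b c) (1%:P * 'X%:P) 1%:P) FM d 1 (fun=> erefl) hFM.
    apply: ord3P; rewrite /vec3 /=; first exact: size_affine.
      by rewrite mul1r; apply: leq_trans (size_polyC_leq1 _) _.
    by rewrite size_poly1.
  rewrite muln1 -/(ev2 _ _ _) => s ->; split=> //.
  rewrite (mmap_ext _ (h' := vec3 a%:P 0 0)) ?(mmap_e0 _ _ hFM).
    by rewrite rmorphM rmorphXn.
  apply: ord3P; rewrite /vec3 /= /affine.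
  - by rewrite coefD coefCM coefX coefC mulr1 addr0.
  - by rewrite mul1r coefC.
  - by rewrite coefC.
have [F10 sF1] := (dehom_neq0 hFM FMe, size_dehom hFM FMe).
have ev_at x y : (ev2 FM (affine a b c) 1).[x%:P].[y] = FM.@[vec3 (a * x + b * y + c) y 1].
  by rewrite at_xy_ev2 affine_at !hornerC mul1r.
have a0 : a != 0.
  apply/eqP => a0.
  have Q0 : Q = 0.
    apply/eqP/negPn/negP => Q0; have [s _] := sev.
    have c0 : (ev2 FM (affine a b c) 1)`_d = 0.
      by have [_ ->] := sev; rewrite a0 expr0n gtn_eqF ?mul0r //; lia.
    have : (size (ev2 FM (affine a b c) 1) <= d)%N.
      apply/leq_sizeP => j; rewrite leq_eqVlt => /predU1P [<-|hj]; first by rewrite c0.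
      by apply: nth_default; apply: leq_trans hj.
    rewrite eQ size_mul // sF1; have : (0 < size Q)%N by rewrite size_poly_gt0.
    by move: (size Q) => q; lia.
  apply: (no_linear_factor charK hFM FMe sFM d_ge3 sM (b := b) (c := c)) => y.
  have := ev_at 0 y; rewrite a0 mul0r add0r => <-.
  by rewrite -a0 eQ Q0 mul0r !horner0.
split=> //.
have adF : a ^+ d * FM.@[vec3 1 0 0] != 0 by rewrite mulf_neq0 ?expf_neq0.
have eQc : Q = (a ^+ d)%:P%:P.
  have Q0 : Q != 0.
    apply: contraNneq adF => Q0; case: sev => _; rewrite eQ Q0 mul0r coef0.
    by move=> /esym/eqP; rewrite polyC_eq0.
  have sQ : size Q == 1%N.
    have [s _] := sev; move: s; rewrite eQ size_mul // sF1 addnS /=.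
    have : (0 < size Q)%N by rewrite size_poly_gt0.
    by move: (size Q) => q; lia.
  have /size_poly1P [q q0 eq] := sQ; rewrite eq; congr (_%:P).
  have [_] := sev; rewrite eQ eq coefCM.
  have [_ lF] := size_lead_dehom hFM FMe.
  have -> : (dehom FM)`_d = (FM.@[vec3 1 0 0])%:P by rewrite -lF lead_coefE sF1.
  by rewrite rmorphM /= => /mulIf; apply; rewrite polyC_eq0.
have aff x y : FM.@[vec3 (a * x + b * y + c) y 1] = a ^+ d * FM.@[vec3 x y 1].
  rewrite -ev_at eQ eQc hornerM hornerM !hornerC; congr (_ * _).
  exact: at_xy_dehom.
move=> x y z; rewrite -!meval_row3.
pose p := restr FM (row3 (a * x + b * y) y 0) (row3 c 0 1) -
  (a ^+ d) *: restr FM (row3 x y 0) (row3 0 0 1).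
have pE w : p.[w] = FM.@[row3 (a * x + b * y + c * w) y w 0] -
    a ^+ d * FM.@[row3 x y w 0].
  rewrite /p !(hornerE, horner_restr) !row3Z !row3D !mulr0 !mulr1 !addr0 !add0r.
  by rewrite [w * c]mulrC.
suff p0 : p = 0.
  by have := pE z; rewrite p0 horner0 => /esym/eqP; rewrite subr_eq0 => /eqP.
apply: (poly_eq0_fun charK (D := 'X)); first by rewrite polyX_eq0.
move=> w; rewrite hornerX => w0; rewrite pE.
have -> : row3 (a * x + b * y + c * w) y w =
    w *: row3 (a * (x / w) + b * (y / w) + c) (y / w) 1.
  by rewrite row3Z; congr row3; field.
have -> : row3 x y w = w *: row3 (x / w) (y / w) 1.
  by rewrite row3Z; congr row3; field.
by rewrite !(homogZ _ _ hFM) !meval_row3 aff; ring.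
Qed.

End Frame.

End LinearOfG.

Lemma meval_dhomog1 (K : fieldType) (p : {mpoly K[3]}) (a : K) (v w : 'rV[K]_3) :
  p \is 1.-homog -> p.@[(a *: v + w) 0] = a * p.@[v 0] + p.@[w 0].
Proof.
move=> /dhomogP hp; rewrite !mevalE mulr_sumr -big_split /=.
apply: eq_big_seq => m /hp /eqP /mdeg1P [i /eqP ->].
have U u : \prod_j u j ^+ (U_(i)%MM : 'X_{1..3}) j = u i :> K.
  by have := mmap1U u i; rewrite /mmap1.
by rewrite !U !mxE; ring.
Qed.

Lemma collinear_mul (K : fieldType) (x y : 'rV[K]_3) (M : 'M[K]_3) :
  (forall i j, x 0 i * y 0 j = x 0 j * y 0 i) ->
  forall i j, (x *m M) 0 i * (y *m M) 0 j = (x *m M) 0 j * (y *m M) 0 i.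
Proof.
move=> xy i j; rewrite !mxE !big_distrlr /= exchange_big /=.
apply: eq_bigr => k _; apply: eq_bigr => l _.
transitivity (x 0 l * y 0 k * (M l i * M k j)); first by ring.
by rewrite xy; ring.
Qed.

Section LinearOfG.

Variables (K : closedFieldType) (charK : [pchar K] =i pred0).
Variables (F : {mpoly K[3]}) (d : nat).
Hypotheses (hF : F \is d.-homog) (sF : smooth_form F) (d_ge3 : (2 < d)%N).

Lemma dvd_dehom_curve (P : 'rV[K]_3) (M : 'M[K]_3) (g : {mpoly K[3]}) m :
    F.@[P 0] != 0 -> good_frame F P M -> g \is m.-homog ->
    dehom (subst_lin F M) %| dehom g ->
  forall u : 'rV[K]_3, u != 0 -> (subst_lin F M).@[u 0] = 0 -> g.@[u 0] = 0.
Proof.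
move=> FP gM hg; have FMe := frame_e0 gM FP; have hFM := subst_lin_homog M hF.
have [uM _ _] := gM.
move=> /(dvd_dehomP hFM FMe) [q eq].
apply: (vanish_ext charK hFM _ (smooth_subst_lin charK uM sF) hg).
  by rewrite meval_row3.
move=> u Fu u2; have eu : u = u 0 2%:R *: row3 (u 0 0 / u 0 2%:R) (u 0 1 / u 0 2%:R) 1.
  by rewrite row3Z {1}[u]row3_eta; congr row3; field.
set x := u 0 0 / _ in eu; set y := u 0 1 / _ in eu.
have Fxy : (subst_lin F M).@[vec3 x y 1] = 0.
  move: Fu; rewrite eu (homogZ _ _ hFM) meval_row3 => /eqP.
  by rewrite mulf_eq0 expf_eq0 (negPf u2) andbF => /eqP.
have gxy : g.@[vec3 x y 1] = 0.
  apply: etrans (esym (at_xy_dehom _ _ _)) _; rewrite eq hornerM hornerM.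
  by apply/eqP; rewrite mulf_eq0; apply/orP; right; apply/eqP;
     apply: etrans (at_xy_dehom _ _ _) Fxy.
by rewrite eu (homogZ _ _ hg) meval_row3 gxy mulr0.
Qed.

Section Lift.

Variables (P : 'rV[K]_3) (tau : 3.-tuple {mpoly K[3]}) (M : 'M[K]_3).
Hypotheses (P0 : P != 0) (FP : F.@[P 0] != 0) (Gtau : G F P tau).
Hypothesis gM : good_frame F P M.

Let uM : M \in unitmx. Proof. by case: gM. Qed.
Let eM : row3 1 0 0 *m M = P. Proof. by case: gM. Qed.

Local Notation FM := (subst_lin F M).

Definition row_eval (f : 3.-tuple {mpoly K[3]}) (v : 'rV[K]_3) : 'rV[K]_3 :=
  \row_i (tnth f i).@[v 0].

(** The components of [tau] in the coordinates of the frame [M]. *)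
Definition frame_map (i : 'I_3) : {mpoly K[3]} :=
  \sum_j invmx M j i *: subst_lin (tnth tau j) M.

Local Notation h := frame_map.

Lemma frame_mapE (u : 'rV[K]_3) i : (h i).@[u 0] = (row_eval tau (u *m M) *m invmx M) 0 i.
Proof.
rewrite rmorph_sum mxE; apply: eq_bigr => j _ /=.
by rewrite mevalZ mxE meval_subst_lin mulrC.
Qed.

Lemma frame_map_row (u : 'rV[K]_3) : \row_i (h i).@[u 0] *m M = row_eval tau (u *m M).
Proof.
rewrite -[RHS](mulmxKV uM); congr (_ *m _).
by apply/rowP => i; rewrite mxE frame_mapE.
Qed.

Lemma on_curve_frame (u : 'rV[K]_3) : u != 0 -> FM.@[u 0] = 0 -> on_curve F (u *m M).
Proof.
move=> u0 Fu; split; last by rewrite -meval_subst_lin.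
by apply: contraNneq u0 => uM0; rewrite -(mulmxK uM u) uM0 mul0mx.
Qed.

Lemma frame_map_curve (u : 'rV[K]_3) : u != 0 -> FM.@[u 0] = 0 ->
  FM.@[vec3 (h 0).@[u 0] (h 1).@[u 0] (h 2%:R).@[u 0]] = 0.
Proof.
case: Gtau => [[[_ vF] _] _] u0 Fu.
have := vF _ (on_curve_frame u0 Fu).
rewrite (@meval_comp _ _ _ _ (row_eval tau (u *m M))) => [|i]; last by rewrite mxE.
rewrite -frame_map_row -meval_subst_lin => <-.
by apply: meval_eq; apply: ord3P; rewrite mxE.
Qed.

Lemma frame_map_proj x y : FM.@[vec3 x y 1] = 0 ->
  (h 1).@[vec3 x y 1] = y * (h 2%:R).@[vec3 x y 1].
Proof.
case: Gtau => [_ [l [hl lP] [_ _ lt]]] Fxy; set u := row3 x y 1.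
have u0 : u != 0 by rewrite row3_eq0 oner_eq0 !andbF.
have Fu : FM.@[u 0] = 0 by rewrite meval_row3.
have := lt 0 1 _ (on_curve_frame u0 Fu).
rewrite mevalB !mevalM !tnth_mktuple => /eqP; rewrite subr_eq0 => /eqP.
have hw i : (tnth l i \mPo tau).@[(u *m M) 0] = (tnth l i).@[row_eval tau (u *m M) 0].
  by apply: meval_comp => j; rewrite mxE.
rewrite !hw -frame_map_row.
pose w1 := row3 0 1 0 *m M; pose w2 := row3 0 0 1 *m M.
have lP0 i : (tnth l i).@[P 0] = 0.
  by apply: (lP P P0).2; exists 1; rewrite ?oner_eq0 // scale1r.
have lcomb i a b c : (tnth l i).@[(row3 a b c *m M) 0] =
    b * (tnth l i).@[w1 0] + c * (tnth l i).@[w2 0].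
  have -> : row3 a b c *m M = a *: P + (b *: w1 + (c *: w2 + 0)).
    rewrite addr0 -eM /w1 /w2 !scalemxAl -!mulmxDl; congr (_ *m _).
    by rewrite !row3Z !row3D; congr row3; ring.
  have l0 : (tnth l i).@[(0 : 'rV[K]_3) 0] = 0.
    by rewrite -(scale0r P) (homogZ _ _ (hl i)) lP0 mulr0.
  by rewrite !(meval_dhomog1 _ _ _ (hl i)) lP0 l0 mulr0 add0r addr0.
have -> : \row_i (h i).@[u 0] = row3 (h 0).@[u 0] (h 1).@[u 0] (h 2%:R).@[u 0].
  by apply/rowP; apply: ord3P; rewrite !mxE.
rewrite -!meval_row3 -/u.
move: (h 0).@[_] (h 1).@[_] (h 2%:R).@[_] => h0 h1 h2.
rewrite (lcomb 0 h0) (lcomb 1 h0) (lcomb 0 x) (lcomb 1 x) !mul1r.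
set a0 := (tnth l 0).@[w1 0]; set b0 := (tnth l 0).@[w2 0].
set a1 := (tnth l 1).@[w1 0]; set b1 := (tnth l 1).@[w2 0] => e.
(* The two linear forms of the projection vanish together only at P, so they are independent on the
   plane spanned by [w1] and [w2]; any other projection from P is thereby compared with (y : z). *)
have det0 : a0 * b1 - a1 * b0 != 0.
  apply/eqP => det0.
  have [[s t] /= [st0 e0 e1]] : exists st : K * K,
      [/\ (st.1 != 0) || (st.2 != 0), st.1 * a0 + st.2 * b0 = 0
        & st.1 * a1 + st.2 * b1 = 0].
    have [ea0|a00] := eqVneq a0 0; have [eb0|b00] := eqVneq b0 0.
    - have [ea1|a10] := eqVneq a1 0.
        by exists (1, 0) => /=; rewrite oner_eq0 ea0 ea1; split=> //; ring.
      by exists (b1, - a1) => /=; rewrite oppr_eq0 a10 orbT ea0 eb0; split=> //; ring.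
    - by exists (b0, - a0) => /=; rewrite b00; split=> //; [ring|rewrite -[RHS]oppr0 -det0; ring].
    - by exists (b0, - a0) => /=; rewrite oppr_eq0 a00 orbT; split=> //; [ring|rewrite -[RHS]oppr0 -det0; ring].
    - by exists (b0, - a0) => /=; rewrite b00; split=> //; [ring|rewrite -[RHS]oppr0 -det0; ring].
  have w0 : row3 0 s t *m M != 0.
    apply/eqP => /(congr1 (mulmx^~ (invmx M))); rewrite mulmxK // mul0mx => /eqP.
    by rewrite row3_eq0 eqxx /=; apply/negP; rewrite negb_and.
  have [|c c0] := (lP _ w0).1.
    by move=> i; rewrite lcomb; move: i => [[|[|i]] hi] //;
      [have -> : Ordinal hi = 0 by apply/val_inj|have -> : Ordinal hi = 1 by apply/val_inj].
  rewrite -eM scalemxAl => /(congr1 (mulmx^~ (invmx M))); rewrite !mulmxK // row3Z.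
  move=> /row3_inj [_ s0 t0]; move: st0.
  by rewrite s0 t0 !mulr0 eqxx.
apply/eqP; rewrite -subr_eq0; apply/eqP/(mulIf det0); rewrite mul0r.
by rewrite -(subrr ((h1 * a1 + h2 * b1) * (y * a0 + b0))) -{1}e; ring.
Qed.

(** By [frame_map_proj] the tuple h is (h0 : y h2 : h2) modulo the curve, the situation of
    [linear_lift]. Divisibilities in the chart z = 1 pass to all points of C by
    [dvd_dehom_curve]. *)
Lemma frame_lift : exists a b c, [/\ a != 0,
  forall x y z, FM.@[vec3 (a * x + b * y + c * z) y z] = a ^+ d * FM.@[vec3 x y z]
  & forall u : 'rV[K]_3, u != 0 -> FM.@[u 0] = 0 ->
    let t := row3 (a * u 0 0 + b * u 0 1 + c * u 0 2%:R) (u 0 1) (u 0 2%:R) in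
    forall i j, (h i).@[u 0] * t 0 j = (h j).@[u 0] * t 0 i].
Proof.
have hFM := subst_lin_homog M hF; have FMe := frame_e0 gM FP.
have sFM := smooth_subst_lin charK uM sF.
have sM : separable_poly (mmap (@polyC K) (vec3 'X 1 0) FM) by case: gM.
have [[[[m hm] [i0 nv]] _] _] : Bir F tau by case: Gtau.
have hh i : h i \is m.-homog.
  by apply: rpred_sum => j _; apply/dhomogZ/subst_lin_homog.
have dehomB g g' : dehom (g - g') = dehom g - dehom g' :> {poly {poly K}}.
  exact: mmapB.
have dehomM g g' : dehom (g * g') = dehom g * dehom g' :> {poly {poly K}}.
  exact: rmorphM.
have dehomX i : dehom 'X_i = vec3 'X 'X%:P 1 i :> {poly {poly K}}.
  by rewrite /dehom mmapX mmap1U.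
have nz1 x y : row3 x y 1 != 0 :> 'rV[K]_3 by rewrite row3_eq0 oner_eq0 !andbF.
have dv12 : dehom FM %| dehom (h 1) - 'X%:P * dehom (h 2%:R).
  have -> : dehom (h 1) - 'X%:P * dehom (h 2%:R) = dehom (h 1 - 'X_1 * h 2%:R).
    by rewrite dehomB dehomM dehomX.
  apply: (vanish_dvd_form charK hFM FMe sFM (oner_neq0 _)) => x y _ Fxy.
  by rewrite mevalB mevalM mevalXU (frame_map_proj Fxy) subrr.
have dvF : dehom FM %| mmap cst2 (vec3 (dehom (h 0)) (dehom (h 1)) (dehom (h 2%:R))) FM.
  apply: (vanish_dvd charK hFM FMe sFM (oner_neq0 _)) => x y _.
  move=> /(etrans (esym (at_xy_dehom FM x y))) Fxy.
  apply: (etrans (at_xy_mmap _ _ _ _ _ _)); rewrite -meval_row3 in Fxy.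
  rewrite -[RHS](frame_map_curve (nz1 x y) Fxy); apply: meval_eq.
  by apply: ord3P; rewrite /vec3 /= meval_row3; apply: at_xy_dehom.
(* Otherwise all three components of [tau] would vanish on C, against its being a rational map. *)
have nf : ~ (dehom FM %| dehom (h 0) /\ dehom FM %| dehom (h 2%:R)).
  move=> [dv0 dv2]; apply: nv => v [v0 Fv].
  have dvh i : dehom FM %| dehom (h i).
    move: i; apply: ord3P; [exact: dv0| |exact: dv2].
    rewrite -(subrK ('X%:P * dehom (h 2%:R)) (dehom (h 1))).
    by apply: dvdp_add; [exact: dv12|exact: (dvdp_mull _ dv2)].
  have w0 : v *m invmx M != 0.
    by apply: contraNneq v0 => e; rewrite -(mulmxKV uM v) e mul0mx.
  have Fw : FM.@[(v *m invmx M) 0] = 0 by rewrite meval_subst_lin mulmxKV.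
  have := frame_map_row (v *m invmx M); rewrite mulmxKV //.
  have -> : \row_i (h i).@[(v *m invmx M) 0] = 0.
    apply/rowP => i; rewrite !mxE.
    exact: (dvd_dehom_curve FP gM (hh i) (dvh i) w0 Fw).
  by rewrite mul0mx => /rowP/(_ i0); rewrite !mxE.
have [a [b [c [dv0 dvE]]]] :=
  linear_lift charK hFM FMe sFM d_ge3 sM dv12 dvF nf.
have [a0 FE] := ev2_affine_eq charK hF sF d_ge3 FP gM dvE.
exists a, b, c; split=> // u u0 Fu.
pose t : 3.-tuple {mpoly K[3]} :=
  [tuple vec3 (a *: 'X_0 + b *: 'X_1 + c *: 'X_2%:R) 'X_1 'X_2%:R i | i < 3].
have tE i : (tnth t i).@[u 0] =
    row3 (a * u 0 0 + b * u 0 1 + c * u 0 2%:R) (u 0 1) (u 0 2%:R) 0 i.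
  rewrite tnth_mktuple mxE; move: i; apply: ord3P; rewrite /vec3 /= ?mevalXU //.
  by rewrite !mevalD !mevalZ !mevalXU.
have ht i : tnth t i \is 1.-homog.
  rewrite tnth_mktuple; move: i; apply: ord3P; rewrite /vec3 /= ?dhomog_var //.
  by rewrite !rpredD // dhomogZ // dhomog_var.
have dt0 : dehom (tnth t 0) = affine a b c.
  rewrite tnth_mktuple /vec3 /= /dehom !mmapD !mmapZ -![mmap _ _ 'X_ _]/(dehom _).
  by rewrite !dehomX /vec3 /= /affine mulr1 polyCD polyCM addrA.
have dt1 : dehom (tnth t 1) = 'X%:P by rewrite tnth_mktuple dehomX.
have dt2 : dehom (tnth t 2%:R) = 1 by rewrite tnth_mktuple dehomX.
have key i j : dehom FM %| dehom (h i) * dehom (tnth t j) - dehom (h j) * dehom (tnth t i) ->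
    (h i).@[u 0] * (tnth t j).@[u 0] = (h j).@[u 0] * (tnth t i).@[u 0].
  move=> dv; apply/eqP; rewrite -subr_eq0 -!mevalM -mevalB; apply/eqP.
  have hg : h i * tnth t j - h j * tnth t i \is (m + 1).-homog.
    by rewrite rpredB // dhomogM.
  apply: (dvd_dehom_curve FP gM hg _ u0 Fu).
  rewrite dehomB !dehomM; exact: dv.
have sym i j : dehom FM %| dehom (h i) * dehom (tnth t j) - dehom (h j) * dehom (tnth t i) ->
   dehom FM %| dehom (h j) * dehom (tnth t i) - dehom (h i) * dehom (tnth t j).
  move=> dv; rewrite -opprB dvdpNr; exact: dv.
have refl i : dehom FM %| dehom (h i) * dehom (tnth t i) - dehom (h i) * dehom (tnth t i).
  by rewrite subrr dvdp0.
have d02 : dehom FM %| dehom (h 0) * dehom (tnth t 2%:R) - dehom (h 2%:R) * dehom (tnth t 0).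
  rewrite dt2 dt0 mulr1 [_ * affine _ _ _]mulrC; exact: dv0.
have d12 : dehom FM %| dehom (h 1) * dehom (tnth t 2%:R) - dehom (h 2%:R) * dehom (tnth t 1).
  rewrite dt2 dt1 mulr1 [_ * 'X%:P]mulrC; exact: dv12.
have d01 : dehom FM %| dehom (h 0) * dehom (tnth t 1) - dehom (h 1) * dehom (tnth t 0).
  rewrite dt0 dt1.
  have -> : dehom (h 0) * 'X%:P - dehom (h 1) * affine a b c =
    'X%:P * (dehom (h 0) - affine a b c * dehom (h 2%:R)) +
    - affine a b c * (dehom (h 1) - 'X%:P * dehom (h 2%:R)) by ring.
  by apply: dvdp_add; [exact: (dvdp_mull _ dv0)|exact: (dvdp_mull _ dv12)].
move=> /= i j; rewrite -!tE; apply: key.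
move: i j; apply: ord3P; apply: ord3P.
- exact: refl.
- exact: d01.
- exact: d02.
- exact: (sym _ _ d01).
- exact: refl.
- exact: d12.
- exact: (sym _ _ d02).
- exact: (sym _ _ d12).
- exact: refl.
Qed.

(** In the frame, the map (x, y, z) to (a x + b y + c z, y, z) moves v by a multiple of P; the form
    phi is (a - 1) x + b y + c z carried back to the original coordinates. *)
Lemma linear_of_G_frame : exists phi : 'cV[K]_3,
  [/\ 1 + (P *m phi) 0 0 != 0,
      forall v : 'rV[K]_3, F.@[(v + (v *m phi) 0 0 *: P) 0] =
        (1 + (P *m phi) 0 0) ^+ d * F.@[v 0]
    & forall v, on_curve F v -> forall i j,
        (tnth tau i).@[v 0] * (v + (v *m phi) 0 0 *: P) 0 j =
        (tnth tau j).@[v 0] * (v + (v *m phi) 0 0 *: P) 0 i].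
Proof.
have [a [b [c [a0 FE col]]]] := frame_lift.
pose phi0 : 'cV[K]_3 := (row3 (a - 1) b c)^T.
have phi0E x y z : (row3 x y z *m phi0) 0 0 = (a - 1) * x + b * y + c * z.
  by rewrite !mxE !big_ord_recl big_ord0 !mxE /vec3 /=; ring.
pose phi := invmx M *m phi0.
have phiE u : (u *m M) *m phi = u *m phi0 by rewrite /phi mulmxA mulmxK.
have Pphi : 1 + (P *m phi) 0 0 = a by rewrite -eM phiE phi0E; ring.
have TE u : u *m M + (u *m M *m phi) 0 0 *: P =
    row3 (a * u 0 0 + b * u 0 1 + c * u 0 2%:R) (u 0 1) (u 0 2%:R) *m M.
  rewrite phiE -eM scalemxAl -mulmxDl {1 2}[u]row3_eta phi0E row3Z row3D.
  by congr (row3 _ _ _ *m _); ring.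
exists phi; rewrite Pphi; split=> // v.
  rewrite -(mulmxKV uM v); move: (v *m invmx M) => u; rewrite TE -!meval_subst_lin meval_row3 FE.
  by congr (_ * _); apply: meval_eq => i; rewrite [RHS]vec3E.
case=> v0 Fv; rewrite -(mulmxKV uM v) TE; set u := v *m invmx M.
have u0 : u != 0 by apply: contraNneq v0 => e; rewrite -(mulmxKV uM v) -/u e mul0mx.
have Fu : FM.@[u 0] = 0 by rewrite meval_subst_lin mulmxKV.
have /collinear_mul cm : forall i j, (\row_k (h k).@[u 0]) 0 i *
    row3 (a * u 0 0 + b * u 0 1 + c * u 0 2%:R) (u 0 1) (u 0 2%:R) 0 j =
    (\row_k (h k).@[u 0]) 0 j *
    row3 (a * u 0 0 + b * u 0 1 + c * u 0 2%:R) (u 0 1) (u 0 2%:R) 0 i.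
  by move=> i j; rewrite [X in X * _ = _]mxE [X in _ = X * _]mxE; apply: col.
move=> i j; have := cm M i j; rewrite frame_map_row.
by rewrite [X in X * _ = _]mxE [X in _ = X * _]mxE.
Qed.

End Lift.

Lemma linear_of_G (P : 'rV[K]_3) (tau : 3.-tuple {mpoly K[3]}) :
    P != 0 -> F.@[P 0] != 0 -> G F P tau ->
  exists phi : 'cV[K]_3,
  [/\ 1 + (P *m phi) 0 0 != 0,
      forall v : 'rV[K]_3, F.@[(v + (v *m phi) 0 0 *: P) 0] =
        (1 + (P *m phi) 0 0) ^+ d * F.@[v 0]
    & forall v, on_curve F v -> forall i j,
        (tnth tau i).@[v 0] * (v + (v *m phi) 0 0 *: P) 0 j =
        (tnth tau j).@[v 0] * (v + (v *m phi) 0 0 *: P) 0 i].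
Proof.
move=> P0 FP Gtau; have [M gM] := good_frame_exists charK hF sF P0 FP.
exact: (linear_of_G_frame P0 FP Gtau gM).
Qed.

End LinearOfG.

(** * The axis of a quasi-Galois point *)

Definition lform (K : fieldType) (a : 'cV[K]_3) (v : 'rV[K]_3) : K := (v *m a) 0 0.

Section LinearForm.

Variable K : fieldType.
Implicit Types (a : 'cV[K]_3) (v w : 'rV[K]_3).

Lemma lformD a v w : lform a (v + w) = lform a v + lform a w.
Proof. by rewrite /lform mulmxDl mxE. Qed.

Lemma lformZ a c v : lform a (c *: v) = c * lform a v.
Proof. by rewrite /lform -scalemxAl mxE. Qed.

Lemma lformB a v w : lform a (v - w) = lform a v - lform a w.
Proof. by rewrite -scaleN1r lformD lformZ mulN1r. Qed.

Lemma lformDl a b v : lform (a + b) v = lform a v + lform b v.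
Proof. by rewrite /lform mulmxDr mxE. Qed.

Lemma lformZl a c v : lform (c *: a) v = c * lform a v.
Proof. by rewrite /lform -scalemxAr mxE. Qed.

Lemma lform_inj a b : (forall v, lform a v = lform b v) -> a = b.
Proof.
move=> ab; apply/matrixP => i j; rewrite ord1; have := ab (delta_mx 0 i).
by rewrite /lform -!rowE !mxE.
Qed.

End LinearForm.

Section PolyScaling.

Variables (K : fieldType) (charK : [pchar K] =i pred0).

Lemma coef_scaling (r : {poly K}) c e :
  (forall s, r.[c * s] = e * r.[s]) -> forall k, r`_k * c ^+ k = e * r`_k.
Proof.
move=> rc k; have : \poly_(i < size r) (r`_i * c ^+ i) = e *: r.
  apply: (poly_ext charK) => s; rewrite hornerZ -rc horner_poly horner_coef.
  by apply: eq_bigr => i _; rewrite exprMn mulrA.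
move/polyP/(_ k); rewrite coef_poly coefZ; case: ltnP => // sk <-.
by rewrite nth_default // mul0r.
Qed.

Lemma scaling_of_coef (r : {poly K}) c e :
  (forall k, r`_k * c ^+ k = e * r`_k) -> forall s, r.[c * s] = e * r.[s].
Proof.
move=> rc s; rewrite !horner_coef mulr_sumr; apply: eq_bigr => i _.
by rewrite exprMn (mulrA r`_i) rc mulrA.
Qed.

Lemma poly_const_of_periodic (r : {poly K}) c :
  c != 0 -> (forall s, r.[s + c] = r.[s]) -> (size r <= 1)%N.
Proof.
move=> c0 rc; have rk k : r.[k%:R * c] = r.[0].
  by elim: k => [|k IH]; rewrite ?mul0r // mulrSr mulrDl mul1r rc.
suff -> : r = r.[0]%:P by apply: size_polyC_leq1.
apply/eqP; rewrite -subr_eq0; apply/negPn/negP => q0.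
have := max_poly_roots q0 (rs := [seq k%:R * c | k <- iota 0 (size (r - r.[0]%:P))]).
rewrite size_map size_iota ltnn => H; suff : false by []; apply: H.
  by apply/allP => _ /mapP [k _ ->]; rewrite rootE !hornerE rk subrr.
rewrite map_inj_uniq ?iota_uniq // => k l /(mulIf c0); exact: natr_inj.
Qed.

End PolyScaling.

Lemma unity_gcd (K : fieldType) (x : K) k l :
  x ^+ k = 1 -> x ^+ l = 1 -> x ^+ (gcdn k l) = 1.
Proof.
have [->|k0] := posnP k; first by rewrite gcd0n.
move=> xk xl; have [u v e _] := egcdnP l k0.
have : x ^+ (u * k) = 1 by rewrite mulnC exprM xk expr1n.
by rewrite e exprD mulnC exprM xl expr1n mul1r.
Qed.

Lemma unity_roots_card (K : fieldType) n k (x : 'I_n -> K) :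
  injective x -> (0 < k)%N -> (forall i, x i ^+ k = 1) -> (n <= k)%N.
Proof.
move=> xi k0 xk; have := @max_unity_roots K k [seq x i | i <- enum 'I_n] k0.
rewrite size_map size_enum_ord; apply.
  by apply/allP => _ /mapP [i _ ->]; apply/unity_rootP.
by rewrite map_inj_uniq ?enum_uniq.
Qed.

Section Axis.

Variables (K : closedFieldType) (charK : [pchar K] =i pred0).
Variables (F : {mpoly K[3]}) (d : nat).
Hypotheses (hF : F \is d.-homog) (sF : smooth_form F) (d_ge3 : (2 < d)%N).
Variable P : 'rV[K]_3.
Hypotheses (P0 : P != 0) (FP : F.@[P 0] != 0).

(** The map v + phi(v) P has centre P: a homology with axis phi = 0 if phi(P) is nonzero, otherwise
    an elation or the identity. It scales P by 1 + phi(P), which fixes the multiplier of F. *)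
Definition central (phi : 'cV[K]_3) : Prop :=
  1 + lform phi P != 0 /\
  forall v, F.@[(v + lform phi v *: P) 0] = (1 + lform phi P) ^+ d * F.@[v 0].

(** One map composed with the inverse of the other is v + delta(v) P with delta(P) = 0. It makes F(u
    + s P) periodic in s, hence constant, whereas its top coefficient F(P) is nonzero. *)
Lemma central_inj phi psi :
  central phi -> central psi -> lform phi P = lform psi P -> phi = psi.
Proof.
case=> a0 hphi [_ hpsi] eP; apply: lform_inj => u.
set al := 1 + lform phi P in a0 hphi; rewrite -eP -/al in hpsi.
have hdiff v : F.@[(v + (lform phi v - lform psi v) *: P) 0] = F.@[v 0].
  (* The preimage of [v] under the map of [psi]. *)
  pose w := v - (lform psi v / al) *: P.
  have e1 : w + lform psi w *: P = v.
    rewrite /w lformB lformZ -eP; have -> : lform phi P = al - 1 by rewrite /al; ring.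
    rewrite -addrA -scaleNr -scalerDl.
    have -> : - (lform psi v / al) + (lform psi v - lform psi v / al * (al - 1)) = 0 by field.
    by rewrite scale0r addr0.
  have e2 : w + lform phi w *: P = v + (lform phi v - lform psi v) *: P.
    rewrite /w lformB lformZ; have -> : lform phi P = al - 1 by rewrite /al; ring.
    rewrite -addrA -scaleNr -scalerDl; congr (_ + _ *: _); by field.
  by rewrite -e2 hphi -hpsi e1.
apply/eqP; rewrite -subr_eq0; set c := _ - _; apply/negPn/negP => c0.
have := poly_const_of_periodic charK c0 (r := restr F u P).
move=> H; have {H} : (size (restr F u P) <= 1)%N.
  apply: H => s; rewrite !horner_restr scalerDl addrA -(hdiff (u + s *: P)).
  by rewrite !lformD !lformZ -eP opprD addrACA subrr addr0.
move=> /leq_sizeP/(_ d); rewrite (coef_top_restr _ _ hF) => F0.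
by move: FP; rewrite F0 ?eqxx // ltnW // ltnW.
Qed.

Lemma central_comp phi psi :
  central phi -> central psi -> central (phi + (1 + lform phi P) *: psi).
Proof.
case=> a0 hphi [b0 hpsi].
have e : 1 + lform (phi + (1 + lform phi P) *: psi) P =
    (1 + lform phi P) * (1 + lform psi P) by rewrite lformDl lformZl; ring.
split; first by rewrite e mulf_neq0.
move=> v; rewrite e exprMn -mulrA -hpsi -hphi; congr (F.@[fun_of_matrix _ 0]).
rewrite lformDl lformZl lformD lformZ -[RHS]addrA -scalerDl; congr (_ + _ *: _); ring.
Qed.

(** The two composites have the same multiplier, so they agree by [central_inj]; commutation is
    exactly this proportionality of the two forms. *)
Lemma central_comm phi psi : central phi -> central psi ->
  lform phi P *: psi = lform psi P *: phi.
Proof.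
move=> hphi hpsi.
have := central_inj (central_comp hphi hpsi) (central_comp hpsi hphi).
have -> : lform (phi + (1 + lform phi P) *: psi) P =
    lform (psi + (1 + lform psi P) *: phi) P by rewrite !lformDl !lformZl; ring.
move=> /(_ erefl) /eqP; rewrite !scalerDl !scale1r !addrA [psi + phi]addrC.
by rewrite (inj_eq (addrI _)) => /eqP.
Qed.

(** The n forms are proportional, so all maps scale P by distinct alpha_i and fix one axis
    pointwise. Comparing coefficients of F(w + s P) for w on the axis then shows that only exponents
    divisible by n occur. *)
Lemma axis_of_central n (phi : 'I_n -> 'cV[K]_3) :
    d = (2 * n)%N -> injective phi -> (forall i, central (phi i)) ->
  exists a, lform a P = 1 /\
    forall z, z ^+ n = 1 -> forall v, F.@[(v + ((z - 1) * lform a v) *: P) 0] = F.@[v 0].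
Proof.
move=> d2n phi_inj hphi; pose al i := 1 + lform (phi i) P.
have al_inj : injective al.
  by move=> i j /addrI e; apply/phi_inj/(central_inj (hphi i) (hphi j) e).
have n1 : (1 < n)%N by move: d_ge3; rewrite d2n; case: (n) => [|[]].
have [i0 ai0] : exists i, al i != 1.
  pose i := Ordinal (ltnW n1); pose j := Ordinal n1.
  have [ei|] := eqVneq (al i) 1; last by exists i.
  exists j; apply/eqP => ej; have : i = j by apply: al_inj; rewrite ei ej.
  by move/(congr1 val).
have l0 : lform (phi i0) P != 0.
  by apply: contraNneq ai0 => e; rewrite /al e addr0.
pose a := (lform (phi i0) P)^-1 *: phi i0.
have aP : lform a P = 1 by rewrite /a lformZl mulVf.
have phiE i v : lform (phi i) v = (al i - 1) * lform a v.
  have e := congr1 (fun b => lform b v) (central_comm (hphi i0) (hphi i)).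
  rewrite /= !lformZl in e.
  rewrite /a lformZl mulrCA [al i]/(1 + _) [1 + _ - 1]addrAC subrr add0r -e.
  by rewrite mulKf.
have hal i v : F.@[(v + ((al i - 1) * lform a v) *: P) 0] = al i ^+ d * F.@[v 0].
  by rewrite -phiE; have [_ ->] := hphi i.
have scal i w : lform a w = 0 -> forall s,
    (restr F w P).[al i * s] = al i ^+ d * (restr F w P).[s].
  move=> aw s; rewrite !horner_restr -hal lformD lformZ aw aP; congr (F.@[fun_of_matrix _ 0]).
  by rewrite -addrA -scalerDl; congr (_ + _ *: _); ring.
have coefk i w k : lform a w = 0 -> (restr F w P)`_k * al i ^+ k = al i ^+ d * (restr F w P)`_k.
  by move=> aw; apply: (coef_scaling charK); apply: scal.
(* Otherwise the constant coefficient F(w) would vanish for every w on the axis, making the axis a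
   component of C. *)
have ald i : al i ^+ d = 1.
  apply/eqP/negPn/negP => ad.
  apply: (line_not_in_curve charK hF sF d_ge3 P0 FP (a := a)).
    by rewrite -/(lform a P) aP oner_eq0.
  move=> w aw; have := coefk i w 0%N aw; rewrite coef0_restr expr0 mulr1 => /eqP.
  rewrite -{1}[F.@[_]]mul1r -subr_eq0 -mulrBl mulf_eq0 subr_eq0 eq_sym (negPf ad) /=.
  by move/eqP.
exists a; split=> // z zn v.
have : lform a (v - lform a v *: P) = 0 by rewrite lformB lformZ aP mulr1 subrr.
set w := v - _ => aw.
have rz s : (restr F w P).[z * s] = 1 * (restr F w P).[s].
  apply: scaling_of_coef => k; rewrite mul1r.
  have [->|rk] := eqVneq (restr F w P)`_k 0; first by rewrite mul0r.
  have alk i : al i ^+ k = 1.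
    by apply: (mulfI rk); rewrite coefk // ald mul1r mulr1.
  have g0 : (0 < gcdn k d)%N by rewrite gcdn_gt0 (ltnW (ltnW d_ge3)) orbT.
  have ng : (n <= gcdn k d)%N.
    by apply: (unity_roots_card al_inj g0) => i; apply: unity_gcd.
  have /dvdnP [m em] := dvdn_gcdr k d.
  (* The g = gcd(k, d) is at least n because n distinct roots of unity have order dividing it. As g
     divides 2n, it is n or 2n, so n divides g and therefore k. *)
  have nk : (n %| k)%N.
    apply: dvdn_trans (dvdn_gcdl k d); move: ng g0 em; set g := gcdn k d => ng g0 em.
    have m2 : (m <= 2)%N.
      by rewrite leqNgt; apply/negP => m3; move: em; rewrite d2n; nia.
    by case: m em m2 => [|[|[|]]] // em _; apply/dvdnP; [exfalso; lia|exists 2; lia|exists 1%N; lia].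
  by have /dvdnP [q ->] := nk; rewrite mulnC exprM zn expr1n mulr1.
have := rz (lform a v); rewrite mul1r !horner_restr.
rewrite /w subrK => <-; congr (F.@[fun_of_matrix _ 0]).
rewrite -addrA -scaleNr -scalerDl; congr (_ + _ *: _); ring.
Qed.

(** Each element of G[P] is determined, as a rational map, by its linear form, so inequivalent
    elements give distinct forms and [axis_of_central] applies. *)
Lemma axis_of_G n : d = (2 * n)%N -> order_G_ge F P n ->
  exists a, lform a P = 1 /\
    forall z, z ^+ n = 1 -> forall v, F.@[(v + ((z - 1) * lform a v) *: P) 0] = F.@[v 0].
Proof.
move=> d2n [x [Gx xneq]].
have [phi hphi] := fin_all_exists (fun i => linear_of_G charK hF sF d_ge3 P0 FP (Gx i)).
apply: (axis_of_central (phi := phi) d2n) => [i j eij|i]; last by have [] := hphi i.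
apply: xneq; split; [by case: (Gx i) => [[[]]]|by case: (Gx j) => [[[]]]|].
move=> k l v cv; rewrite mevalB !mevalM; apply/eqP; rewrite subr_eq0; apply/eqP.
have [a0 aF coli] := hphi i; have [_ _ colj] := hphi j; rewrite -eij in colj.
set t := v + (v *m phi i) 0 0 *: P in coli colj.
have [v0 Fv] := cv.
have t0 : t != 0.
  apply: contraNneq v0 => t0; have et : v = - (v *m phi i) 0 0 *: P.
    by apply/eqP; rewrite scaleNr -addr_eq0 -/t t0.
  have := Fv; rewrite et (homogZ _ _ hF) => /eqP.
  rewrite mulf_eq0 (negPf FP) orbF expf_eq0 oppr_eq0 => /andP [_ /eqP c0].
  by apply/eqP; move: et; rewrite c0 oppr0 scale0r.
have /rV0Pn [m tm] := t0.
have ci := coli v cv; have cj := colj v cv.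
apply: (mulIf (mulf_neq0 tm tm)).
transitivity ((tnth (x i) k).@[v 0] * t 0 m * ((tnth (x j) l).@[v 0] * t 0 m)); first by ring.
rewrite (ci k m) (cj l m).
transitivity ((tnth (x i) m).@[v 0] * t 0 l * ((tnth (x j) m).@[v 0] * t 0 k)); first by ring.
by rewrite -(ci l m) -(cj k m); ring.
Qed.

End Axis.

(** * Pairs of points *)

Lemma prim_root_exists (K : closedFieldType) n : [pchar K] =i pred0 -> (0 < n)%N ->
  exists z : K, n.-primitive_root z.
Proof.
move=> charK n0; have [rs ers] := closed_field_poly_normal ('X^n - 1%:P : {poly K}).
have m1 : 'X^n - 1%:P \is @monic K by rewrite monicXnsubC.
rewrite (monicP m1) scale1r in ers.
have nn0 : n%:R != 0 :> K by have /pcharf0P -> := charK; rewrite -lt0n.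
have urs : uniq rs by rewrite -separable_prod_XsubC -ers; apply: separable_Xn_sub_1.
have srs : size rs = n.
  by have := congr1 (fun p : {poly K} => size p) ers; rewrite /= size_prod_XsubC size_XnsubC // => -[].
have ars : all n.-unity_root rs.
  apply/allP => z zrs; apply/unity_rootP.
  have : root ('X^n - 1%:P) z by rewrite ers root_prod_XsubC.
  by rewrite /root !hornerE subr_eq0 => /eqP.
have := has_prim_root n0 ars urs; rewrite srs leqnn => /(_ isT) /hasP [z _ zP].
by exists z.
Qed.

(* Each application of x d/dx - e kills one term and one root at p. *)
Lemma fewnomial (K : fieldType) (p : K) (s : seq nat) (f : {poly K}) :
    [pchar K] =i pred0 -> p != 0 -> (forall k, k \notin s -> f`_k = 0) ->
  ('X - p%:P) ^+ size s %| f -> f = 0.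
Proof.
move=> charK p0; elim: s f => [|e s IH] f fs dv.
  by apply/polyP => k; rewrite coef0 fs.
have h0 : 'X * f^`() - e%:R *: f = 0.
  apply: IH => [k ks|].
    rewrite coefB coefZ coefXM coef_deriv.
    have -> : (if k == 0%N then 0 else f`_k.-1.+1 *+ k.-1.+1) = k%:R * f`_k.
      by case: k {ks} => [|k] /=; rewrite ?mul0r // mulr_natl.
    have [->|ke] := eqVneq k e; first by rewrite subrr.
    by rewrite fs ?mulr0 ?subrr // inE negb_or ke.
  move: dv => /= /dvdpP [g ->].
  rewrite derivM deriv_exp derivXsubC mul1r /= exprS -mulr_natl.
  apply/dvdpP; exists ('X * (g^`() * ('X - p%:P) + g * (size s).+1%:R) - e%:R *: (g * ('X - p%:P))).
  by rewrite -!mul_polyC; ring.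
have fe k : k != e -> f`_k = 0.
  move=> ke; have : ('X * f^`() - e%:R *: f)`_k = 0 by rewrite h0 coef0.
  rewrite coefB coefZ coefXM coef_deriv.
  have -> : (if k == 0%N then 0 else f`_k.-1.+1 *+ k.-1.+1) = k%:R * f`_k.
    by case: k {ke} => [|k] /=; rewrite ?mul0r // mulr_natl.
  move/eqP; rewrite -mulrBl mulf_eq0 subr_eq0 => /orP [/eqP /(natr_inj charK) ke'|/eqP //].
  by rewrite ke' eqxx in ke.
have ef : f = f`_e *: 'X^e.
  apply/polyP => k; rewrite coefZ coefXn; case: eqP => [->|/eqP /fe ->].
    by rewrite mulr1.
  by rewrite mulr0.
have : root f p by rewrite -dvdp_XsubCl; apply: dvdp_trans dv; rewrite /= exprS dvdp_mulr.
rewrite /root {1}ef hornerZ hornerXn mulf_eq0 expf_eq0 (negPf p0) andbF orbF => /eqP fe0.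
by rewrite ef fe0 scale0r.
Qed.

Lemma coef1_exp_affine (K : fieldType) (c : K) m :
  ((1 + c *: 'X) ^+ m)`_1 = c * m%:R.
Proof.
have -> : ((1 + c *: 'X) ^+ m)`_1 = ((1 + c *: 'X) ^+ m)^`()`_0.
  by rewrite coef_deriv mulr1n.
rewrite deriv_exp -horner_coef0 !derivE add0r hornerMn hornerM horner_exp !hornerE.
by rewrite expr1n mulr1 mulr_natr.
Qed.

Section Pair.

Variables (K : closedFieldType) (charK : [pchar K] =i pred0).
Variables (F : {mpoly K[3]}) (n : nat).
Hypotheses (hF : F \is (2 * n).-homog) (sF : smooth_form F) (n_ge5 : (4 < n)%N).
Implicit Types (P Q v w : 'rV[K]_3) (a : 'cV[K]_3).

(* z ranges over the ratios of the homologies with centre P and axis a = 0. *)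
Definition is_axis P a : Prop :=
  lform a P = 1 /\
  forall z, z ^+ n = 1 -> forall v, F.@[(v + ((z - 1) * lform a v) *: P) 0] = F.@[v 0].

(** For w on the axis the homology of ratio z replaces s by z s in F(w + s P); with z primitive, s^k
    survives only if z^k = 1. *)
Lemma axis_coef P a w k : is_axis P a -> lform a w = 0 -> ~~ (n %| k)%N ->
  (restr F w P)`_k = 0.
Proof.
case=> aP inv aw nk; have [z zp] := prim_root_exists charK (ltnW (ltnW (ltnW (ltnW n_ge5)))).
have sc s : (restr F w P).[z * s] = 1 * (restr F w P).[s].
  rewrite mul1r !horner_restr -(inv z (prim_expr_order zp) (w + s *: P)).
  rewrite lformD lformZ aw aP add0r mulr1 -addrA -scalerDl.
  by congr (F.@[fun_of_matrix _ 0]); congr (_ + _ *: _); ring.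
have := coef_scaling charK sc k; move/eqP.
rewrite mul1r -{2}[_`_k]mulr1 -subr_eq0 -mulrBr mulf_eq0 subr_eq0 => /orP [/eqP //|].
by rewrite -(prim_order_dvd zp) (negPf nk).
Qed.

Lemma axis_restr P a w : is_axis P a -> lform a w = 0 ->
  restr F w P = (restr F w P)`_(2 * n) *: 'X^(2 * n) + (restr F w P)`_n *: 'X^n
     + (restr F w P)`_0 *: 'X^0.
Proof.
move=> aP aw; apply/polyP => k; rewrite !coefD !coefZ !coefXn.
have [nk|nk] := boolP (n %| k)%N; last first.
  rewrite (axis_coef aP aw nk) (_ : (k == 2 * n)%N = false); last first.
    by apply: contraNF nk => /eqP ->; rewrite dvdn_mull.
  rewrite (_ : (k == n)%N = false); last by apply: contraNF nk => /eqP ->.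
  rewrite (_ : (k == 0)%N = false); last by apply: contraNF nk => /eqP ->.
  by rewrite !mulr0 !addr0.
have [m ->] := dvdnP nk; case: m => [|[|[|m]]].
- rewrite mul0n (_ : (0 == 2 * n)%N = false) 1?(_ : (0 == n)%N = false); try by apply/negP => /eqP; lia.
  by rewrite !mulr0 mulr1 !add0r.
- rewrite mul1n (_ : (n == 2 * n)%N = false) ?eqxx 1?(_ : (n == 0)%N = false); try by apply/negP => /eqP; lia.
  by rewrite !mulr0 mulr1 add0r addr0.
- rewrite eqxx (_ : (2 * n == n)%N = false) 1?(_ : (2 * n == 0)%N = false); try by apply/negP => /eqP; lia.
  by rewrite !mulr0 mulr1 !addr0.
rewrite (_ : (m.+3 * n == 2 * n)%N = false) 1?(_ : (m.+3 * n == n)%N = false)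
  1?(_ : (m.+3 * n == 0)%N = false); try by apply/negP => /eqP; nia.
rewrite nth_default ?mulr0 ?addr0 //.
apply: leq_trans (size_restr _ _ hF) _; nia.
Qed.

Lemma restr_coef2_quadratic Q v P : exists2 T : {poly K}, (size T <= 3)%N &
  forall t, T.[t] = (restr F Q (v + t *: P))`_2.
Proof.
pose h i : {poly {poly K}} := (Q 0 i)%:P%:P + 'X * ((v 0 i)%:P + P 0 i *: 'X)%:P.
exists (mmap cst2 h F)`_2.
  suff sz : forall k, (size ((mmap cst2 h F)`_k)%R <= k.+1)%N by apply: sz.
  elim/mpoly_ring_ind: F => [c|i|p q Hp Hq|p q Hp Hq] k.
  - by rewrite mmapC coefC; case: k => [|k]; rewrite ?size_poly0 // size_polyC_leq1.
  - rewrite mmapX mmap1U /h coefD coefC coefXM coefC; case: k => [|[|k]] /=.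
    + by rewrite addr0 size_polyC_leq1.
    + rewrite add0r; apply: leq_trans (size_polyD _ _) _; rewrite geq_max.
      rewrite (leq_trans (size_polyC_leq1 _)) //=.
      by apply: leq_trans (size_scale_leq _ _) _; rewrite size_polyX.
    + by rewrite add0r size_poly0.
  - by rewrite mmapD coefD; apply: leq_trans (size_polyD _ _) _; rewrite geq_max Hp Hq.
  - rewrite rmorphM /= coefM; apply: (big_ind (fun r : {poly K} => (size r <= k.+1)%N)).
    + by rewrite size_poly0.
    + by move=> r s sr ss; apply: leq_trans (size_polyD _ _) _; rewrite geq_max sr ss.
    + move=> [i hi] _ /=; have -> : k.+1 = (i + (k - i)).+1 by rewrite subnKC.
      by apply: sizeM_top.
move=> t; have <- : map_poly (horner_eval t) (mmap cst2 h F) = restr F Q (v + t *: P).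
  apply: mmap_comp => [c|i] /=; first by rewrite map_polyC /= /horner_eval hornerC.
  rewrite /h rmorphD rmorphM /= map_polyX !map_polyC /= /horner_eval !hornerE !mxE.
  by rewrite mulrC mul_polyC [t * _]mulrC.
by rewrite coef_map.
Qed.

(* The r^2-coefficient of F(Q + r v) is quadratic in v and takes the same value at *)
(* v + (z - 1) a(v) P for all z^n = 1.                                             *)
Lemma restr_coef2_invariant P a Q v t : is_axis P a -> lform a Q = 0 -> lform a v != 0 ->
  (restr F Q (v + t *: P))`_2 = (restr F Q v)`_2.
Proof.
case=> aP inv aQ av; have [T sT eT] := restr_coef2_quadratic Q v P.
have [z zp] := prim_root_exists charK (ltnW (ltnW (ltnW (ltnW n_ge5)))).
suff Tc : T = ((restr F Q v)`_2)%:P by rewrite -eT Tc hornerC.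
apply/eqP; rewrite -subr_eq0; apply/negPn/negP => T0.
have := max_poly_roots T0 (rs := [seq (z ^+ i - 1) * lform a v | i <- iota 0 3]).
rewrite size_map size_iota => H; have {H} : (3 < size (T - ((restr F Q v)`_2)%:P)%R)%N.
  apply: H.
    apply/allP => _ /mapP [i _ ->]; rewrite /root hornerD hornerN hornerC eT subr_eq0.
    suff -> : restr F Q (v + ((z ^+ i - 1) * lform a v) *: P) = restr F Q v by [].
    apply: (poly_ext charK) => s; rewrite !horner_restr.
    have zi : (z ^+ i) ^+ n = 1 by rewrite exprAC (prim_expr_order zp) expr1n.
    rewrite -(inv _ zi (Q + s *: v)) lformD aQ add0r lformZ scalerDr scalerA addrA.
    by congr (F.@[fun_of_matrix _ 0]); congr (_ + _ *: _); ring.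
  rewrite map_inj_in_uniq ?iota_uniq // => i j; rewrite !mem_iota !add0n => /= i3 j3.
  have n3 : (3 <= n)%N by lia.
  move=> /(mulIf av) /addIr /eqP; rewrite (eq_prim_root_expr zp).
  by rewrite (modn_small (leq_trans i3 n3)) (modn_small (leq_trans j3 n3)) => /eqP.
apply/negP; rewrite -leqNgt; apply: leq_trans (size_polyD _ _) _.
by rewrite geq_max sT size_polyN (leq_trans (size_polyC_leq1 _)).
Qed.

Lemma restr_coef1D Q v w : (restr F Q (v + w))`_1 = (restr F Q v)`_1 + (restr F Q w)`_1.
Proof.
by rewrite !coef1_restr -big_split /=; apply: eq_bigr => i _; rewrite mxE mulrDl.
Qed.

Lemma restr_coef1Z Q c v : (restr F Q (c *: v))`_1 = c * (restr F Q v)`_1.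
Proof.
by rewrite !coef1_restr mulr_sumr; apply: eq_bigr => i _; rewrite mxE mulrA.
Qed.

(** Write Q + s (v + c Q) as (1 + c s) Q + s v and expand F as a binary form: the linear term of F(Q
    + s v) comes with (1 + c s)^(2n-1), which feeds the coefficient of s^2. *)
Lemma restr_coef2_shift Q v c : F.@[Q 0] = 0 ->
  (restr F Q (v + c *: Q))`_2 =
    (restr F Q v)`_2 + c * (2 * n).-1%:R * (restr F Q v)`_1.
Proof.
move=> FQ; set g := restr F Q v.
have -> : restr F Q (v + c *: Q) =
    \sum_(k < (2 * n).+1) g`_k *: ((1 + c *: 'X) ^+ (2 * n - k) * 'X^k).
  apply: (poly_ext charK) => s; rewrite horner_restr horner_sum.
  have -> : Q + s *: (v + c *: Q) = (1 + c * s) *: Q + s *: v.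
    by rewrite scalerDr scalerA scalerDl scale1r [s * c]mulrC -addrA [s *: v + _]addrC.
  rewrite (restr_homog _ _ _ _ hF); apply: eq_bigr => k _.
  by rewrite hornerZ hornerM horner_exp hornerXn hornerD hornerZ hornerX hornerC mulrA.
rewrite coef_sum; have [m em] : exists m, (2 * n = m.+2)%N by exists (2 * n - 2)%N; lia.
rewrite em !big_ord_recl big1 => [|[k hk] _]; last first.
  by rewrite coefZ coefMXn /= mulr0.
rewrite !coefZ !coefMXn /= /bump /=.
have g0 : g`_0 = 0 by rewrite coef0_restr.
rewrite g0 mul0r add0r addr0 -[(2 - 1)%N]/1%N -[(2 - 2)%N]/0%N.
have -> : (m.+2 - 1)%N = m.+1 by lia.
rewrite coef1_exp_affine -horner_coef0 horner_exp hornerD hornerZ hornerX hornerC.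
by rewrite mulr0 addr0 expr1n mulr1 addrC; congr (_ + _); ring.
Qed.

End Pair.

Section Pair.

Variables (K : closedFieldType) (charK : [pchar K] =i pred0).
Variables (F : {mpoly K[3]}) (n : nat).
Hypotheses (hF : F \is (2 * n).-homog) (sF : smooth_form F) (n_ge5 : (4 < n)%N).
Implicit Types (P Q v w : 'rV[K]_3) (a : 'cV[K]_3).

Local Notation is_axis := (is_axis F n).

(* A binary form with n-fold symmetries about two different pairs of points is  *)
(* a power: with U = 1 + q(X - p), the first order operator U d/dX - 2nq maps g *)
(* to a polynomial with four terms that vanishes to order n - 1 at p != 0.      *)
Lemma two_symmetric_forms (p q c2 c1 c0 d2 d1 d0 : K) :
    p != 0 -> c2 != 0 ->
    (forall x, c2 * x ^+ (2 * n) + c1 * x ^+ n + c0 =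
      let u := 1 + q * (x - p) in
      d2 * u ^+ (2 * n) + d1 * u ^+ n * (x - p) ^+ n + d0 * (x - p) ^+ (2 * n)) ->
  [/\ q * p = 1, c1 = 0 & c0 = 0].
Proof.
move=> p0 c20 /= id.
pose S : {poly K} := 'X - p%:P; pose U : {poly K} := 1 + q *: S.
pose g : {poly K} := c2 *: 'X^(2 * n) + c1 *: 'X^n + c0%:P.
pose H : {poly K} := d1 *: U ^+ n + d0 *: S ^+ n.
have eg : g = d2 *: U ^+ (2 * n) + S ^+ n * H.
  apply: (poly_ext charK) => x; rewrite /g /H /U /S !hornerE id.
  by rewrite -addrA; congr (_ + _); rewrite [(2 * n)%N]mulnC muln2 -addnn exprD; ring.
pose f := U * g^`() - ((2 * n)%:R * q)%:P * g.
have dU : U^`() = q%:P by rewrite /U /S !derivE add0r alg_polyC.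
have dvf : S ^+ n.-1 %| f.
  have eS : S ^+ n = S ^+ n.-1 * S by rewrite -exprSr prednK //; lia.
  have eU : U * (U ^+ (2 * n))^`() = ((2 * n)%:R * q)%:P * U ^+ (2 * n).
    have e2n : U ^+ (2 * n) = U * U ^+ (2 * n).-1 by rewrite -exprS prednK //; lia.
    by rewrite deriv_exp dU e2n -mulr_natl rmorphM rmorph_nat; ring.
  have dS : (S ^+ n)^`() = n%:R * S ^+ n.-1.
    by rewrite deriv_exp /S derivXsubC mul1r mulr_natl.
  apply/dvdpP; exists (U * (n%:R * H + S * H^`()) - ((2 * n)%:R * q)%:P * S * H).
  rewrite /f eg derivD derivM derivZ dS -!mul_polyC.
  rewrite [X in _ = X](_ : _ = d2%:P * (U * (U ^+ (2 * n))^`()) -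
    d2%:P * (((2 * n)%:R * q)%:P * U ^+ (2 * n)) +
    (U * (n%:R * S ^+ n.-1 * H + S ^+ n.-1 * S * H^`()) -
     ((2 * n)%:R * q)%:P * (S ^+ n.-1 * S) * H)); last by rewrite eU; ring.
  by rewrite -eS; ring.
pose q1 := 1 - q * p.
have ef : f = ((2 * n)%:R * c2 * q1) *: 'X^((2 * n).-1) - (n%:R * q * c1) *: 'X^n
    + (n%:R * c1 * q1) *: 'X^(n.-1) - ((2 * n)%:R * q * c0) *: 'X^0.
  have U1 : U = q1%:P + q%:P * 'X.
    by rewrite /U /S /q1 -mul_polyC polyCB polyCM polyC1; ring.
  have e2n : 'X^(2 * n) = 'X * 'X^((2 * n).-1) :> {poly K} by rewrite -exprS prednK //; lia.
  have en : 'X^n = 'X * 'X^(n.-1) :> {poly K} by rewrite -exprS prednK //; lia.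
  have dg : g^`() = c2%:P * ((2 * n)%:R%:P * 'X^((2 * n).-1)) + c1%:P * (n%:R%:P * 'X^(n.-1)).
    rewrite /g derivD derivC addr0 derivD !derivZ !derivXn -!mul_polyC.
    by rewrite -[_ *+ (2 * n)]mulr_natl -[_ *+ n]mulr_natl !polyC_natr.
  have eg' : g = c2%:P * ('X * 'X^((2 * n).-1)) + c1%:P * ('X * 'X^(n.-1)) + c0%:P.
    by rewrite /g e2n en -!mul_polyC.
  rewrite /f dg eg' U1 en expr0 -!mul_polyC !polyCM.
  have -> : (2 * n)%:R%:P = 2%:R * n%:R%:P :> {poly K} by rewrite !polyC_natr natrM.
  move: 'X^((2 * n).-1) 'X^(n.-1) q1%:P q%:P c2%:P c1%:P c0%:P n%:R%:P {en e2n dg eg' U1}.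
  by move=> *; ring.
(* Here n > 4 enters: f has four terms and vanishes to order n - 1 >= 4 at [p]. *)
have f0 : f = 0.
  apply: (@fewnomial _ p [:: (2 * n).-1; n; n.-1; 0%N] _ charK p0) => [k|].
    rewrite !inE !negb_or => /and4P [k1 k2 k3 k4].
    rewrite ef !coefD !coefN !coefZ !coefXn.
    by rewrite (negPf k1) (negPf k2) (negPf k3) (negPf k4) !mulr0 !subr0 !addr0.
  apply: dvdp_trans dvf; apply: dvdp_exp2l => /=; lia.
have nn m : (0 < m)%N -> m%:R != 0 :> K.
  by move=> m0; have /pcharf0P -> := charK; rewrite -lt0n.
have cf k : (f`_k = 0) by rewrite f0 coef0.
have [e1 e2 e3] : [/\ ((2 * n).-1 == n)%N = false, ((2 * n).-1 == n.-1)%N = false & ((2 * n).-1 == 0)%N = false].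
  by split; apply/negP => /eqP; lia.
have := cf (2 * n).-1; rewrite ef !coefD !coefN !coefZ !coefXn eqxx e1 e2 e3.
rewrite !mulr0 mulr1 !subr0 addr0 => /eqP; rewrite !mulf_eq0 (negPf c20).
rewrite (negPf (nn (2 * n)%N _)) /=; last by lia.
rewrite /q1 subr_eq0 => /eqP qp.
have q0 : q != 0 by apply/eqP => q0; move: qp; rewrite q0 mul0r => /eqP; rewrite oner_eq0.
split; first by rewrite -qp.
  have {e1 e2 e3}[e1 e2 e3] : [/\ (n == (2 * n).-1)%N = false, (n == n.-1)%N = false & (n == 0)%N = false].
    by split; apply/negP => /eqP; lia.
  have := cf n; rewrite ef !coefD !coefN !coefZ !coefXn eqxx e1 e2 e3.
  rewrite !mulr0 mulr1 subr0 addr0 sub0r => /eqP; rewrite oppr_eq0 !mulf_eq0 (negPf q0).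
  by rewrite (negPf (nn n _)) /=; [move/eqP|lia].
have {e1 e2 e3}[e1 e2 e3] : [/\ (0 == (2 * n).-1)%N = false, (0 == n)%N = false & (0 == n.-1)%N = false].
  by split; apply/negP => /eqP; lia.
have := cf 0%N; rewrite ef !coefD !coefN !coefZ !coefXn eqxx e1 e2 e3.
rewrite !mulr0 mulr1 subr0 addr0 sub0r => /eqP; rewrite oppr_eq0 !mulf_eq0 (negPf q0).
by rewrite (negPf (nn (2 * n)%N _)) /=; [move/eqP|lia].
Qed.

Lemma avoid_two (x y al : K) : al != 0 -> exists c, x + c != 0 /\ y + c * al != 0.
Proof.
move=> al0; have /closed_nonrootP [c] : ('X + x%:P) * ('X * al%:P + y%:P) != 0.
  rewrite mulf_neq0 // -size_poly_eq0.
    by rewrite size_polyDl ?size_polyX // (leq_ltn_trans (size_polyC_leq1 _)).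
  rewrite size_polyDl mulrC ?size_Cmul ?size_polyX //.
  by rewrite (leq_ltn_trans (size_polyC_leq1 _)).
rewrite rootM negb_or /root !hornerE => /andP [h1 h2].
by exists c; split; rewrite addrC.
Qed.

(* Otherwise the line through P and P' meets the curve in one point Q lying on both *)
(* axes; the second polar of Q is then degenerate along the line, contradicting     *)
(* smoothness at Q.                                                                 *)
Lemma pair_on_axis P a P' a' : F.@[P 0] != 0 -> is_axis P a -> is_axis P' a' ->
  (forall c, P' != c *: P) -> lform a P' = 0.
Proof.
have n21 : (0 < (2 * n).-1)%N by lia.
move=> FP hP hP' neqP; apply/eqP/negPn/negP => p0.
have [aP _] := hP; have [aP' _] := hP'.
set p := lform a P' in p0; pose al := lform a' P.
pose Q := P' - p *: P; pose Q' := P - al *: P'.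
have aQ : lform a Q = 0 by rewrite lformB lformZ aP mulr1 subrr.
have aQ' : lform a' Q' = 0 by rewrite lformB lformZ aP' mulr1 subrr.
have Q0 : Q != 0 by rewrite subr_eq0.
have eF x : F.@[(Q + x *: P) 0] = F.@[P 0] * x ^+ (2 * n) + (restr F Q P)`_n * x ^+ n + F.@[Q 0].
  rewrite -horner_restr {1}(axis_restr charK hF n_ge5 hP aQ) (coef_top_restr _ _ hF).
  by rewrite coef0_restr !hornerD !hornerZ !hornerXn expr0 mulr1.
have eF' s u : F.@[(s *: Q' + u *: P') 0] = F.@[P' 0] * u ^+ (2 * n) +
    (restr F Q' P')`_n * u ^+ n * s ^+ n + F.@[Q' 0] * s ^+ (2 * n).
  have [->|s0] := eqVneq s 0.
    rewrite scale0r add0r (homogZ _ _ hF) !expr0n gtn_eqF; last by lia.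
    by rewrite gtn_eqF ?mulr0 ?addr0 1?mulrC //; lia.
  have -> : s *: Q' + u *: P' = s *: (Q' + (u / s) *: P').
    by rewrite [RHS]scalerDr scalerA [s * _]mulrC divfK.
  rewrite (homogZ _ _ hF) -horner_restr {1}(axis_restr charK hF n_ge5 hP' aQ').
  rewrite (coef_top_restr _ _ hF) coef0_restr !hornerD !hornerZ !hornerXn expr0 mulr1.
  rewrite !expr_div_n [(2 * n)%N]mulnC !exprM !expr2.
  by field; rewrite expf_neq0.
(* Two coordinate systems on PP': Q + x P = P' + (x - p) P = (x - p) Q' + (1 + al (x - p)) P'. *)
have [|alp r1 FQ] := @two_symmetric_forms p al F.@[P 0] (restr F Q P)`_n F.@[Q 0] F.@[P' 0] (restr F Q' P')`_n F.@[Q' 0] p0 FP.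
  move=> x /=; rewrite -eF -eF'; congr (F.@[fun_of_matrix _ 0]).
  by apply/rowP => i; rewrite /Q /Q' !mxE; ring.
have alp0 : al != 0 by apply/eqP => al0; move: alp; rewrite al0 mul0r => /eqP; rewrite eq_sym oner_eq0.
have a'Q : lform a' Q = 0 by rewrite lformB lformZ aP' -/al mulrC alp subrr.
have [v0 v0P] := sF Q0 FQ.
have lP : (restr F Q P)`_1 = 0.
  rewrite (axis_restr charK hF n_ge5 hP aQ) r1 scale0r addr0 coef0_restr FQ scale0r addr0.
  rewrite coefZ coefXn (_ : (1 == 2 * n)%N = false) ?mulr0 //.
  by apply/negP => /eqP; lia.
(* Adding a multiple of P leaves the derivative at Q unchanged, since it vanishes along P, and moves
   v off both axes. *)
have [c [c1 c2]] := avoid_two (lform a v0) (lform a' v0) alp0.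
pose v := v0 + c *: P.
have lv : (restr F Q v)`_1 != 0 by rewrite restr_coef1D restr_coef1Z lP mulr0 addr0.
have av : lform a v != 0 by rewrite lformD lformZ aP mulr1.
have a'v : lform a' v != 0 by rewrite lformD lformZ.
(* Moving by -rho p P and then by rho P' adds rho Q in all, and both moves preserve the second polar
   of Q. The factor 2 makes a' equal to -a'(v), still nonzero, between the two moves, because al p =
   1. *)
pose rho := 2%:R * lform a' v.
have nn m : (0 < m)%N -> m%:R != 0 :> K.
  by move=> m0; have /pcharf0P -> := charK; rewrite -lt0n.
have rho0 : rho != 0 by rewrite mulf_neq0 // nn.
have inv1 := restr_coef2_invariant charK hF n_ge5 (- (rho * p)) hP aQ av.
have a'v' : lform a' (v + - (rho * p) *: P) != 0.
  rewrite lformD lformZ -/al mulNr -mulrA [p * al]mulrC alp mulr1 /rho.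
  by rewrite (_ : _ - _ = - lform a' v) ?oppr_eq0 //; ring.
have := restr_coef2_invariant charK hF n_ge5 rho hP' a'Q a'v'.
have -> : v + - (rho * p) *: P + rho *: P' = v + rho *: Q.
  by apply/rowP => i; rewrite /Q !mxE; ring.
rewrite inv1 (restr_coef2_shift charK hF n_ge5 _ _ FQ) -[RHS]addr0 => /addrI /eqP.
apply/negP; apply: mulf_neq0 lv; apply: mulf_neq0 rho0 _.
exact: (nn _ n21).
Qed.

End Pair.

(** * The normal form *)

Lemma mpoly_supp_sum (n : nat) (R : nzRingType) (p : {mpoly R[n]}) (s : seq 'X_{1..n}) :
  uniq s -> {subset msupp p <= s} -> p = \sum_(m <- s) p@_m *: 'X_[m].
Proof.
move=> us sub; apply/mpolyP => m; rewrite raddf_sum /=.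
have [ms|nms] := boolP (m \in s); last first.
  rewrite big_seq big1 => [|k ks]; first by rewrite memN_msupp_eq0 //; apply: contra nms; apply: sub.
  by rewrite mcoeffZ mcoeffX (_ : (k == m) = false) ?mulr0 //; apply: contraNF nms => /eqP <-.
rewrite (bigD1_seq m) //= big1 ?addr0 => [|k km].
  by rewrite mcoeffZ mcoeffX eqxx mulr1.
by rewrite mcoeffZ mcoeffX (negPf km) mulr0.
Qed.

Lemma mnm3P (m m' : 'X_{1..3}) :
  m 0 = m' 0 -> m 1 = m' 1 -> m 2%:R = m' 2%:R -> m = m'.
Proof. by move=> e0 e1 e2; apply/mnmP; apply: ord3P. Qed.

(* Kronecker substitution 'X_i := t^(B^i). *)
Lemma mpoly_eq0_fun (K : fieldType) (p : {mpoly K[3]}) : [pchar K] =i pred0 ->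
  (forall v : 'rV[K]_3, p.@[v 0] = 0) -> p = 0.
Proof.
move=> charK pv; apply/mpolyP => m; rewrite mcoeff0.
have [ms|] := boolP (m \in msupp p); last exact: memN_msupp_eq0.
pose B := msize p.
pose h (i : 'I_3) : {poly K} := 'X^(B ^ i).
have q0 : mmap (@polyC K) h p = 0.
  apply: (poly_ext charK) => t; rewrite horner0 -[RHS](pv (\row_i t ^+ (B ^ i))).
  apply: (mmap_comp (g := horner_eval t) (f' := idfun)) => [c|i].
    by rewrite /= /horner_eval hornerC.
  by rewrite /= /horner_eval hornerXn mxE.
pose w (k : 'X_{1..3}) := (k 0%R + k 1%R * B + k 2%:R%R * (B * B))%N.
have hw k : mmap1 h k = 'X^(w k).
  rewrite /mmap1 !big_ord_recl big_ord0 mulr1 /h -!exprM -!exprD; congr ('X^_).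
  have -> : lift 0 0 = 1 :> 'I_3 by apply/val_inj.
  have -> : lift 0 (lift 0 0) = 2%:R :> 'I_3 by apply/val_inj.
  by rewrite /w /= expn0 mul1n expn1 -mulnn addnA [(B * k 1%R)%N]mulnC [(_ * k 2%:R%R)%N]mulnC.
have lt_kB k i : k \in msupp p -> (k i < B)%N.
  move=> ks; apply: leq_ltn_trans (msize_mdeg_lt ks).
  by rewrite mdegE (bigD1 i) //= leq_addr.
have w_inj k : k \in msupp p -> w k = w m -> k = m.
  move=> ks; have [[k0 k1] k2] := (lt_kB k 0 ks, lt_kB k 1 ks, lt_kB k 2%:R ks).
  have [[m0 m1] m2] := (lt_kB m 0 ms, lt_kB m 1 ms, lt_kB m 2%:R ms).
  rewrite /w => e; have B0 : (0 < B)%N by apply: leq_trans k0.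
  have e' : ((k 0%R + (k 1%R + k 2%:R%R * B) * B) = (m 0%R + (m 1%R + m 2%:R%R * B) * B))%N.
    by rewrite !mulnDl -!mulnA !addnA.
  have d0 : k 0 = m 0.
    have := congr1 (modn^~ B) e'; rewrite /= ![(_ + _ * B)%N]addnC !modnMDl.
    by rewrite !modn_small.
  have d12 : ((k 1%R + k 2%:R%R * B) = (m 1%R + m 2%:R%R * B))%N.
    by apply/eqP; rewrite -(eqn_pmul2r B0); apply/eqP; move: e'; rewrite d0 => /addnI.
  have d1 : k 1 = m 1.
    have := congr1 (modn^~ B) d12; rewrite /= ![(_ + _ * B)%N]addnC !modnMDl.
    by rewrite !modn_small.
  have d2 : k 2%:R = m 2%:R.
    by apply/eqP; rewrite -(eqn_pmul2r B0); apply/eqP; move: d12; rewrite d1 => /addnI.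
  exact: mnm3P.
have := congr1 (fun q : {poly K} => q`_(w m)) q0; rewrite coef0 /mmap coef_sum.
rewrite (bigD1_seq m) //= big_seq_cond big1 ?addr0 => [|k /andP [ks km]].
  by rewrite hw coefCM coefXn eqxx mulr1.
rewrite hw coefCM coefXn (_ : (w m == w k) = false) ?mulr0 //.
by apply: contraNF km => /eqP e; apply/eqP; apply: w_inj.
Qed.

Section NormalForm.

Variables (K : closedFieldType) (charK : [pchar K] =i pred0).
Variables (n : nat) (n0 : (0 < n)%N).

Definition family_eval (a1 a2 a3 b1 b2 b3 : K) (x y z : K) : K :=
  a1 * x ^+ (2 * n) + a2 * y ^+ (2 * n) + a3 * z ^+ (2 * n) +
  b1 * (x ^+ n * y ^+ n) + b2 * (y ^+ n * z ^+ n) + b3 * (z ^+ n * x ^+ n).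

(** Invariance makes the exponents of x and y multiples of n, hence also that of z as the degree is
    2n; six monomials remain. *)
Lemma monomial_form (G : {mpoly K[3]}) : G \is (2 * n).-homog ->
    (forall z, z ^+ n = 1 -> forall x y t, G.@[row3 (z * x) y t 0] = G.@[row3 x y t 0]) ->
    (forall z, z ^+ n = 1 -> forall x y t, G.@[row3 x (z * y) t 0] = G.@[row3 x y t 0]) ->
  exists a1 a2 a3 b1 b2 b3, forall x y t,
    G.@[row3 x y t 0] = family_eval a1 a2 a3 b1 b2 b3 x y t.
Proof.
move=> hG inv0 inv1.
have [z zp] := prim_root_exists charK n0; have zn := prim_expr_order zp.
pose mk (t : nat * nat * nat) : 'X_{1..3} :=
  [multinom (n * vec3 t.1.1 t.1.2 t.2 i)%N | i < 3].
pose T : seq (nat * nat * nat) :=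
  [:: (2, 0, 0); (0, 2, 0); (0, 0, 2); (1, 1, 0); (0, 1, 1); (1, 0, 1)]%N.
have mk_inj : injective mk.
  move=> [[i j] k] [[i' j'] k'] /mnmP e.
  have := e 0; have := e 1; have := e 2%:R; rewrite !mnmE /vec3 /=.
  by move=> /eqP + /eqP + /eqP; rewrite !eqn_pmul2l // => /eqP -> /eqP -> /eqP ->.
have inv_coef (i : 'I_3) :
    (forall v : 'rV[K]_3, G.@[(\row_j (if j == i then z * v 0 j else v 0 j)) 0] = G.@[v 0]) ->
    forall m, m \in msupp G -> (n %| m i)%N.
  move=> inv m mG.
  pose l : 3.-tuple {mpoly K[3]} := [tuple (if j == i then z else 1) *: 'X_j | j < 3].
  have eG : G \mPo l = G.
    apply/eqP; rewrite -subr_eq0; apply/eqP/(mpoly_eq0_fun charK) => v.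
    rewrite mevalB -(inv v); apply/eqP; rewrite subr_eq0; apply/eqP.
    apply: meval_comp => j; rewrite tnth_mktuple mevalZ mevalXU mxE.
    by case: eqP; rewrite ?mul1r.
  have eX (k : 'X_{1..3}) : 'X_[k] \mPo l = z ^+ k i *: 'X_[k].
    rewrite comp_mpolyX [in RHS]mpolyXE_id (bigD1 i) //= [in RHS](bigD1 i) //=.
    rewrite tnth_mktuple eqxx exprZn -scalerAl; congr (_ *: (_ * _)).
    by apply: eq_bigr => j ji; rewrite tnth_mktuple (negPf ji) scale1r.
  have := congr1 (mcoeff m) eG.
  rewrite {1}[G]mpolyE rmorph_sum /= raddf_sum /= (bigD1_seq m) //= big1 ?addr0 => [|k km].
    rewrite comp_mpolyZ eX !mcoeffZ mcoeffX eqxx mulr1 => /eqP.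
    rewrite -{2}[G@_m]mulr1 -subr_eq0 -mulrBr mulf_eq0 mcoeff_eq0 mG /= subr_eq0.
    by rewrite -(prim_order_dvd zp).
  by rewrite comp_mpolyZ eX !mcoeffZ mcoeffX (negPf km) !mulr0.
have sub : {subset msupp G <= [seq mk t | t <- T]}.
  move=> m mG.
  have d0 : (n %| m 0%R)%N.
    apply: inv_coef mG => v.
    have -> : \row_j (if j == 0 then z * v 0 j else v 0 j) = row3 (z * v 0 0) (v 0 1) (v 0 2%:R).
      by apply/rowP; apply: ord3P; rewrite !mxE.
    by rewrite inv0 // -row3_eta.
  have d1 : (n %| m 1%R)%N.
    apply: inv_coef mG => v.
    have -> : \row_j (if j == 1 then z * v 0 j else v 0 j) = row3 (v 0 0) (z * v 0 1) (v 0 2%:R).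
      by apply/rowP; apply: ord3P; rewrite !mxE.
    by rewrite inv1 // -row3_eta.
  have dm : (m 0%R + m 1%R + m 2%:R%R = 2 * n)%N.
    move/dhomogP: hG => /(_ m mG) <-; rewrite /= mdegE !big_ord_recl big_ord0 addn0 addnA.
    by congr (_ + m _ + m _)%N; apply/val_inj.
  have [i ei] := dvdnP d0; have [j ej] := dvdnP d1.
  have ek : m 2%:R = ((2 - i - j) * n)%N by rewrite !mulnBl -dm -ei -ej; lia.
  have ij : (i + j <= 2)%N by rewrite -(leq_pmul2r n0) mulnDl -ei -ej -dm leq_addr.
  have -> : m = mk (i, j, (2 - i - j)%N).
    by apply: mnm3P; rewrite mnmE /vec3 /= ?ei ?ej ?ek mulnC.
  rewrite mem_map //.
  by case: i ij {ei ek} => [|[|[|i]]]; case: j {ej} => [|[|[|j]]].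
have uT : uniq [seq mk t | t <- T] by rewrite map_inj_uniq.
exists G@_(mk (2, 0, 0)%N), G@_(mk (0, 2, 0)%N), G@_(mk (0, 0, 2)%N),
  G@_(mk (1, 1, 0)%N), G@_(mk (0, 1, 1)%N), G@_(mk (1, 0, 1)%N) => x y t.
have ev i j k : ('X_[mk (i, j, k)]).@[row3 x y t 0] = x ^+ (n * i) * y ^+ (n * j) * t ^+ (n * k).
  rewrite mevalX !big_ord_recl big_ord0 mulr1 mulrA !mxE /vec3 /= !mnmE /vec3 /=.
  by [].
rewrite {1}(mpoly_supp_sum uT sub) !big_cons big_nil /= addr0.
rewrite !mevalD !mevalZ !ev /family_eval !muln0 !muln1 !expr0 !mulr1 !mul1r.
rewrite [(n * 2)%N]mulnC; ring.
Qed.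

Lemma family_form_meval a b c (v : 'rV[K]_3) :
  (family_form n a b c).@[v 0] = family_eval 1 1 1 a b c (v 0 0) (v 0 1) (v 0 2%:R).
Proof.
by rewrite /family_form /family_eval !mevalD !mevalZ !mevalM !rmorphXn /= !mevalXU !mul1r.
Qed.

End NormalForm.

Lemma lform_mx3 (K : fieldType) (a : 'cV[K]_3) x y z (u v w : 'rV[K]_3) :
  lform a (row3 x y z *m mx3 u v w) = x * lform a u + y * lform a v + z * lform a w.
Proof. by rewrite mul_mx3 !lformD !lformZ. Qed.

(** * From quasi-Galois points to the family *)

Section Forward.

Variables (K : closedFieldType) (charK : [pchar K] =i pred0).
Variables (F : {mpoly K[3]}) (n : nat).
Hypotheses (hF : F \is (2 * n).-homog) (sF : smooth_form F) (n_ge5 : (4 < n)%N).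
Implicit Types (P Q v w : 'rV[K]_3) (a : 'cV[K]_3).

Local Notation is_axis := (is_axis F n).

Lemma axis_of_point P : outer_quasi_Galois_ge F n P ->
  [/\ P != 0, F.@[P 0] != 0 & exists a, is_axis P a].
Proof.
case=> P0 nC _ oG; have FP : F.@[P 0] != 0 by apply/eqP => FP; apply: nC.
by split=> //; apply: (axis_of_G charK hF sF _ P0 FP erefl oG); lia.
Qed.

Lemma axes_of_points m (x : 'I_m -> 'rV[K]_3) :
    (forall i, outer_quasi_Galois_ge F n (x i)) ->
    (forall i j, same_point (x i) (x j) -> i = j) ->
  exists a : 'I_m -> 'cV[K]_3, (forall i, is_axis (x i) (a i)) /\
    (forall i j, i != j -> lform (a i) (x j) = 0).
Proof.
move=> hx xneq.
have [a ha] := fin_all_exists (fun i => let: And3 _ _ h := axis_of_point (hx i) in h).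
exists a; split=> // i j ij; have [xi0 Fi _] := axis_of_point (hx i).
have [xj0 Fj _] := axis_of_point (hx j).
apply: (pair_on_axis charK hF sF n_ge5 Fi (ha i) (ha j)) => c.
apply: contraNneq ij => ec; apply/eqP/xneq; exists c => //.
by apply: contraNneq xj0 => c0; rewrite ec c0 scale0r.
Qed.

Lemma dual_frame_unit (u v w : 'rV[K]_3) (a b c : 'cV[K]_3) :
    lform a u != 0 -> lform b v != 0 -> lform c w != 0 ->
    lform a v = 0 -> lform a w = 0 -> lform b u = 0 -> lform b w = 0 ->
  mx3 u v w \in unitmx.
Proof.
move=> au bv cw av aw bu bw; rewrite -row_free_unit; apply: inj_row_free => s.
rewrite [s]row3_eta => s0; have ls l := lform_mx3 l (s 0 0) (s 0 1) (s 0 2%:R) u v w.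
have l0 l : lform l (row3 (s 0 0) (s 0 1) (s 0 2%:R) *m mx3 u v w) = 0.
  by rewrite s0 /lform mul0mx mxE.
have := ls a; rewrite l0 av aw !mulr0 !addr0 => /esym/eqP; rewrite mulf_eq0 (negPf au) orbF.
move=> /eqP s00.
have := ls b; rewrite l0 bu bw !mulr0 addr0 add0r => /esym/eqP; rewrite mulf_eq0 (negPf bv) orbF.
move=> /eqP s01.
have := ls c; rewrite l0 s00 s01 !mul0r !add0r => /esym/eqP; rewrite mulf_eq0 (negPf cw) orbF.
by move=> /eqP s02; rewrite s02; apply/eqP; rewrite row3_eq0 eqxx.
Qed.

(** Three points form a basis with their axes as dual basis. A fourth point lies on all three axes,
    so its coordinates are all 0. *)
Lemma no_four_points : ~ delta'_ge F n 4.
Proof.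
move=> [x [hx xneq]]; have [a [ha aij]] := axes_of_points hx xneq.
pose i0 : 'I_4 := inord 0; pose i1 : 'I_4 := inord 1; pose i2 : 'I_4 := inord 2.
pose i3 : 'I_4 := inord 3.
have neq (i j : nat) : (i < 4)%N -> (j < 4)%N -> i != j -> (inord i : 'I_4) != inord j.
  by move=> i4 j4 ij; rewrite -val_eqE /= !inordK.
have a1 i : lform (a i) (x i) = 1 by case: (ha i).
have uM : mx3 (x i0) (x i1) (x i2) \in unitmx.
  by apply: (@dual_frame_unit _ _ _ (a i0) (a i1) (a i2));
     rewrite ?a1 ?oner_neq0 //; apply: aij; apply: neq.
have [x30 _ _] := axis_of_point (hx i3).
move/eqP: x30; apply; rewrite -(mulmxKV uM (x i3)).
set s := x i3 *m _; have es : x i3 = row3 (s 0 0) (s 0 1) (s 0 2%:R) *m mx3 (x i0) (x i1) (x i2).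
  by rewrite -row3_eta mulmxKV.
have l i := lform_mx3 (a i) (s 0 0) (s 0 1) (s 0 2%:R) (x i0) (x i1) (x i2).
have := l i0; rewrite -es a1 !aij ?neq // !mulr0 !addr0 mulr1 => s0.
have := l i1; rewrite -es a1 !aij ?neq // !mulr0 addr0 add0r mulr1 => s1.
have := l i2; rewrite -es a1 !aij ?neq // !mulr0 !add0r mulr1 => s2.
have -> : s = 0 by rewrite [s]row3_eta -s0 -s1 -s2; apply/eqP; rewrite row3_eq0 eqxx.
by rewrite mul0mx.
Qed.

Lemma kernel_two (a b : 'cV[K]_3) : exists w, [/\ w != 0, lform a w = 0 & lform b w = 0].
Proof.
pose B := row_mx a b; have kB : kermx B != 0.
  by rewrite -mxrank_eq0 mxrank_ker -lt0n subn_gt0 (leq_ltn_trans (rank_leq_col _)).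
have /sub_kermxP : (nz_row (kermx B) <= kermx B)%MS := nz_row_sub _.
rewrite mul_mx_row => /eqP; rewrite row_mx_eq0 => /andP [/eqP wa /eqP wb].
by exists (nz_row (kermx B)); rewrite nz_row_eq0 kB /lform wa wb mxE.
Qed.

Lemma family_of_two_points : delta'_ge F n 2 ->
  exists a b c : K, projectively_equivalent F (family_form n a b c).
Proof.
have [n0 n20] : (0 < n)%N /\ (0 < 2 * n)%N by lia.
have n1 : ~~ (n %| 1)%N by rewrite dvdn1; apply/eqP; lia.
move=> [x [hx xneq]]; have [ax [ha aij]] := axes_of_points hx xneq.
pose j0 : 'I_2 := 0; pose j1 : 'I_2 := 1.
have [P0 FP0 _] := axis_of_point (hx j0); have [P1 FP1 _] := axis_of_point (hx j1).
have h0 := ha j0; have h1 := ha j1; have [a00 _] := h0; have [a11 _] := h1.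
have a01 : lform (ax j0) (x j1) = 0 by apply: aij.
have a10 : lform (ax j1) (x j0) = 0 by apply: aij.
have [w [w0 aw bw]] := kernel_two (ax j0) (ax j1).
have [c cw] : exists c : 'cV[K]_3, lform c w != 0.
  have /rV0Pn [i wi] := w0; exists (delta_mx i 0).
  by rewrite /lform -colE mxE.
pose M := mx3 (x j0) (x j1) w.
have uM : M \in unitmx.
  by apply: (@dual_frame_unit _ _ _ (ax j0) (ax j1) c); rewrite ?a00 ?a11 ?oner_neq0.
have eM r s t : row3 r s t *m M = r *: x j0 + s *: x j1 + t *: w by rewrite mul_mx3.
(* If [w] were on C, the derivative there would vanish along both points, because n does not divide
   1, and along [w] by Euler's relation, so C would be singular at [w]. *)
have Fw : F.@[w 0] != 0.
  apply/eqP => Fw; have [u] := sF w0 Fw.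
  rewrite -(mulmxKV uM u); set s := u *m _; rewrite [s]row3_eta eM.
  rewrite !restr_coef1D !restr_coef1Z.
  rewrite (axis_coef charK n_ge5 h0 aw n1) (axis_coef charK n_ge5 h1 bw n1).
  have -> : restr F w w = 0.
    apply: (poly_ext charK) => r; rewrite horner_restr horner0.
    by rewrite -{1}[w]scale1r -scalerDl (homogZ _ _ hF) Fw mulr0.
  by rewrite coef0 !mulr0 !addr0 eqxx.
have hFM := subst_lin_homog M hF.
have [a1 [a2 [a3 [b1 [b2 [b3 FE]]]]]] : exists a1 a2 a3 b1 b2 b3 : K, forall r s t,
    (subst_lin F M).@[row3 r s t 0] = family_eval n a1 a2 a3 b1 b2 b3 r s t.
  apply: (monomial_form charK n0 hFM) => z zn r s t; rewrite !meval_subst_lin !eM.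
    have [_ inv] := h0; rewrite -(inv z zn (r *: x j0 + s *: x j1 + t *: w)).
    rewrite !lformD !lformZ a00 a01 aw; congr (F.@[fun_of_matrix _ 0]).
    by apply/rowP => i; rewrite !mxE; ring.
  have [_ inv] := h1; rewrite -(inv z zn (r *: x j0 + s *: x j1 + t *: w)).
  rewrite !lformD !lformZ a11 a10 bw; congr (F.@[fun_of_matrix _ 0]).
  by apply/rowP => i; rewrite !mxE; ring.
have fe r s t : family_eval n a1 a2 a3 b1 b2 b3 r s t = F.@[(r *: x j0 + s *: x j1 + t *: w) 0].
  by rewrite -FE meval_subst_lin eM.
have z2n : (0 : K) ^+ (2 * n) = 0 by rewrite expr0n gtn_eqF.
have zn : (0 : K) ^+ n = 0 by rewrite expr0n gtn_eqF.
have a1n : a1 != 0.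
  have := fe 1 0 0; rewrite /family_eval z2n zn !expr1n !mulr0 !mul0r !mulr0 !mulr1 !addr0.
  by rewrite scale1r !scale0r !addr0 => ->.
have a2n : a2 != 0.
  have := fe 0 1 0; rewrite /family_eval z2n zn !expr1n !mulr0 !mul0r !mulr0 !mulr1 !addr0 !add0r.
  by rewrite scale1r !scale0r !addr0 add0r => ->.
have a3n : a3 != 0.
  have := fe 0 0 1; rewrite /family_eval z2n zn !expr1n !mulr0 !mul0r !mulr0 !mulr1 !addr0 !add0r.
  by rewrite scale1r !scale0r !add0r => ->.
have rootn (e : K) : e != 0 -> exists2 r, r != 0 & r ^+ (2 * n) = e.
  move=> e0; have /closed_rootP [r] : size ('X^(2 * n) - e%:P) != 1%N.
    by rewrite size_XnsubC // eqSS -lt0n.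
  rewrite /root !hornerE subr_eq0 => /eqP er; exists r => //.
  by apply: contraNneq e0 => r0; rewrite -er r0 z2n.
have [r1 r10 e1] := rootn _ a1n; have [r2 r20 e2] := rootn _ a2n.
have [r3 r30 e3] := rootn _ a3n.
pose D : 'M[K]_3 := mx3 (row3 r1 0 0) (row3 0 r2 0) (row3 0 0 r3).
have eD r s t : row3 r s t *m D = row3 (r * r1) (s * r2) (t * r3).
  by rewrite mul_mx3 !row3Z !row3D; congr row3; ring.
have uD : D \in unitmx.
  have : mx3 (row3 r1^-1 0 0) (row3 0 r2^-1 0) (row3 0 0 r3^-1) *m D = 1%:M.
    by rewrite mul_row_mx3 !eD !mul0r !mulVf // mx3_1.
  by case/mulmx1_unit.
exists (b1 / (r1 ^+ n * r2 ^+ n)), (b2 / (r2 ^+ n * r3 ^+ n)), (b3 / (r3 ^+ n * r1 ^+ n)).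
have uA : invmx M *m D \in unitmx by rewrite unitmx_mul unitmx_inv uM.
exists (invmx M *m D) => // v; rewrite /on_curve.
have -> : (v *m (invmx M *m D) != 0) = (v != 0).
  apply/idP/idP; first by apply: contraNneq => ->; rewrite mul0mx.
  by apply: contraNneq => e; rewrite -(mulmxK uA v) e mul0mx.
suff -> : (family_form n (b1 / (r1 ^+ n * r2 ^+ n)) (b2 / (r2 ^+ n * r3 ^+ n))
   (b3 / (r3 ^+ n * r1 ^+ n))).@[(v *m (invmx M *m D)) 0] = F.@[v 0] by [].
rewrite family_form_meval mulmxA -[in RHS](mulmxKV uM v); move: (v *m invmx M) => u.
rewrite -meval_subst_lin [u]row3_eta FE eD !mxE /vec3 /= /family_eval !exprMn e1 e2 e3.
by field; rewrite !expf_neq0.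
Qed.

End Forward.

(** * The homologies of the family *)

Lemma at_least_leq (T : Type) (eqv : T -> T -> Prop) (S : T -> Prop) (m m' : nat) :
  (m' <= m)%N -> at_least eqv S m -> at_least eqv S m'.
Proof.
move=> le_m [x [Sx xneq]]; exists (fun i => x (widen_ord le_m i)); split=> // i j /xneq.
by move/(congr1 val) => /= e; apply/val_inj.
Qed.

(** * Matrices preserving the curve as birational maps *)

Section LinearMaps.

Variables (K : closedFieldType) (F : {mpoly K[3]}).
Implicit Types (T S : 'M[K]_3) (v : 'rV[K]_3).

Lemma lin_tuple_comp T S : ratmap_comp (lin_tuple T) (lin_tuple S) = lin_tuple (S *m T).
Proof.
apply: eq_from_tnth => i; rewrite !tnth_mktuple rmorph_sum /=.
transitivity (\sum_j \sum_k (S k j * T j i) *: ('X_k : {mpoly K[3]})).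
  apply: eq_bigr => j _; rewrite comp_mpolyZ comp_mpolyXU -tnth_nth tnth_mktuple.
  by rewrite scaler_sumr; apply: eq_bigr => k _; rewrite scalerA mulrC.
rewrite exchange_big; apply: eq_bigr => k _ /=.
by rewrite mxE scaler_suml.
Qed.

Lemma ratmap_id_lin : ratmap_id K = lin_tuple 1%:M.
Proof.
apply: eq_from_tnth => i; rewrite !tnth_mktuple (bigD1 i) //= big1 ?addr0.
  by rewrite mxE eqxx scale1r.
by move=> j ji; rewrite mxE (negPf ji) scale0r.
Qed.

Hypothesis curve_pt : exists v, on_curve F v.

Lemma ratmap_lin T : T \in unitmx -> ratmap F (lin_tuple T).
Proof.
move=> uT; split; first by exists 1%N => i; apply: lin_tuple_homog.
have [v [v0 Fv]] := curve_pt.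
have /rV0Pn [j vTj] : v *m T != 0.
  by apply: contraNneq v0 => e; rewrite -(mulmxK uT v) e mul0mx.
by exists j => /(_ v (conj v0 Fv)); rewrite meval_lin_tuple => /eqP; apply/negP.
Qed.

Lemma ratmap_eq_refl T : T \in unitmx -> ratmap_eq F (lin_tuple T) (lin_tuple T).
Proof.
move=> uT; split; try exact: ratmap_lin.
by move=> i j v _; rewrite mulrC subrr meval0.
Qed.

Definition curve_automorphism T : Prop :=
  T \in unitmx /\ forall v, on_curve F v <-> on_curve F (v *m T).

Lemma self_ratmap_lin T : curve_automorphism T -> self_ratmap F (lin_tuple T).
Proof.
case=> uT aT; split; first exact: ratmap_lin.
move=> v /aT [_ FvT]; rewrite -FvT; apply: meval_comp => i.
by rewrite meval_lin_tuple.
Qed.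

Lemma Bir_lin T : curve_automorphism T -> Bir F (lin_tuple T).
Proof.
move=> aT; split; first exact: self_ratmap_lin.
have [uT hT] := aT; have aT' : curve_automorphism (invmx T).
  by split=> [|v]; rewrite ?unitmx_inv // (hT (v *m invmx T)) mulmxKV.
exists (lin_tuple (invmx T)); split; first exact: self_ratmap_lin.
  by rewrite lin_tuple_comp ratmap_id_lin mulmxV //; apply: ratmap_eq_refl; apply: unitmx1.
by rewrite lin_tuple_comp ratmap_id_lin mulVmx //; apply: ratmap_eq_refl; apply: unitmx1.
Qed.

End LinearMaps.

Section Family.

Variables (K : closedFieldType) (charK : [pchar K] =i pred0).
Variables (F : {mpoly K[3]}) (n : nat) (n_ge2 : (1 < n)%N) (a b c : K) (A : 'M[K]_3).
Hypothesis uA : A \in unitmx.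

Local Notation H := (family_form n a b c).

Hypothesis FH : forall v, on_curve F v <-> on_curve H (v *m A).

Let n0 : (0 < n)%N := ltnW n_ge2.

Lemma family_form_homog : H \is (2 * n).-homog.
Proof.
have h (i : 'I_3) m : ('X_i ^+ m : {mpoly K[3]}) \is m.-homog.
  by have := dhomogMn m (dhomog_var K i); rewrite mul1n.
have h2 (i j : 'I_3) : ('X_i ^+ n * 'X_j ^+ n : {mpoly K[3]}) \is (2 * n).-homog.
  by rewrite mul2n -addnn dhomogM.
by rewrite /family_form !rpredD //; first [exact: h | exact: (dhomogZ _ (h2 _ _))].
Qed.

Let e (i : 'I_3) : 'rV[K]_3 := delta_mx 0 i.

Lemma family_form_e i : H.@[e i 0] = 1.
Proof.
rewrite family_form_meval /family_eval /e !mxE; move: i.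
have [zn z2n] : (0 : K) ^+ n = 0 /\ (0 : K) ^+ (2 * n) = 0.
  by rewrite !expr0n !gtn_eqF //; lia.
by apply: ord3P; rewrite /= ?mulr1n ?mulr0n ?zn ?z2n ?expr1n; ring.
Qed.

Definition homology (i : 'I_3) (z : K) : 'M[K]_3 := 1%:M + (z - 1) *: delta_mx i i.

Lemma mul_homology i z (v : 'rV[K]_3) j :
  (v *m homology i z) 0 j = if j == i then z * v 0 j else v 0 j.
Proof.
rewrite /homology mulmxDr mulmx1 -scalemxAr !mxE.
rewrite (bigD1 i) //= big1 => [|k ki]; last by rewrite mxE (negPf ki) mulr0.
by rewrite mxE eqxx addr0; case: eqP => [->|_] /=; ring.
Qed.

Lemma homologyM i z z' : homology i z *m homology i z' = homology i (z * z').
Proof.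
apply/row_matrixP => j; apply/rowP => k; rewrite row_mul !rowE.
rewrite mul_homology [in RHS]mul_homology mul_homology.
by case: eqP => // _; ring.
Qed.

Lemma homology1 i : homology i 1 = 1%:M.
Proof. by rewrite /homology subrr scale0r addr0. Qed.

Lemma homology_inv i z (v : 'rV[K]_3) : z ^+ n = 1 -> H.@[(v *m homology i z) 0] = H.@[v 0].
Proof.
move=> zn; rewrite !family_form_meval /family_eval !mul_homology.
have z2n : z ^+ (2 * n) = 1 by rewrite mulnC exprM zn expr1n.
by move: i; apply: ord3P; rewrite /= !exprMn ?zn ?z2n !mul1r.
Qed.

Definition curve_homology i z : 'M[K]_3 := A *m homology i z *m invmx A.

Lemma curve_homologyA i z (v : 'rV[K]_3) : v *m curve_homology i z *m A = v *m A *m homology i z.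
Proof. by rewrite /curve_homology !mulmxA mulmxKV. Qed.

Lemma curve_homology_aut i z : z ^+ n = 1 -> curve_automorphism F (curve_homology i z).
Proof.
move=> zn; have z0 : z != 0.
  by apply/eqP => z0; move: zn; rewrite z0 expr0n gtn_eqF // => /eqP; rewrite eq_sym oner_eq0.
have uD : homology i z \in unitmx.
  have : homology i z *m homology i z^-1 = 1%:M by rewrite homologyM divff // homology1.
  by case/mulmx1_unit.
split=> [|v]; first by rewrite !unitmx_mul uA uD unitmx_inv.
rewrite !FH curve_homologyA /on_curve homology_inv //.
suff -> : (v *m A *m homology i z != 0) = (v *m A != 0) by [].
apply/idP/idP; first by apply: contraNneq => ->; rewrite mul0mx.
by apply: contraNneq => e0; rewrite -(mulmxK uD (v *m A)) e0 mul0mx.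
Qed.

(** The curve meets the line x_i = x_j because the coefficient of x_k^(2n) is 1. Such a point
    witnesses that coordinates do not vanish on C and separates homologies of different ratios. *)
Lemma family_point i j k : i != j -> i != k -> j != k ->
  exists v, [/\ on_curve F v, (v *m A) 0 i = 1 & (v *m A) 0 j = 1].
Proof.
move=> ij ik jk; pose r := restr H (e i + e j) (e k).
have /closed_rootP [s] : size r != 1%N.
  apply/eqP => sr; have := coef_top_restr (e i + e j) (e k) family_form_homog.
  rewrite nth_default; last by rewrite -/r sr; lia.
  by rewrite family_form_e => /eqP; rewrite eq_sym oner_eq0.
rewrite /root horner_restr => /eqP Hs; set u := e i + e j + s *: e k in Hs.
have ui : u 0 i = 1 by rewrite !mxE !eqxx (negPf ij) (negPf ik) mulr0 !addr0.
have uj : u 0 j = 1.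
  by rewrite !mxE !eqxx eq_sym (negPf ij) (negPf jk) mulr0 addr0 add0r.
exists (u *m invmx A); rewrite mulmxKV //; split=> //.
rewrite FH mulmxKV //; split=> //.
by apply/eqP => u0; move: ui; rewrite u0 mxE => /eqP; rewrite eq_sym oner_eq0.
Qed.

Lemma family_curve_pt : exists v, on_curve F v.
Proof.
by have [||| v [Cv _ _]] := @family_point 0 1 2%:R; try exists v.
Qed.

Let P i : 'rV[K]_3 := e i *m invmx A.

Lemma curve_homology_G i z : z ^+ n = 1 -> G F (P i) (lin_tuple (curve_homology i z)).
Proof.
move=> zn; have aut := curve_homology_aut i zn.
split; first exact: (Bir_lin family_curve_pt).
pose l : 2.-tuple {mpoly K[3]} := [tuple tnth (lin_tuple A) (lift i k) | k < 2].
have lE k (v : 'rV[K]_3) : (tnth l k).@[v 0] = (v *m A) 0 (lift i k).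
  by rewrite tnth_mktuple meval_lin_tuple.
have lh k : tnth l k \is 1.-homog by rewrite tnth_mktuple lin_tuple_homog.
have i0 : i != lift i 0 by exact: neq_lift.
have i1 : i != lift i 1 by exact: neq_lift.
have i01 : lift i 0 != lift i 1 by apply/eqP => /lift_inj.
have [u [Cu ui uj]] := family_point i0 i1 i01.
have compE k (v : 'rV[K]_3) : (tnth (ratmap_comp l (lin_tuple (curve_homology i z))) k).@[v 0] =
    (tnth l k).@[v 0].
  rewrite tnth_mktuple (@meval_comp _ _ _ _ (v *m curve_homology i z)) => [|j].
    by rewrite !lE curve_homologyA mul_homology [lift _ _ == _]eq_sym (negPf (neq_lift _ _)).
  by rewrite meval_lin_tuple.
exists l.
  split=> // v v0; split=> [vl|[s s0 ->] k]; last first.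
    by rewrite lE -scalemxAl mulmxKV // !mxE [lift _ _ == _]eq_sym (negPf (neq_lift _ _)) andbF mulr0.
  have ev : v *m A = (v *m A) 0 i *: e i.
    apply/rowP => j; rewrite [RHS]mxE [e i 0 j]mxE eqxx /=.
    by case: (unliftP i j) => [k ->|->]; rewrite ?eqxx ?mulr1 // -lE vl [lift _ _ == _]eq_sym
      (negPf (neq_lift _ _)) mulr0.
  exists ((v *m A) 0 i); last by rewrite scalemxAl -ev mulmxK.
  apply: contraNneq v0 => vi0; rewrite -(mulmxK uA v) ev vi0 scale0r mul0mx //.
have rl : ratmap F l.
  split; first by exists 1%N.
  by exists 0 => /(_ u Cu); rewrite lE uj => /eqP; rewrite oner_eq0.
split=> //; last by move=> j k v _; rewrite mevalB !mevalM !compE mulrC subrr.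
split; last by exists 0 => /(_ u Cu); rewrite compE lE uj => /eqP; rewrite oner_eq0.
exists 1%N => k; rewrite tnth_mktuple -[1%N]/(1 * 1)%N.
by apply: comp_homog => // j; apply: lin_tuple_homog.
Qed.

Lemma curve_homology_inj i z z' :
  ratmap_eq F (lin_tuple (curve_homology i z)) (lin_tuple (curve_homology i z')) -> z = z'.
Proof.
case=> _ _ eqr.
have i0 : i != lift i 0 by exact: neq_lift.
have i1 : i != lift i 1 by exact: neq_lift.
have i01 : lift i 0 != lift i 1 by apply/eqP => /lift_inj.
have [v [Cv vi vj]] := family_point i0 i1 i01.
have col p q : (v *m curve_homology i z) 0 p * (v *m curve_homology i z') 0 q =
    (v *m curve_homology i z) 0 q * (v *m curve_homology i z') 0 p.
  have := eqr p q v Cv; rewrite mevalB !mevalM !meval_lin_tuple => /eqP.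
  by rewrite subr_eq0 => /eqP.
have := collinear_mul A col i (lift i 0).
rewrite !curve_homologyA !mul_homology eqxx eq_sym (negPf i0).
by rewrite vi vj !mulr1 mul1r.
Qed.

(** At each coordinate point the powers of a primitive n-th root of unity give n distinct
    homologies, and the point is off the curve because the pure powers have coefficient 1. *)
Lemma three_points : delta'_ge F n 3.
Proof.
have oG i : order_G_ge F (P i) n.
  have [z zp] := prim_root_exists charK n0.
  exists (fun k : 'I_n => lin_tuple (curve_homology i (z ^+ k))); split=> [k|k l].
    by apply: curve_homology_G; rewrite exprAC (prim_expr_order zp) expr1n.
  move=> /curve_homology_inj /eqP; rewrite (eq_prim_root_expr zp) !modn_small //.
  by move=> /eqP; apply: val_inj.
have eP i : P i *m A = e i by rewrite mulmxKV.
have e0 i : e i != 0.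
  by apply/eqP => /rowP /(_ i); rewrite !mxE !eqxx; apply/eqP/oner_neq0.
exists P; split=> [i|i j].
  split=> //; last exact: at_least_leq (oG i).
    by apply: contraNneq (e0 i) => P0; rewrite -eP P0 mul0mx.
  by rewrite FH eP => -[_ /eqP]; rewrite family_form_e oner_eq0.
case=> s s0 ePj; apply/eqP; have := eP j; rewrite ePj -scalemxAl eP => /rowP /(_ j).
rewrite !mxE !eqxx /= => es; apply/negPn/negP => ij.
by move: es; rewrite eq_sym (negPf ij) mulr0 => /eqP; rewrite eq_sym oner_eq0.
Qed.

End Family.

Theorem theorem4p9 (K : closedFieldType) (charK : [pchar K] =i pred0)
    (F : {mpoly K[3]}) (d n : nat)
    (smoothC : smooth_plane_curve F d)
    (d_ge14 : (14 <= d)%N) (d_even : ~~ odd d) (n_def : n = (d %/ 2)%N) :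
  (delta'_ge F n 2 <->
     exists a b c : K, projectively_equivalent F (family_form n a b c)) /\
  (delta'_ge F n 2 -> delta'_eq F n 3).
Proof.
have [hF sF] := smooth_plane_curveP smoothC.
have d2n : d = (2 * n)%N by lia.
rewrite {}d2n in hF d_ge14 *.
have n_ge5 : (4 < n)%N by lia.
have fwd := family_of_two_points charK hF sF n_ge5.
have bwd : (exists a b c : K, projectively_equivalent F (family_form n a b c)) ->
    delta'_ge F n 3.
  by move=> [a [b [c [A uA FH]]]]; apply: (three_points charK _ uA FH); lia.
split; first by split=> [/fwd //|/bwd]; apply: at_least_leq.
move=> /fwd /bwd d3; split=> //.
exact: (no_four_points charK hF sF n_ge5).
Qed.
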